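(* Forget restricted to instances whose query is nonrecursive, connected, and whose rules contain no time points, is in PTIME in data complexity (i.e., when the query is fixed), with numbers encoded in unary.
   Context: Temporal Datalog. Constants are partitioned into objects and integer time points; variables into object variables and time variables. A time term is a time point, a time variable, or an expression $t+k$ with $t$ a time variable and $k\in\mathbb{Z}$. Each predicate is either extensional (EDB) or intensional (IDB) and has an arity $n\ge0$, each position being of object sort or time sort; a predicate is rigid if all its positions are of object sort, and temporal if its last position is of time sort and all others are of object sort. An atom $P(t_1,\dots,t_n)$ has terms of the required sorts. A rule is $\bigwedge_i\alpha_i\to\alpha$ with $\alpha$ and all $\alpha_i$ rigid or temporal atoms, $\alpha$ IDB whenever the body is nonempty, and every head variable occurring in the body. A program is a finite set of rules. A fact is a ground rigid or temporal atom without $+$ (identified with the rule $\top\to\alpha$); a dataset is a finite set of EDB facts. Rules are read as universally quantified first-order sentences with $+$ interpreted as integer addition; $\Pi\models\alpha$ denotes entailment. A query is $Q=\langle P_Q,\Pi_Q\rangle$ with $\Pi_Q$ a program and $P_Q$ an IDB predicate of $\Pi_Q$; it is temporal if $P_Q$ is temporal. For a temporal query $Q$, dataset $D$ and time point $\tau$, $Q(D,\tau)$ is the set of tuples of objects $\vec o$ with $\Pi_Q\cup D\models P_Q(\vec o,\tau)$. For a dataset $D$ and time point $\tau$, $D[\tau]$ is the set of all rigid facts of $D$ together with the temporal facts of $D$ whose time argument is $>\tau$. A $\tau_{in}$-history is a dataset consisting of rigid facts and temporal facts with time argument $\le\tau_{in}$; a $\tau_{in}$-update is a dataset consisting of temporal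 facts with time argument $>\tau_{in}$. Forget: an instance is $\langle Q,D,\tau_{in},\tau_{out},\tau_{mem}\rangle$ with $Q$ a temporal query, $D$ a $\tau_{in}$-history and $\tau_{mem}\le\tau_{out}\le\tau_{in}$; Forget holds for it iff $Q(D\cup U,\tau)=Q(D[\tau_{mem}]\cup U,\tau)$ for every $\tau_{in}$-update $U$ and every time point $\tau\ge\tau_{out}$. Predicate $P$ depends on $P'$ in $\Pi$ if some rule of $\Pi$ has $P$ in the head and $P'$ in the body; $\Pi$ (or a query with program $\Pi$) is nonrecursive if the graph of this dependency relation is acyclic. A rule is connected if it contains at most one time variable and, if a time variable occurs in the body, it also occurs in the head; a query is connected if all its rules are. *)

(* Defs.v *)
From Stdlib Require Import ZArith List Arith Relations.
Import ListNotations.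
Open Scope Z_scope.

Inductive sort := SObj | STime.

Record pred := mkPred { pname : nat; psorts : list sort; pedb : bool }.

Definition rigid (P : pred) : Prop := Forall (fun s => s = SObj) (psorts P).
Definition temporal (P : pred) : Prop :=
  exists rest, psorts P = rest ++ [STime] /\ Forall (fun s => s = SObj) rest.

Inductive oterm := OConst (o : nat) | OVar (x : nat).
Inductive tterm := TConst (t : Z) | TVar (x : nat) | TShift (x : nat) (k : Z).
Inductive term := TObj (o : oterm) | TTm (t : tterm).

Record atom := mkAtom { apred : pred; aargs : list term }.

Definition term_has_sort (t : term) (s : sort) : Prop :=
  match t, s with TObj _, SObj => True | TTm _, STime => True | _, _ => False end.

Definition well_sorted (a : atom) : Prop := Forall2 term_has_sort (aargs a) (psorts (apred a)).
Definition atom_ok (a : atom) : Prop :=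
  well_sorted a /\ (rigid (apred a) \/ temporal (apred a)).

Definition term_ovars (t : term) : list nat :=
  match t with TObj (OVar x) => [x] | _ => [] end.
Definition term_tvars (t : term) : list nat :=
  match t with TTm (TVar x) => [x] | TTm (TShift x _) => [x] | _ => [] end.
Definition atom_ovars (a : atom) : list nat := flat_map term_ovars (aargs a).
Definition atom_tvars (a : atom) : list nat := flat_map term_tvars (aargs a).

Record rule := mkRule { body : list atom; head : atom }.

Definition rule_wf (r : rule) : Prop :=
  atom_ok (head r) /\ Forall atom_ok (body r) /\
  (body r <> [] -> pedb (apred (head r)) = false) /\
  (forall x, In x (atom_ovars (head r)) -> In x (flat_map atom_ovars (body r))) /\
  (forall x, In x (atom_tvars (head r)) -> In x (flat_map atom_tvars (body r))).

Definition program := list rule.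
Definition program_wf (P : program) : Prop := Forall rule_wf P.

Inductive val := VObj (o : nat) | VTime (t : Z).
Definition gatom : Type := (pred * list val)%type.

Definition eval_term (vo : nat -> nat) (vt : nat -> Z) (t : term) : val :=
  match t with
  | TObj (OConst o) => VObj o
  | TObj (OVar x) => VObj (vo x)
  | TTm (TConst z) => VTime z
  | TTm (TVar x) => VTime (vt x)
  | TTm (TShift x k) => VTime (vt x + k)
  end.
Definition eval_atom vo vt (a : atom) : gatom := (apred a, map (eval_term vo vt) (aargs a)).

Definition rule_sat (I : gatom -> Prop) (r : rule) : Prop :=
  forall vo vt, (forall b, In b (body r) -> I (eval_atom vo vt b)) -> I (eval_atom vo vt (head r)).
Definition is_model (I : gatom -> Prop) (P : program) : Prop := forall r, In r P -> rule_sat I r.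
Definition entails (P : program) (g : gatom) : Prop := forall I, is_model I P -> I g.

Definition term_ground (t : term) : Prop :=
  match t with TObj (OConst _) => True | TTm (TConst _) => True | _ => False end.
Definition is_fact (a : atom) : Prop := atom_ok a /\ Forall term_ground (aargs a).
Definition fact_rule (a : atom) : rule := mkRule [] a.

Definition dataset := list atom.
Definition is_dataset (D : dataset) : Prop :=
  Forall (fun a => is_fact a /\ pedb (apred a) = true) D.

Definition fact_time (a : atom) : option Z :=
  match last (aargs a) (TObj (OVar 0)) with TTm (TConst t) => Some t | _ => None end.

Definition restrict (D : dataset) (tau : Z) : dataset :=
  filter (fun a => match fact_time a with None => true | Some t => Z.ltb tau t end) D.

Definition is_history (tin : Z) (D : dataset) : Prop :=
  is_dataset D /\ Forall (fun a => forall t, fact_time a = Some t -> t <= tin) D.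
Definition is_update (tin : Z) (U : dataset) : Prop :=
  is_dataset U /\ Forall (fun a => temporal (apred a) /\
                                   exists t, fact_time a = Some t /\ tin < t) U.

Record query := mkQuery { qpred : pred; qprog : program }.

Definition query_wf (Q : query) : Prop :=
  program_wf (qprog Q) /\ pedb (qpred Q) = false /\
  exists r, In r (qprog Q) /\ (apred (head r) = qpred Q \/ exists b, In b (body r) /\ apred b = qpred Q).
Definition temporal_query (Q : query) : Prop := temporal (qpred Q).

Definition answer (Q : query) (D : dataset) (tau : Z) (os : list nat) : Prop :=
  entails (qprog Q ++ map fact_rule D) (qpred Q, map VObj os ++ [VTime tau]).

Definition depends (P : program) (p p' : pred) : Prop :=
  exists r, In r P /\ apred (head r) = p /\ exists b, In b (body r) /\ apred b = p'.
Definition nonrecursive (Q : query) : Prop :=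
  forall p, ~ clos_trans pred (depends (qprog Q)) p p.

Definition rule_tvars (r : rule) : list nat := flat_map atom_tvars (head r :: body r).
Definition rule_connected (r : rule) : Prop :=
  (forall x y, In x (rule_tvars r) -> In y (rule_tvars r) -> x = y) /\
  (forall x, In x (flat_map atom_tvars (body r)) -> In x (atom_tvars (head r))).
Definition connected (Q : query) : Prop := Forall rule_connected (qprog Q).

Definition term_no_timepoint (t : term) : Prop :=
  match t with TTm (TConst _) => False | _ => True end.
Definition atom_no_timepoint (a : atom) : Prop := Forall term_no_timepoint (aargs a).
Definition no_time_points (Q : query) : Prop :=
  Forall (fun r => atom_no_timepoint (head r) /\ Forall atom_no_timepoint (body r)) (qprog Q).

Record instance := mkInst { idata : dataset; itin : Z; itout : Z; itmem : Z }.

Definition valid_instance (i : instance) : Prop :=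
  is_history (itin i) (idata i) /\ itmem i <= itout i /\ itout i <= itin i.

Definition Forget (Q : query) (i : instance) : Prop :=
  forall U tau, is_update (itin i) U -> itout i <= tau ->
  forall os, answer Q (idata i ++ U) tau os <-> answer Q (restrict (idata i) (itmem i) ++ U) tau os.

(* ---------- Encoding of the data part of an instance ----------
   Alphabet symbols 1..5 (0 is the blank).  Objects in binary (digits 1,2),
   integers (time points) in unary: a sign symbol followed by |z| ones. *)
Fixpoint pos_bits (p : positive) : list nat :=
  match p with xH => [2%nat] | xO q => pos_bits q ++ [1%nat] | xI q => pos_bits q ++ [2%nat] end.
Definition bin (n : nat) : list nat :=
  match N.of_nat n with N0 => [] | Npos p => pos_bits p end.
Definition unary (z : Z) : list nat :=
  (if Z.ltb z 0 then 2%nat else 1%nat) :: repeat 1%nat (Z.abs_nat z).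
Definition enc_arg (t : term) : list nat :=
  match t with
  | TObj (OConst o) => 3%nat :: 1%nat :: bin o
  | TTm (TConst z) => 3%nat :: 2%nat :: unary z
  | _ => [3%nat]
  end.
Definition enc_fact (a : atom) : list nat :=
  bin (pname (apred a)) ++ flat_map enc_arg (aargs a) ++ [4%nat].
Definition enc_instance (i : instance) : list nat :=
  flat_map enc_fact (idata i) ++ [5%nat] ++ unary (itin i) ++ [5%nat] ++
  unary (itout i) ++ [5%nat] ++ unary (itmem i).

Inductive move := MLeft | MRight | MStay.
Record TM := mkTM { tm_states : nat; tm_syms : nat; tm_start : nat; tm_acc : nat; tm_rej : nat;
                    tm_delta : nat -> nat -> nat * nat * move }.

Definition tm_wf (M : TM) : Prop :=
  (6 <= tm_syms M)%nat /\ (tm_start M < tm_states M)%nat /\ (tm_acc M < tm_states M)%nat /\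
  (tm_rej M < tm_states M)%nat /\ tm_acc M <> tm_rej M /\
  forall q a, (q < tm_states M)%nat -> (a < tm_syms M)%nat ->
    let '(q', b, _) := tm_delta M q a in (q' < tm_states M)%nat /\ (b < tm_syms M)%nat.

(* configuration: state, left tape (reversed), scanned symbol, right tape; 0 = blank *)
Definition config : Type := (nat * list nat * nat * list nat)%type.
Definition cstate (c : config) : nat := let '(q, _, _, _) := c in q.
Definition halted (M : TM) (c : config) : bool :=
  Nat.eqb (cstate c) (tm_acc M) || Nat.eqb (cstate c) (tm_rej M).

Definition step (M : TM) (c : config) : config :=
  if halted M c then c else
  let '(q, l, a, r) := c in
  let '(q', b, m) := tm_delta M q a in
  match m with
  | MLeft => match l with [] => (q', [], 0%nat, b :: r) | x :: l' => (q', l', x, b :: r) end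
  | MRight => match r with [] => (q', b :: l, 0%nat, []) | x :: r' => (q', b :: l, x, r') end
  | MStay => (q', l, b, r)
  end.
Definition init (M : TM) (w : list nat) : config :=
  match w with [] => (tm_start M, [], 0%nat, []) | x :: r => (tm_start M, [], x, r) end.
Definition run (M : TM) (k : nat) (c : config) : config := Nat.iter k (step M) c.

Definition ptime_decidable {I : Type} (valid : I -> Prop) (enc : I -> list nat) (P : I -> Prop) : Prop :=
  exists M : TM, tm_wf M /\ exists c d : nat, forall i, valid i ->
    exists k, (k <= c * (S (length (enc i))) ^ d)%nat /\
      halted M (run M k (init M (enc i))) = true /\
      (cstate (run M k (init M (enc i))) = tm_acc M <-> P i).

(* Main.v *)
Require Import Defs.
From Stdlib Require Import ZArith NArith List Lia Arith Relations Classical FunctionalExtensionality.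
Import ListNotations.
Open Scope nat_scope.

(** Derivations of a nonrecursive connected program have bounded depth, so each of them uses boundedly
    many facts, all at bounded distance from the time of the derived fact.  Hence, if Forget fails, then
    it fails at some [tau] with [tau - tau_mem] bounded and for an update of bounded size whose objects
    are objects of [D], constants of the program or some of boundedly many fresh objects.  For a fixed
    program, derivability is a first-order property of these objects.  Such a property is evaluated
    with finitely many pointers into the word that encodes the instance: quantifiers are loops over the
    positions of the word, equality of names is a simultaneous scan.  A computation with finitely many
    pointers into a read-only word that halts does so after polynomially many steps, because it cannot
    repeat a configuration, and a Turing machine that keeps the pointers as marks on its tape performs
    each of these steps in two sweeps. *)

(** * Pointer machines and their simulation by a Turing machine *)

(** A lost answer at [tau] has a derivation that uses a forgotten fact, which lies at or before
    [tau_mem], whereas [tau] lies at or after it; the bounded distance of the two bounds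
    [tau - tau_mem]. As rules are connected and contain no time points, the time of a goal
    determines the times of its subgoals by offsets of the program. So all times that matter have
    the form [tau_mem + j] with [j] from a finite set fixed by the query, and no quantifier over
    times is needed. In unary, adding a constant means appending or removing a fixed number of ones,
    apart from finitely many small values, and pointers can check this. The domain of objects may be
    cut down because derivations survive every renaming that fixes the constants of the rules. A
    counterexample also asserts that some derivation does not exist, so the renaming of the objects
    of the update needs a left inverse that carries derivations back. *)

Lemma Forall_in {A} {P : A -> Prop} {l} : Forall P l -> forall x, In x l -> P x.
Proof. apply Forall_forall. Qed.

Definition store := nat -> nat.
Definition upd (s : store) (p x : nat) : store := fun q => if q =? p then x else s q.

Lemma upd_eq s p x : upd s p x p = x.
Proof. unfold upd. now rewrite Nat.eqb_refl. Qed.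

Lemma upd_neq s p x q : q <> p -> upd s p x q = s q.
Proof. unfold upd. intros H. now apply Nat.eqb_neq in H as ->. Qed.

(** The default is the blank 0, so a pointer at [length w] is legal and reads a symbol that the
    encoded word does not contain; this is how programs see the end. *)
Definition sym (w : list nat) (x : nat) : nat := nth x w 0.

Inductive op := OReset (p : nat) | OInc (p : nat) | OSym (p a : nat) | OEq (p q : nat).

Definition op_ptr (o : op) : nat :=
  match o with OReset p => p | OInc p => p | OSym p _ => p | OEq p _ => p end.

Definition op_test (w : list nat) (o : op) (s : store) : bool :=
  match o with
  | OSym p a => sym w (s p) =? a
  | OEq p q => s p =? s q
  | _ => true
  end.

(** An increment at the end of the word does nothing. Pointers therefore stay in [0 .. length w],
    and finitely many of them have only polynomially many joint values. *)
Definition op_eff (w : list nat) (o : op) (s : store) : store :=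
  match o with
  | OReset p => upd s p 0
  | OInc p => if s p <? length w then upd s p (S (s p)) else s
  | _ => s
  end.

Definition op_below (K : nat) (o : op) : Prop :=
  match o with OEq p q => p < K /\ q < K | _ => op_ptr o < K end.

Definition instr : Type := op * nat * nat.

(** A program counter outside the program means that the computation has stopped; the address at
    which it stops carries the answer. *)
Definition gstep (prog : list instr) (w : list nat) (c : nat * store) : nat * store :=
  match nth_error prog (fst c) with
  | Some (o, lt, lf) => (if op_test w o (snd c) then lt else lf, op_eff w o (snd c))
  | None => c
  end.

(** * Sets of marks as tape symbols *)

Section Marks.
Variable K : nat.

Fixpoint bits (k : nat) (f : nat -> bool) : nat :=
  match k with
  | 0 => 0
  | S k' => Nat.b2n (f 0) + 2 * bits k' (fun p => f (S p))
  end.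

Lemma bits_bound k f : bits k f < 2 ^ k.
Proof.
  revert f; induction k as [|k IH]; intros f; cbn [bits Nat.pow]; [lia|].
  specialize (IH (fun p => f (S p))). destruct (f 0); simpl Nat.b2n; lia.
Qed.

Lemma bits_testbit k f p : p < k -> Nat.testbit (bits k f) p = f p.
Proof.
  revert f p; induction k as [|k IH]; intros f p Hp; [lia|].
  cbn [bits]. destruct p as [|p].
  - apply Nat.add_b2n_double_bit0.
  - transitivity (Nat.testbit (Nat.div2 (Nat.b2n (f 0) + 2 * bits k (fun p => f (S p)))) p); [reflexivity|].
    rewrite Nat.div2_div, Nat.add_b2n_double_div2. apply (IH (fun p => f (S p))); lia.
Qed.

Lemma bits_ext k f g : (forall p, p < k -> f p = g p) -> bits k f = bits k g.
Proof.
  revert f g; induction k as [|k IH]; intros f g H; cbn [bits]; [reflexivity|].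
  rewrite (H 0) by lia. f_equal. f_equal. apply IH. intros p Hp. apply H; lia.
Qed.

(* A tape symbol is a base symbol below 6 with a set of marks: mark [p < K] for pointer [p] and mark [K]
   for cell 0. *)
Definition mark (b : nat) (f : nat -> bool) : nat := b + 6 * bits (S K) f.
Definition base (a : nat) : nat := a mod 6.
Definition bit (p a : nat) : bool := Nat.testbit (a / 6) p.
Definition setb (p : nat) (v : bool) (a : nat) : nat :=
  mark (base a) (fun q => if q =? p then v else bit q a).
Definition nsyms : nat := 6 * 2 ^ S K.

Lemma mark_bound b f : b < 6 -> mark b f < nsyms.
Proof. unfold mark, nsyms. pose proof (bits_bound (S K) f). lia. Qed.

Lemma base_bound a : base a < 6.
Proof. apply Nat.mod_upper_bound; lia. Qed.

Lemma base_mark b f : b < 6 -> base (mark b f) = b.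
Proof.
  intros H. unfold base, mark. rewrite Nat.mul_comm, Nat.Div0.mod_add. now apply Nat.mod_small.
Qed.

Lemma bit_mark b f p : b < 6 -> p <= K -> bit p (mark b f) = f p.
Proof.
  intros H Hp. unfold bit, mark. rewrite Nat.mul_comm, Nat.div_add by lia.
  rewrite Nat.div_small by lia. apply bits_testbit. lia.
Qed.

Lemma mark_ext b f g : (forall p, p <= K -> f p = g p) -> mark b f = mark b g.
Proof. intros H. unfold mark. f_equal. f_equal. apply bits_ext. intros p Hp. apply H; lia. Qed.

Lemma setb_mark b f p v : b < 6 -> p <= K ->
  setb p v (mark b f) = mark b (fun q => if q =? p then v else f q).
Proof.
  intros H Hp. unfold setb. rewrite base_mark by assumption. apply mark_ext. intros q Hq.
  destruct (q =? p); [reflexivity|]. now apply bit_mark.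
Qed.

(** An input symbol is already a cell without marks, so the input needs no translation; only cell 0
    and the final blank have to be prepared. *)
Lemma mark_none b : mark b (fun _ => false) = b.
Proof.
  unfold mark. replace (bits (S K) (fun _ => false)) with 0; [lia|].
  generalize (S K) as k. induction k as [|k IH]; cbn [bits]; [reflexivity|]. rewrite <- IH. reflexivity.
Qed.

End Marks.

Lemma sym_bound w i : (forall x, In x w -> 0 < x < 6) -> sym w i < 6.
Proof.
  intros Hw. unfold sym. destruct (Nat.lt_ge_cases i (length w)) as [H|H].
  - destruct (Hw (nth i w 0)); [now apply nth_In|lia].
  - rewrite nth_overflow by assumption. lia.
Qed.

Lemma sym_zero w i : (forall x, In x w -> 0 < x < 6) -> sym w i = 0 <-> length w <= i.
Proof.
  intros Hw. unfold sym. destruct (Nat.lt_ge_cases i (length w)) as [H|H].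
  - destruct (Hw (nth i w 0)); [now apply nth_In|lia].
  - rewrite nth_overflow by assumption. lia.
Qed.

(** * The simulating Turing machine *)

Section Machine.
Variables (K : nat) (prog : list instr).
Let L := length prog.

(* Control state [5 * pc + phase]: phase 0 looks for the mark of the pointer of instruction [pc],
   phases 2 and 4 return to cell 0 with test result true and false, phase 1 returns to cell 0
   to put the pointer there, phase 3 puts the pointer down.  The states from [5 * L] on are:
   accept, reject, and three states that mark cell 0, append the final blank and come back. *)
Definition lab (l : nat) : nat := if l <? L then 5 * l else if l =? L then 5 * L else 5 * L + 1.

Definition found (pc : nat) (o : op) (a : nat) : nat * nat * move :=
  match o with
  | OReset p => (5 * pc + 1, setb K p false a, MStay)
  | OInc p => if base a =? 0 then (5 * pc + 2, a, MStay) else (5 * pc + 3, setb K p false a, MRight)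
  | OSym p b => (if base a =? b then 5 * pc + 2 else 5 * pc + 4, a, MStay)
  | OEq p q => (if bit q a then 5 * pc + 2 else 5 * pc + 4, a, MStay)
  end.

Definition instr_delta (pc ph : nat) (i : instr) (a : nat) : nat * nat * move :=
  let '(o, lt, lf) := i in
  match ph with
  | 0 => if bit (op_ptr o) a then found pc o a else (5 * pc, a, MRight)
  | 1 => if bit K a then (lab lt, setb K (op_ptr o) true a, MStay) else (5 * pc + 1, a, MLeft)
  | 2 => if bit K a then (lab lt, a, MStay) else (5 * pc + 2, a, MLeft)
  | 3 => (5 * pc + 2, setb K (op_ptr o) true a, MStay)
  | _ => if bit K a then (lab lf, a, MStay) else (5 * pc + 4, a, MLeft)
  end.

Definition delta (q a : nat) : nat * nat * move :=
  if q <? 5 * L then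
    match nth_error prog (q / 5) with
    | Some i => instr_delta (q / 5) (q mod 5) i a
    | None => (q, a, MStay)
    end
  else if q =? 5 * L + 2 then (5 * L + 3, mark K (base a) (fun _ => true), MRight)
  else if q =? 5 * L + 3 then
    if base a =? 0 then (5 * L + 4, a, MLeft) else (5 * L + 3, a, MRight)
  else if q =? 5 * L + 4 then
    if bit K a then (lab 0, a, MStay) else (5 * L + 4, a, MLeft)
  else (q, a, MStay).

Definition machine : TM := mkTM (5 * L + 5) (nsyms K) (5 * L + 2) (5 * L) (5 * L + 1) delta.

Lemma lab_bound l : lab l < 5 * L + 5.
Proof. unfold lab. destruct (Nat.ltb_spec l L), (Nat.eqb_spec l L); lia. Qed.

Lemma setb_bound p v a : setb K p v a < nsyms K.
Proof. apply mark_bound, base_bound. Qed.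

Lemma machine_wf : tm_wf machine.
Proof.
  unfold tm_wf; cbn [tm_states tm_syms tm_start tm_acc tm_rej tm_delta machine].
  repeat split; try lia.
  { unfold nsyms. pose proof (Nat.pow_nonzero 2 (S K)). lia. }
  intros q a Hq Ha. unfold delta.
  destruct (Nat.ltb_spec q (5 * L)) as [Hl|Hl].
  - assert (Hpc : q / 5 < L) by (apply Nat.Div0.div_lt_upper_bound; lia).
    assert (Hm : q mod 5 < 5) by (apply Nat.mod_upper_bound; lia).
    destruct (nth_error prog (q / 5)) as [[[o lt] lf]|]; [|lia].
    pose proof (lab_bound lt). pose proof (lab_bound lf).
    unfold instr_delta.
    destruct (q mod 5) as [|[|[|[|]]]];
      repeat match goal with
      | |- context [if ?b then _ else _] => destruct b
      end; try (split; [lia|try apply setb_bound; lia]).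
    unfold found. destruct o;
      repeat match goal with
      | |- context [if ?b then _ else _] => destruct b
      end; (split; [lia|try apply setb_bound; lia]).
  - pose proof (lab_bound 0).
    repeat match goal with
      | |- context [if ?b then _ else _] => destruct b
      end; (split; [lia|try lia]).
    apply mark_bound, base_bound.
Qed.

Lemma delta_instr pc ph i a : nth_error prog pc = Some i -> ph < 5 ->
  delta (5 * pc + ph) a = instr_delta pc ph i a.
Proof.
  intros Hi Hph. unfold delta.
  assert (Hpc : pc < L) by (apply nth_error_Some; congruence).
  destruct (Nat.ltb_spec (5 * pc + ph) (5 * L)); [|lia].
  assert (E1 : (5 * pc + ph) / 5 = pc).
  { rewrite Nat.mul_comm, Nat.div_add_l, Nat.div_small by lia. lia. }
  assert (E2 : (5 * pc + ph) mod 5 = ph).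
  { rewrite Nat.add_comm, Nat.mul_comm, Nat.Div0.mod_add. apply Nat.mod_small; lia. }
  now rewrite E1, E2, Hi.
Qed.

Variable w : list nat.
Hypothesis w_sym : forall x, In x w -> 0 < x < 6.
Let n := length w.

(** The mark of cell 0 is handled as one more pointer, number [K], which the assumption [s K = 0]
    keeps in place. *)
Definition cell (s : store) (i : nat) : nat := mark K (sym w i) (fun p => s p =? i).

(** The tape consists of exactly the cells [0 .. n]; the last one is a blank that carries the marks
    of pointers at the end of the word. *)
Definition conf (q : nat) (s : store) (h : nat) : config :=
  (q, rev (map (cell s) (seq 0 h)), cell s h, map (cell s) (seq (S h) (n - h))).

Lemma base_cell s i : base (cell s i) = sym w i.
Proof. apply base_mark, sym_bound, w_sym. Qed.

Lemma bit_cell s i p : p <= K -> bit p (cell s i) = (s p =? i).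
Proof. intros H. unfold cell. now rewrite bit_mark by (auto using sym_bound). Qed.

Lemma setb_cell s i p x : p <= K -> setb K p (x =? i) (cell s i) = cell (upd s p x) i.
Proof.
  intros H. unfold cell at 1. rewrite setb_mark by (auto using sym_bound). unfold cell.
  apply mark_ext. intros q Hq. unfold upd. now destruct (q =? p).
Qed.

Lemma cell_upd s i p x : (x =? i) = (s p =? i) -> cell (upd s p x) i = cell s i.
Proof.
  intros H. unfold cell. apply mark_ext. intros q Hq. unfold upd.
  destruct (Nat.eqb_spec q p); congruence.
Qed.

Lemma halted_false q : q <> 5 * L -> q <> 5 * L + 1 -> forall s h, halted machine (conf q s h) = false.
Proof.
  intros H1 H2 s h. unfold halted, conf; cbn [cstate tm_acc tm_rej machine].
  apply Nat.eqb_neq in H1, H2. now rewrite H1, H2.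
Qed.

Definition moved (mv : move) (h h' : nat) : Prop :=
  match mv with MStay => h' = h | MRight => h' = S h | MLeft => h = S h' end.

(** Covers all transitions at once: as the tape is a function of the store, writing a cell means
    passing to a store whose marks differ in that cell only. *)
Lemma step_conf q q' s s' h h' mv :
  q <> 5 * L -> q <> 5 * L + 1 ->
  delta q (cell s h) = (q', cell s' h, mv) ->
  moved mv h h' -> h <= n -> h' <= n ->
  (forall i, i <= n -> i <> h -> cell s' i = cell s i) ->
  step machine (conf q s h) = conf q' s' h'.
Proof.
  intros Hq1 Hq2 Hd Hm Hh Hh' Hc. unfold step. rewrite halted_false by assumption.
  unfold conf at 1. cbn [tm_delta machine]. rewrite Hd.
  assert (EL : map (cell s) (seq 0 h) = map (cell s') (seq 0 h)).
  { apply map_ext_in. intros i Hi. apply in_seq in Hi. symmetry. apply Hc; lia. }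
  assert (ER : map (cell s) (seq (S h) (n - h)) = map (cell s') (seq (S h) (n - h))).
  { apply map_ext_in. intros i Hi. apply in_seq in Hi. symmetry. apply Hc; lia. }
  rewrite EL, ER. unfold conf. destruct mv; cbn in Hm; subst.
  - rewrite seq_S, map_app, rev_app_distr. cbn.
    replace (n - h') with (S (n - S h')) by lia. reflexivity.
  - rewrite (seq_S h 0), map_app, rev_app_distr.
    replace (n - h) with (S (n - S h)) by lia. reflexivity.
  - reflexivity.
Qed.

Lemma run_add a b c : run machine (a + b) c = run machine b (run machine a c).
Proof. unfold run. rewrite Nat.add_comm. apply Nat.iter_add. Qed.

Lemma run_S a c : run machine (S a) c = run machine a (step machine c).
Proof. exact (run_add 1 a c). Qed.

Lemma sweep_right q s d h :
  q <> 5 * L -> q <> 5 * L + 1 -> h + d <= n ->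
  (forall i, h <= i < h + d -> delta q (cell s i) = (q, cell s i, MRight)) ->
  run machine d (conf q s h) = conf q s (h + d).
Proof.
  intros H1 H2. revert h; induction d as [|d IH]; intros h Hn Hd.
  - now rewrite Nat.add_0_r.
  - rewrite run_S, (step_conf q q s s h (S h) MRight); cbn; auto; try lia.
    + rewrite IH; [f_equal; lia|lia|]. intros i Hi. apply Hd; lia.
    + apply Hd; lia.
Qed.

Lemma sweep_left q s h :
  q <> 5 * L -> q <> 5 * L + 1 -> h <= n ->
  (forall i, 0 < i <= h -> delta q (cell s i) = (q, cell s i, MLeft)) ->
  run machine h (conf q s h) = conf q s 0.
Proof.
  intros H1 H2. induction h as [|h IH]; intros Hn Hd; [reflexivity|].
  rewrite run_S, (step_conf q q s s (S h) h MLeft); cbn; auto; try lia.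
  - apply IH; [lia|]. intros i Hi. apply Hd; lia.
  - apply Hd; lia.
Qed.

Lemma return_home q l s h :
  q <> 5 * L -> q <> 5 * L + 1 -> h <= n -> s K = 0 ->
  (forall a, delta q a = if bit K a then (l, a, MStay) else (q, a, MLeft)) ->
  run machine (S h) (conf q s h) = conf l s 0.
Proof.
  intros H1 H2 Hn HK Hd. rewrite <- (Nat.add_1_r h), run_add, sweep_left; auto.
  - cbn. apply (step_conf q l s s 0 0 MStay); cbn; auto; try lia.
    rewrite Hd, bit_cell, HK by lia. reflexivity.
  - intros i Hi. rewrite Hd, bit_cell, HK by lia. destruct i; [lia|reflexivity].
Qed.

Lemma seek pc i s : nth_error prog pc = Some i -> let p := op_ptr (fst (fst i)) in
  p < K -> s p <= n -> run machine (s p) (conf (5 * pc) s 0) = conf (5 * pc) s (s p).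
Proof.
  intros Hi p Hp Hs.
  assert (Hpc : pc < L) by (apply nth_error_Some; congruence).
  apply (sweep_right (5 * pc) s (s p) 0); try lia.
  intros j Hj. rewrite <- (Nat.add_0_r (5 * pc)) at 1. rewrite (delta_instr pc 0 i) by (auto; lia).
  destruct i as [[o lt] lf]. cbn [instr_delta]. cbn in p. fold p.
  rewrite bit_cell by lia. destruct (Nat.eqb_spec (s p) j); [lia|reflexivity].
Qed.

Lemma read_only q q' s h : q <> 5 * L -> q <> 5 * L + 1 -> h <= n ->
  delta q (cell s h) = (q', cell s h, MStay) -> step machine (conf q s h) = conf q' s h.
Proof. intros H1 H2 Hh Hd. apply (step_conf q q' s s h h MStay); auto. reflexivity. Qed.

(* A pointer at position [n + 1] has no mark on the tape. *)
Lemma pick_up q q' s p h mv : q <> 5 * L -> q <> 5 * L + 1 -> p < K -> s p <= n ->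
  delta q (cell s (s p)) = (q', setb K p false (cell s (s p)), mv) -> moved mv (s p) h -> h <= n ->
  step machine (conf q s (s p)) = conf q' (upd s p (S n)) h.
Proof.
  intros H1 H2 Hp Hs Hd Hm Hh. apply (step_conf q q' s _ (s p) h mv); auto.
  - rewrite Hd, <- setb_cell by lia. destruct (Nat.eqb_spec (S n) (s p)); [lia|reflexivity].
  - intros i Hi1 Hi2. apply cell_upd.
    destruct (Nat.eqb_spec (S n) i), (Nat.eqb_spec (s p) i); lia || reflexivity.
Qed.

Lemma put_down q q' s p h : q <> 5 * L -> q <> 5 * L + 1 -> p < K -> h <= n ->
  let s1 := upd s p (S n) in delta q (cell s1 h) = (q', setb K p true (cell s1 h), MStay) ->
  step machine (conf q s1 h) = conf q' (upd s p h) h.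
Proof.
  intros H1 H2 Hp Hh s1 Hd. apply (step_conf q q' s1 _ h h MStay); auto; try reflexivity.
  - rewrite Hd, <- (Nat.eqb_refl h) at 1. rewrite setb_cell by lia.
    enough (cell (upd s1 p h) h = cell (upd s p h) h) as -> by reflexivity.
    apply mark_ext. intros q0 _. unfold s1, upd. now destruct (q0 =? p).
  - intros i Hi1 Hi2. apply mark_ext. intros q0 _. unfold s1, upd. destruct (q0 =? p); [|reflexivity].
    destruct (Nat.eqb_spec (S n) i), (Nat.eqb_spec h i); lia || reflexivity.
Qed.

Definition in_range (s : store) : Prop := forall p, s p <= n.

(** The head moves from cell 0 to the pointer and back, at most [n] cells each way; the constant
    covers the work at the two ends. *)
Lemma simulate_step pc s o lt lf :
  nth_error prog pc = Some (o, lt, lf) -> op_below K o -> in_range s -> s K = 0 ->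
  exists k, k <= 2 * n + 5 /\ run machine k (conf (5 * pc) s 0) =
      conf (lab (if op_test w o s then lt else lf)) (op_eff w o s) 0.
Proof.
  intros Hi Ho Hs HK.
  assert (Hpc : pc < L) by (apply nth_error_Some; congruence).
  assert (Hp : op_ptr o < K) by (destruct o; cbn in *; lia).
  pose proof (Hs (op_ptr o)) as Hsp.
  assert (D : forall ph a, ph < 5 -> delta (5 * pc + ph) a = instr_delta pc ph (o, lt, lf) a)
    by (intros; apply delta_instr; auto).
  assert (F : delta (5 * pc) (cell s (s (op_ptr o))) = found pc o (cell s (s (op_ptr o)))).
  { rewrite <- (Nat.add_0_r (5 * pc)), D by lia. cbn [instr_delta].
    rewrite bit_cell, Nat.eqb_refl by lia. reflexivity. }
  assert (R2 : forall s h, h <= n -> s K = 0 ->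
    run machine (S h) (conf (5 * pc + 2) s h) = conf (lab lt) s 0).
  { intros s1 h Hh HK1. apply return_home; try lia; auto; intros a; rewrite D by lia; reflexivity. }
  assert (R4 : forall s h, h <= n -> s K = 0 ->
    run machine (S h) (conf (5 * pc + 4) s h) = conf (lab lf) s 0).
  { intros s1 h Hh HK1. apply return_home; try lia; auto; intros a; rewrite D by lia; reflexivity. }
  enough (exists k, k <= s (op_ptr o) + 5 /\ run machine k (conf (5 * pc) s (s (op_ptr o))) =
      conf (lab (if op_test w o s then lt else lf)) (op_eff w o s) 0) as (k & Hk & Rk).
  { exists (s (op_ptr o) + k). split; [lia|]. rewrite run_add.
    pose proof (seek pc _ s Hi Hp Hsp) as E. cbn [fst] in E. now rewrite E. }
  destruct o as [p|p|p b|p q]; cbn [op_ptr op_test op_eff found] in *.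
  - exists (S (s p + 1)). split; [lia|].
    rewrite run_S, (pick_up (5 * pc) _ _ _ (s p) _ ltac:(lia) ltac:(lia) Hp Hsp F eq_refl Hsp).
    assert (HK1 : upd s p (S n) K = 0) by (rewrite upd_neq; [assumption|lia]).
    rewrite run_add, sweep_left; auto; try lia.
    + apply put_down; try lia. rewrite D by lia. cbn [instr_delta op_ptr]. now rewrite bit_cell, HK1 by lia.
    + intros i Hi1. rewrite D by lia. cbn [instr_delta]. rewrite bit_cell, HK1 by lia.
      destruct i; [lia|reflexivity].
  - rewrite base_cell in F. pose proof (sym_zero w (s p) w_sym) as Z. fold n in Z |- *.
    (* The machine tests for the blank where the program compares with [n]; by [sym_zero] the two
       tests agree, and the mixed cases vanish. *)
    destruct (Nat.ltb_spec (s p) n) as [Hlt|Hge], (Nat.eqb_spec (sym w (s p)) 0) as [E|E]; try lia.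
    + exists (S (S (S (S (s p))))). split; [lia|].
      rewrite run_S, (pick_up (5 * pc) _ _ _ (S (s p)) _ ltac:(lia) ltac:(lia) Hp Hsp F eq_refl Hlt).
      rewrite run_S, (put_down _ (5 * pc + 2)); try lia; [|now rewrite D by lia].
      apply R2; [lia|]. rewrite upd_neq; [assumption|lia].
    + exists (S (S (s p))). split; [lia|]. rewrite run_S, (read_only (5 * pc) _ _ _ ltac:(lia) ltac:(lia) Hsp F).
      now apply R2.
  - exists (S (S (s p))). split; [lia|]. rewrite base_cell in F.
    rewrite run_S, (read_only (5 * pc) _ _ _ ltac:(lia) ltac:(lia) Hsp F).
    destruct (sym w (s p) =? b); [apply R2|apply R4]; auto.
  - exists (S (S (s p))). split; [lia|]. cbn [op_below] in Ho. rewrite bit_cell, Nat.eqb_sym in F by lia.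
    rewrite run_S, (read_only (5 * pc) _ _ _ ltac:(lia) ltac:(lia) Hsp F).
    destruct (s p =? s q); [apply R2|apply R4]; auto.
Qed.

Lemma simulate t pc s :
  (forall o lt lf, In (o, lt, lf) prog -> op_below K o) -> in_range s -> s K = 0 ->
  exists k, k <= t * (2 * n + 5) /\
    run machine k (conf (lab pc) s 0) =
      (let c := Nat.iter t (gstep prog w) (pc, s) in conf (lab (fst c)) (snd c) 0).
Proof.
  intros Hprog. revert pc s; induction t as [|t IH]; intros pc s Hs HK.
  - exists 0. split; [lia|reflexivity].
  - rewrite Nat.iter_succ_r. unfold gstep at 2; cbn [fst snd].
    destruct (nth_error prog pc) as [[[o lt] lf]|] eqn:E.
    + assert (Ho : op_below K o) by (eapply Hprog, nth_error_In, E).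
      destruct (simulate_step pc s o lt lf E Ho Hs HK) as (k1 & Hk1 & R1).
      destruct (IH (if op_test w o s then lt else lf) (op_eff w o s)) as (k2 & Hk2 & R2).
      * intros p. specialize (Hs p). unfold n in *. destruct o; cbn [op_eff]; auto; unfold upd.
        -- destruct (p =? p0); lia.
        -- destruct (Nat.ltb_spec (s p0) (length w)); [|assumption]. destruct (p =? p0); lia.
      * assert (op_ptr o < K) by (destruct o; cbn in *; lia).
        destruct o; cbn [op_eff op_ptr] in *; auto; unfold upd.
        -- destruct (Nat.eqb_spec K p); [lia|assumption].
        -- destruct (s p <? length w); auto. destruct (Nat.eqb_spec K p); [lia|assumption].
      * exists (k1 + k2). split; [lia|]. rewrite run_add.
        assert (pc < L) by (apply nth_error_Some; congruence).
        unfold lab at 1. destruct (Nat.ltb_spec pc L); [|lia]. rewrite R1. exact R2.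
    + destruct (IH pc s Hs HK) as (k & Hk & R). exists k. split; [lia|exact R].
Qed.

Lemma move_right_raw (q : nat) (l : list nat) k :
  match skipn k w with [] => (q, l, 0, []) | x :: r => (q, l, x, r) end
  = (q, l, sym w k, skipn (S k) w).
Proof.
  unfold sym. clear n w_sym. revert k. induction w as [|x r IH]; intros [|k]; try reflexivity.
  cbn [skipn nth]. rewrite IH. reflexivity.
Qed.

(** All pointers start at 0, so one transition puts every mark on cell 0. The time is [n] steps to
    the right end, one step back from the new blank and [n] steps for the return. *)
Lemma initialize : w <> [] ->
  run machine (2 * n + 1) (init machine w) = conf (lab 0) (fun _ => 0) 0.
Proof.
  intros Hw. set (s0 := fun _ : nat => 0).
  assert (Hn : 0 < n) by (unfold n; destruct w; [congruence|cbn; lia]).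
  assert (C : forall j, 0 < j -> cell s0 j = sym w j).
  { intros j Hj. rewrite <- (mark_none K (sym w j)). unfold cell. apply mark_ext. intros p _.
    destruct j; [lia|reflexivity]. }
  (* Before the blank is appended the tape does not have the form [conf]: the visited part consists
     of cells, the rest is the raw word. *)
  assert (Hinit : forall j, j < n -> run machine (S j) (init machine w) =
    (5 * L + 3, rev (map (cell s0) (seq 0 (S j))), sym w (S j), skipn (S (S j)) w)).
  { induction j as [|j IHj]; intros Hj.
    - rewrite run_S. cbn [run Nat.iter].
      replace (init machine w) with (5 * L + 2, @nil nat, sym w 0, skipn 1 w)
        by (unfold sym; destruct w; [congruence|reflexivity]).
      unfold step, halted; cbn [cstate tm_acc tm_rej tm_delta machine].
      rewrite !(proj2 (Nat.eqb_neq _ _)) by lia. unfold delta.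
      destruct (Nat.ltb_spec (5 * L + 2) (5 * L)); [lia|]. rewrite Nat.eqb_refl.
      unfold run, Nat.iter, nat_rect, base. rewrite (Nat.mod_small _ _ (sym_bound w 0 w_sym)). apply move_right_raw.
    - rewrite <- (Nat.add_1_r (S j)), run_add, IHj by lia. cbn [run Nat.iter].
      unfold run, Nat.iter, nat_rect, step, halted; cbn [cstate tm_acc tm_rej tm_delta machine].
      rewrite !(proj2 (Nat.eqb_neq _ _)) by lia. unfold delta.
      destruct (Nat.ltb_spec (5 * L + 3) (5 * L)); [lia|].
      destruct (Nat.eqb_spec (5 * L + 3) (5 * L + 2)); [lia|]. rewrite Nat.eqb_refl.
      unfold base. rewrite (Nat.mod_small _ _ (sym_bound w (S j) w_sym)).
      destruct (Nat.eqb_spec (sym w (S j)) 0) as [E|E]; [apply sym_zero in E; [fold n in E; lia|assumption]|].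
      rewrite move_right_raw, Nat.add_1_r, (seq_S (S j) 0), map_app, rev_app_distr, Nat.add_0_l.
      cbn [map rev app]. rewrite (C (S j)) by lia. reflexivity. }
  assert (E : run machine n (init machine w) = conf (5 * L + 3) s0 n).
  { replace n with (S (n - 1)) at 1 by lia. rewrite Hinit by lia.
    replace (S (n - 1)) with n by lia. unfold conf. rewrite C, Nat.sub_diag by lia.
    rewrite skipn_all2 by (unfold n; lia). reflexivity. }
  replace (2 * n + 1) with (n + (1 + S (n - 1))) by lia. rewrite run_add, E, run_add.
  assert (D3 : delta (5 * L + 3) (cell s0 n) = (5 * L + 4, cell s0 n, MLeft)).
  { unfold delta. destruct (Nat.ltb_spec (5 * L + 3) (5 * L)); [lia|].
    destruct (Nat.eqb_spec (5 * L + 3) (5 * L + 2)); [lia|]. rewrite Nat.eqb_refl, base_cell.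
    now rewrite (proj2 (sym_zero w n w_sym)). }
  replace (run machine 1 (conf (5 * L + 3) s0 n)) with (conf (5 * L + 4) s0 (n - 1)).
  2: { symmetry. apply (step_conf _ _ s0 s0 _ _ MLeft); auto; try lia. cbn; lia. }
  apply return_home; auto; try lia. intros a. unfold delta.
  destruct (Nat.ltb_spec (5 * L + 4) (5 * L)); [lia|].
  destruct (Nat.eqb_spec (5 * L + 4) (5 * L + 2)); [lia|].
  destruct (Nat.eqb_spec (5 * L + 4) (5 * L + 3)); [lia|]. now rewrite Nat.eqb_refl.
Qed.

End Machine.

(** * Structured pointer programs *)

(** Every command returns a truth value, so a whole decision procedure can serve as the test of a
    loop. *)
Inductive cmd :=
| COp (o : op)
| CNot (c : cmd)
| CIf (c c1 c2 : cmd)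
| CWhile (c d : cmd).

(** Big-step, so a derivation of [exec] includes termination. *)
Inductive exec (w : list nat) : cmd -> store -> bool -> store -> Prop :=
| ex_op o s : exec w (COp o) s (op_test w o s) (op_eff w o s)
| ex_not c s b s' : exec w c s b s' -> exec w (CNot c) s (negb b) s'
| ex_if c c1 c2 s b s1 b' s2 :
    exec w c s b s1 -> exec w (if b then c1 else c2) s1 b' s2 -> exec w (CIf c c1 c2) s b' s2
| ex_while_end c d s s1 : exec w c s false s1 -> exec w (CWhile c d) s true s1
| ex_while_loop c d s s1 b s2 b' s3 :
    exec w c s true s1 -> exec w d s1 b s2 -> exec w (CWhile c d) s2 b' s3 ->
    exec w (CWhile c d) s b' s3.

Fixpoint csize (c : cmd) : nat :=
  match c with
  | COp _ => 1
  | CNot c => csize c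
  | CIf c c1 c2 => csize c + (csize c1 + csize c2)
  | CWhile c d => csize c + csize d
  end.

(** [a] is the address of the first instruction, [lt] and [lf] are the jump targets for the two
    results. No truth value is ever stored, and [CNot] costs nothing. *)
Fixpoint compile (c : cmd) (a lt lf : nat) : list instr :=
  match c with
  | COp o => [(o, lt, lf)]
  | CNot c => compile c a lf lt
  | CIf c c1 c2 =>
      compile c a (a + csize c) (a + csize c + csize c1)
      ++ compile c1 (a + csize c) lt lf ++ compile c2 (a + csize c + csize c1) lt lf
  | CWhile c d => compile c a (a + csize c) lt ++ compile d (a + csize c) a a
  end.

Lemma compile_length c a lt lf : length (compile c a lt lf) = csize c.
Proof.
  revert a lt lf; induction c; intros; cbn [compile csize]; rewrite ?length_app; auto.
Qed.

Lemma iter_iter {A} (f : A -> A) a b x : Nat.iter b f (Nat.iter a f x) = Nat.iter (b + a) f x.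
Proof. symmetry. apply Nat.iter_add. Qed.

(** Jumps are absolute, so the induction needs the code in place between arbitrary [A] and [B]. *)
Lemma compile_correct w c s b s' : exec w c s b s' ->
  forall A B lt lf, exists t,
    Nat.iter t (gstep (A ++ compile c (length A) lt lf ++ B) w) (length A, s)
      = (if b then lt else lf, s').
Proof.
  induction 1 as [o s|c s b s' _ IH|c c1 c2 s b s1 b' s2 _ IH1 _ IH2|c d s s1 _ IH
                 |c d s s1 b s2 b' s3 _ IH1 _ IH2 _ IH3]; intros A B lt lf.
  - exists 1. cbn [Nat.iter nat_rect compile]. unfold gstep; cbn [fst snd].
    rewrite nth_error_app2, Nat.sub_diag by lia. reflexivity.
  - destruct (IH A B lf lt) as [t E]. exists t. cbn [compile]. rewrite E. now destruct b.
  - cbn [compile]. set (n := csize c). set (n1 := csize c1).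
    set (C := compile c (length A) (length A + n) (length A + n + n1)).
    set (C1 := compile c1 (length A + n) lt lf).
    set (C2 := compile c2 (length A + n + n1) lt lf).
    assert (EC : length (A ++ C) = length A + n)
      by (unfold C; rewrite length_app, compile_length; reflexivity).
    assert (EC1 : length (A ++ C ++ C1) = length A + n + n1)
      by (unfold C, C1; rewrite !length_app, !compile_length; unfold n, n1; lia).
    destruct (IH1 A ((C1 ++ C2) ++ B) (length A + n) (length A + n + n1)) as [t1 E1].
    fold C in E1.
    replace (A ++ C ++ (C1 ++ C2) ++ B) with (A ++ (C ++ C1 ++ C2) ++ B) in E1
      by now rewrite !app_assoc.
    destruct b.
    + destruct (IH2 (A ++ C) (C2 ++ B) lt lf) as [t2 E2]. rewrite EC in E2. fold C1 in E2.
      exists (t2 + t1). rewrite <- iter_iter, E1, <- E2. rewrite !app_assoc. reflexivity.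
    + destruct (IH2 (A ++ C ++ C1) B lt lf) as [t2 E2]. rewrite EC1 in E2. fold C2 in E2.
      exists (t2 + t1). rewrite <- iter_iter, E1, <- E2. rewrite !app_assoc. reflexivity.
  - cbn [compile]. destruct (IH A (compile d (length A + csize c) (length A) (length A) ++ B)
      (length A + csize c) lt) as [t E].
    exists t. rewrite <- app_assoc. exact E.
  - cbn [compile]. set (n := csize c).
    set (C := compile c (length A) (length A + n) lt).
    set (C1 := compile d (length A + n) (length A) (length A)).
    assert (EC : length (A ++ C) = length A + n)
      by (unfold C; rewrite length_app, compile_length; reflexivity).
    destruct (IH1 A (C1 ++ B) (length A + n) lt) as [t1 E1]. fold C in E1.
    destruct (IH2 (A ++ C) B (length A) (length A)) as [t2 E2]. rewrite EC in E2. fold C1 in E2.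
    destruct (IH3 A B lt lf) as [t3 E3]. cbn [compile] in E3. fold n C C1 in E3.
    exists (t3 + (t2 + t1)). rewrite <- !iter_iter, <- app_assoc, E1.
    rewrite <- app_assoc in E2. rewrite E2. rewrite <- app_assoc in E3.
    destruct b; exact E3.
Qed.

Fixpoint cmd_bound (c : cmd) : nat :=
  match c with
  | COp (OEq p q) => S (Nat.max p q)
  | COp o => S (op_ptr o)
  | CNot c => cmd_bound c
  | CIf c c1 c2 => Nat.max (cmd_bound c) (Nat.max (cmd_bound c1) (cmd_bound c2))
  | CWhile c d => Nat.max (cmd_bound c) (cmd_bound d)
  end.

Lemma compile_below c a lt lf o l1 l2 :
  In (o, l1, l2) (compile c a lt lf) -> op_below (cmd_bound c) o.
Proof.
  assert (M : forall K K' o, K <= K' -> op_below K o -> op_below K' o)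
    by (intros K K' []; cbn; lia).
  revert a lt lf; induction c; intros a lt lf; cbn [compile cmd_bound]; rewrite ?in_app_iff.
  - intros [[= <- _ _]|[]]. destruct o0; cbn; lia.
  - apply IHc.
  - intros [H|[H|H]]; eapply M; [|eapply IHc1, H| |eapply IHc2, H| |eapply IHc3, H]; lia.
  - intros [H|H]; eapply M; [|eapply IHc1, H| |eapply IHc2, H]; lia.
Qed.

(** * Halting time by counting configurations *)

Section Pigeonhole.
Variables (n K : nat) (prog : list instr) (w : list nat).
Hypothesis w_len : length w = n.
Hypothesis prog_below : forall o lt lf, In (o, lt, lf) prog -> op_below K o.

(** The first [k] pointers are the digits of a number in base [S n]. *)
Fixpoint num (k : nat) (s : store) : nat :=
  match k with 0 => 0 | S k' => s 0 + S n * num k' (fun p => s (S p)) end.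

Lemma num_bound k s : (forall p, s p <= n) -> num k s < S n ^ k.
Proof.
  revert s; induction k as [|k IH]; intros s H; cbn [num Nat.pow]; [lia|].
  specialize (IH (fun p => s (S p)) (fun p => H (S p))). specialize (H 0). nia.
Qed.

Lemma num_inj k s s' : (forall p, s p <= n) -> (forall p, s' p <= n) -> num k s = num k s' ->
  forall p, p < k -> s p = s' p.
Proof.
  revert s s'; induction k as [|k IH]; intros s s' H H' E p Hp; cbn [num] in E; [lia|].
  assert (s 0 = s' 0 /\ num k (fun p => s (S p)) = num k (fun p => s' (S p))) as [E0 E1].
  { pose proof (H 0). pose proof (H' 0).
    revert E; generalize (num k (fun p => s (S p))) (num k (fun p => s' (S p))). intros x y E.
    destruct (Nat.lt_trichotomy x y) as [|[|]]; nia. }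
  destruct p as [|p]; [assumption|].
  apply (IH (fun p => s (S p)) (fun p => s' (S p))); auto; lia.
Qed.

(** The second clause makes a store, a function on all of [nat], determined by its first [K]
    values. *)
Definition tame (s : store) : Prop := (forall p, s p <= n) /\ forall p, K <= p -> s p = 0.

Lemma gstep_tame c : tame (snd c) -> tame (snd (gstep prog w c)).
Proof.
  destruct c as [pc s]; unfold gstep; cbn [fst snd]. intros [H1 H2].
  destruct (nth_error prog pc) as [[[o lt] lf]|] eqn:E; cbn [snd]; [|split; assumption].
  pose proof (prog_below _ _ _ (nth_error_In _ _ E)) as Ho.
  destruct o as [p|p|p a|p q]; cbn [op_eff op_below op_ptr] in *; try (split; assumption).
  - split; intros r; unfold upd; destruct (Nat.eqb_spec r p); auto; lia.
  - destruct (Nat.ltb_spec (s p) (length w)); [|split; assumption].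
    split; intros r; unfold upd; destruct (Nat.eqb_spec r p); auto; lia.
Qed.

Lemma iter_tame t c : tame (snd c) -> tame (snd (Nat.iter t (gstep prog w) c)).
Proof. intros H. induction t; [assumption|]. cbn. now apply gstep_tame. Qed.

Lemma iter_stuck t pc s : length prog <= pc -> Nat.iter t (gstep prog w) (pc, s) = (pc, s).
Proof.
  intros H. induction t as [|t IH]; [reflexivity|]. cbn [Nat.iter nat_rect]. unfold Nat.iter in IH.
  rewrite IH. unfold gstep; cbn [fst]. now rewrite (proj2 (nth_error_None _ _) H).
Qed.

(* A deterministic computation that halts never repeats a configuration before halting. *)
Lemma halting_time pc s T pc' s' : tame s ->
  Nat.iter T (gstep prog w) (pc, s) = (pc', s') -> length prog <= pc' ->
  exists t, t <= length prog * S n ^ K /\ Nat.iter t (gstep prog w) (pc, s) = (pc', s').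
Proof.
  intros Hs ET Hpc'. set (f t := Nat.iter t (gstep prog w) (pc, s)).
  assert (exists t, length prog <= fst (f t) /\ forall t', t' < t -> fst (f t') < length prog)
    as (t & Ht & Hmin).
  { assert (H : length prog <= fst (f T)) by (unfold f; rewrite ET; exact Hpc').
    clear ET. revert H. induction T as [T IH] using (well_founded_induction lt_wf). intros H.
    destruct (classic (exists t', t' < T /\ length prog <= fst (f t'))) as [(t' & H1 & H2)|N].
    - exact (IH t' H1 H2).
    - exists T. split; [assumption|]. intros t' Ht'. apply Nat.nle_gt. intros H'. apply N. eauto. }
  exists t. split.
  (* [g] numbers the configurations; before the first halting time [t] its values are distinct and
     below [length prog * S n ^ K]. *)
  - set (g t := fst (f t) * S n ^ K + num K (snd (f t))).
    assert (Tm : forall a, tame (snd (f a))) by (intros a; now apply iter_tame).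
    assert (G : forall a, a < t -> g a < length prog * S n ^ K).
    { intros a Ha. pose proof (num_bound K _ (proj1 (Tm a))). pose proof (Hmin a Ha). unfold g. nia. }
    assert (Inj : forall a b, a < b -> b < t -> g a <> g b).
    { intros a b Hab Hb E.
      assert (Eab : f a = f b).
      { pose proof (num_bound K _ (proj1 (Tm a))). pose proof (num_bound K _ (proj1 (Tm b))).
        unfold g in E. pose proof (Tm a) as [A1 A2]. pose proof (Tm b) as [B1 B2].
        assert (E1 : fst (f a) = fst (f b)) by nia.
        assert (E2 : num K (snd (f a)) = num K (snd (f b))) by nia.
        rewrite (surjective_pairing (f a)), (surjective_pairing (f b)), E1. f_equal.
        apply functional_extensionality. intros p.
        destruct (Nat.lt_ge_cases p K) as [Hp|Hp].
        - now apply (num_inj K).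
        - now rewrite A2, B2. }
      (* If the times [a < b] had the same configuration, the computation would already have stopped
         [b - a] steps before [t]. *)
      assert (f ((t - b) + a) = f t) as E3.
      { unfold f. rewrite <- iter_iter. fold (f a). rewrite Eab. unfold f. rewrite iter_iter.
        f_equal. lia. }
      specialize (Hmin ((t - b) + a)). rewrite E3 in Hmin. lia. }
    assert (ND : NoDup (map g (seq 0 t))).
    { apply NoDup_map_NoDup_ForallPairs; [|apply seq_NoDup].
      intros a b Ha Hb E. apply in_seq in Ha, Hb.
      destruct (Nat.lt_trichotomy a b) as [H|[H|H]]; [|assumption|]; exfalso;
        eapply Inj; eauto; lia. }
    rewrite <- (length_seq (length prog * S n ^ K) 0), <- (length_seq t 0), <- (length_map g (seq 0 t)).
    apply NoDup_incl_length; [assumption|].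
    intros x Hx. apply in_map_iff in Hx as (a & <- & Ha). apply in_seq in Ha. apply in_seq.
    specialize (G a). lia.
  - rewrite <- ET. fold (f t) (f T). destruct (Nat.le_gt_cases t T) as [H|H].
    + replace T with ((T - t) + t) by lia. unfold f at 2. rewrite <- iter_iter. fold (f t).
      rewrite (surjective_pairing (f t)). now rewrite iter_stuck.
    + specialize (Hmin T H). unfold f in Hmin. rewrite ET in Hmin. cbn in Hmin. lia.
Qed.

End Pigeonhole.

(** Only termination is asked of the program, without any estimate; the polynomial comes from
    counting configurations. *)
Theorem cmd_ptime {I : Type} (valid : I -> Prop) (enc : I -> list nat) (P : I -> Prop) (c : cmd) :
  (forall i x, In x (enc i) -> 0 < x < 6) -> (forall i, enc i <> []) ->
  (forall i, valid i -> exists b s', exec (enc i) c (fun _ => 0) b s' /\ (b = true <-> P i)) ->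
  ptime_decidable valid enc P.
Proof.
  intros Hsym Hne Hc.
  (* The exit addresses [L] and [S L] are sent by [lab] to the accepting and the rejecting state. *)
  set (L := csize c). set (prog := compile c 0 L (S L)). set (K := cmd_bound c).
  assert (EL : length prog = L) by apply compile_length.
  exists (machine K prog). split; [apply machine_wf|].
  (* At most [L * S n ^ K] instructions cost [2 * n + 5 <= 5 * S n] machine steps each; the summand
     2 pays for the [2 * n + 1] steps of the preparation. *)
  exists (2 + 5 * L), (K + 1). intros i Hi.
  destruct (Hc i Hi) as (b & s' & Hex & Hb).
  set (w := enc i) in *. set (n := length w).
  assert (Hprog : forall o lt lf, In (o, lt, lf) prog -> op_below K o)
    by (intros o lt lf; apply compile_below).
  destruct (compile_correct w c _ b s' Hex [] [] L (S L)) as [T ET].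
  rewrite app_nil_r in ET. cbn [app length] in ET. fold prog in ET.
  assert (Tz : tame n K (fun _ => 0)) by (split; intros; lia).
  destruct (halting_time n K prog w eq_refl Hprog 0 (fun _ => 0) T _ s' Tz ET) as (t & Ht & Et).
  { rewrite EL. destruct b; lia. }
  destruct (simulate K prog w (Hsym i) t 0 (fun _ => 0) Hprog) as (k & Hk & Rk).
  { intros p; lia. } { reflexivity. }
  rewrite Et in Rk. cbn [fst snd] in Rk. fold n in Hk.
  exists ((2 * n + 1) + k). split; [|].
  - rewrite EL in Ht. assert (1 <= S n ^ K) by (pose proof (Nat.pow_nonzero (S n) K); lia).
    rewrite Nat.pow_add_r, Nat.pow_1_r.
    assert (k <= L * S n ^ K * (5 * S n)) by nia.
    assert (2 * n + 1 <= 2 * (S n ^ K * S n)) by nia.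
    set (X := S n ^ K) in *. nia.
  - rewrite run_add. unfold n. rewrite initialize by first [exact (Hsym i) | exact (Hne i)].
    rewrite Rk. unfold halted, conf, lab; cbn [cstate tm_acc tm_rej machine]. rewrite EL.
    destruct b.
    + rewrite Nat.ltb_irrefl, !Nat.eqb_refl. split; [reflexivity|]. split; [intros _; now apply Hb|reflexivity].
    + destruct (Nat.ltb_spec (S L) L); [lia|]. destruct (Nat.eqb_spec (S L) L); [lia|].
      rewrite Nat.eqb_refl. split; [apply Bool.orb_true_r|].
      split; [lia|]. intros HP. apply Hb in HP. discriminate.
Qed.

(** * Basic commands and the loop rule *)

Definition agree (m : nat) (s s' : store) : Prop := forall p, p < m -> s' p = s p.

Lemma agree_refl m s : agree m s s.
Proof. intros p _; reflexivity. Qed.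

Lemma agree_trans m m' s s1 s2 : m <= m' -> agree m s s1 -> agree m' s1 s2 -> agree m s s2.
Proof. intros H A B p Hp. rewrite B by lia. now apply A. Qed.

Lemma agree_upd m s s' p x : agree m s s' -> m <= p -> agree m s (upd s' p x).
Proof. intros A H q Hq. rewrite upd_neq by lia. now apply A. Qed.

Definition rng (w : list nat) (s : store) : Prop := forall p, s p <= length w.

Lemma rng_upd w s p x : rng w s -> x <= length w -> rng w (upd s p x).
Proof. intros H Hx q. unfold upd. destruct (q =? p); [assumption|apply H]. Qed.

Lemma exec_rng w c s b s' : exec w c s b s' -> rng w s -> rng w s'.
Proof.
  induction 1 as [o s|c s b s' _ IH|c c1 c2 s b s1 b' s2 _ IH1 _ IH2|c d s s1 _ IH
                 |c d s s1 b s2 b' s3 _ IH1 _ IH2 _ IH3]; auto.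
  intros H. destruct o; cbn [op_eff]; auto.
  - apply rng_upd; [assumption|lia].
  - destruct (Nat.ltb_spec (s p) (length w)); [apply rng_upd; [assumption|lia]|assumption].
Qed.

Definition CTrue : cmd := COp (OEq 0 0).
Definition CFalse : cmd := CNot CTrue.
Definition CSeq (c d : cmd) : cmd := CIf c d d.

Lemma exec_true w s : exec w CTrue s true s.
Proof. pose proof (ex_op w (OEq 0 0) s) as H. cbn in H. now rewrite Nat.eqb_refl in H. Qed.

Lemma exec_false w s : exec w CFalse s false s.
Proof. exact (ex_not w _ _ _ _ (exec_true w s)). Qed.

Lemma exec_seq w c d s b s1 b' s2 :
  exec w c s b s1 -> exec w d s1 b' s2 -> exec w (CSeq c d) s b' s2.
Proof. intros H1 H2. eapply ex_if; [exact H1|]. destruct b; exact H2. Qed.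

Lemma exec_sym w p a s : exec w (COp (OSym p a)) s (sym w (s p) =? a) s.
Proof. exact (ex_op w (OSym p a) s). Qed.

Lemma exec_eq w p q s : exec w (COp (OEq p q)) s (s p =? s q) s.
Proof. exact (ex_op w (OEq p q) s). Qed.

Lemma exec_reset w p s : exec w (COp (OReset p)) s true (upd s p 0).
Proof. exact (ex_op w (OReset p) s). Qed.

Lemma exec_inc w p s : s p < length w -> exec w (COp (OInc p)) s true (upd s p (S (s p))).
Proof.
  intros H. pose proof (ex_op w (OInc p) s) as E. cbn [op_test op_eff] in E.
  apply Nat.ltb_lt in H. now rewrite H in E.
Qed.

Lemma exec_and w c d s b b' : exec w c s b s -> exec w d s b' s ->
  exec w (CIf c d CFalse) s (b && b') s.
Proof.
  intros H1 H2. eapply ex_if; [exact H1|]. destruct b; [exact H2|apply exec_false].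
Qed.

(** Total correctness with variant [mu]. The test may change the store, so the invariant is required
    again only after the body. *)
Lemma while_rule w t f (mu : store -> nat) (Inv Post : store -> Prop) :
  (forall s, Inv s -> exists b s1, exec w t s b s1 /\
     if b then exists b' s2, exec w f s1 b' s2 /\ Inv s2 /\ mu s2 < mu s else Post s1) ->
  forall s, Inv s -> exists s', exec w (CWhile t f) s true s' /\ Post s'.
Proof.
  intros H s. remember (mu s) as k eqn:Ek. revert s Ek.
  induction k as [k IH] using (well_founded_induction lt_wf). intros s -> Hs.
  destruct (H s Hs) as ([] & s1 & E1 & Hb).
  - destruct Hb as (b' & s2 & E2 & H2 & Hmu). destruct (IH _ Hmu s2 eq_refl H2) as (s' & E3 & Hp).
    exists s'. split; [|assumption]. eapply ex_while_loop; eauto.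
  - exists s1. split; [|assumption]. now apply ex_while_end.
Qed.

Definition CCopy (p q : nat) : cmd :=
  CSeq (COp (OReset p)) (CWhile (CNot (COp (OEq p q))) (COp (OInc p))).

Lemma exec_copy w p q s : p <> q -> rng w s ->
  exists s', exec w (CCopy p q) s true s' /\ s' p = s q /\ forall r, r <> p -> s' r = s r.
Proof.
  intros Hpq Hs.
  destruct (while_rule w (CNot (COp (OEq p q))) (COp (OInc p)) (fun s' => length w - s' p)
    (fun s' => s' p <= s q /\ forall r, r <> p -> s' r = s r)
    (fun s' => s' p = s q /\ forall r, r <> p -> s' r = s r)) with (s := upd s p 0) as (s' & E & H).
  - intros s1 [H1 H2]. eexists _, s1. split; [apply ex_not, exec_eq|]. rewrite (H2 q) by auto.
    destruct (Nat.eqb_spec (s1 p) (s q)) as [E|E]; cbn [negb].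
    + split; assumption.
    + pose proof (Hs q). eexists _, _. split; [apply exec_inc; lia|]. rewrite upd_eq. repeat split; try lia.
      intros r Hr. rewrite upd_neq by assumption. now apply H2.
  - rewrite upd_eq. split; [lia|]. intros r Hr. now rewrite upd_neq.
  - exists s'. split; [|exact H]. eapply exec_seq; [apply exec_reset|exact E].
Qed.

(** * Segments of the word *)

Definition seg (w : list nat) (x y : nat) (v : list nat) : Prop :=
  exists u r, w = u ++ v ++ r /\ length u = x /\ y = x + length v.

Lemma app_len_inj {A} (u u' v v' : list A) :
  length u = length u' -> u ++ v = u' ++ v' -> u = u' /\ v = v'.
Proof.
  revert u'; induction u as [|a u IH]; intros [|b u'] Hl E; try discriminate; [auto|].
  injection Hl as Hl. injection E as -> E. destruct (IH u' Hl E) as [-> ->]. auto.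
Qed.

Lemma seg_nil w x y : seg w x y [] <-> x = y /\ x <= length w.
Proof.
  split.
  - intros (u & r & -> & <- & ->). rewrite length_app. cbn. lia.
  - intros [<- H]. exists (firstn x w), (skipn x w). cbn.
    rewrite firstn_skipn, length_firstn. repeat split; lia.
Qed.

Lemma seg_app w x z u v : seg w x z (u ++ v) <-> exists y, seg w x y u /\ seg w y z v.
Proof.
  split.
  - intros (a & r & -> & <- & ->). exists (length a + length u). split.
    + exists a, (v ++ r). rewrite !app_assoc. auto.
    + exists (a ++ u), r. rewrite !length_app, !app_assoc. repeat split. lia.
  - intros (y & (a & r & E & <- & ->) & (b & r' & E' & Hb & ->)).
    exists a, r'. split; [|rewrite length_app; split; lia].
    rewrite E in E'. rewrite app_assoc in E'.
    destruct (app_len_inj _ _ _ _ (eq_trans (length_app a u) (eq_sym Hb)) E') as [<- ->].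
    rewrite E, !app_assoc. reflexivity.
Qed.

Lemma seg_one w x y a : seg w x y [a] <-> sym w x = a /\ y = S x /\ y <= length w.
Proof.
  split.
  - intros (u & r & -> & <- & ->). unfold sym. cbn [app]. rewrite nth_middle, !length_app. cbn. lia.
  - intros (Ha & -> & Hx). exists (firstn x w), (skipn (S x) w). cbn.
    rewrite length_firstn. split; [|split; lia]. rewrite <- Ha. unfold sym.
    clear Ha. revert x Hx; induction w as [|b w IH]; intros [|x] Hx; cbn in *; try lia; [reflexivity|].
    f_equal. apply IH. lia.
Qed.

Lemma seg_cons w x y a v :
  seg w x y (a :: v) <-> sym w x = a /\ S x <= length w /\ seg w (S x) y v.
Proof.
  change (a :: v) with ([a] ++ v). rewrite seg_app. split.
  - intros (z & H & Hv). apply seg_one in H as (H1 & -> & H2). auto.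
  - intros (H1 & H2 & H3). exists (S x). rewrite seg_one. auto.
Qed.

Lemma seg_fun w x y u v : length u = length v -> seg w x y u -> seg w x y v -> u = v.
Proof.
  revert x v; induction u as [|a u IH]; intros x [|b v] E; try discriminate; [reflexivity|].
  rewrite !seg_cons. intros (H1 & _ & H2) (H3 & _ & H4). f_equal; [congruence|].
  eapply IH; eauto.
Qed.

Lemma seg_len w x y v : seg w x y v -> y = x + length v /\ y <= length w.
Proof. intros (u & r & -> & <- & ->). rewrite !length_app. lia. Qed.

Lemma seg_sym w x y v k : seg w x y v -> k < length v -> sym w (x + k) = nth k v 0.
Proof.
  intros (u & r & -> & <- & ->) Hk. unfold sym. rewrite app_nth2_plus. now apply app_nth1.
Qed.

Definition sbit (a : nat) : Prop := a = 1 \/ a = 2.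

(** Names and numbers have no end marker of their own; the first symbol that is not a digit ends
    them, so [z] is a function of [x]. *)
Definition run_to (w : list nat) (x z : nat) : Prop :=
  x <= z /\ (forall u, x <= u < z -> sbit (sym w u)) /\ ~ sbit (sym w z).

(** Compares two places of the input, where [seg] compares a place with a given word; names and
    times of unbounded length require this. *)
Definition segeq (w : list nat) (x x' y y' : nat) : Prop :=
  x <= x' /\ y' = y + (x' - x) /\ forall u, u < x' - x -> sym w (x + u) = sym w (y + u).

Definition ptrs (m : nat) (s : store) : list nat := map s (seq 0 m).

Lemma ptrs_nth m s x : x < m -> nth x (ptrs m s) 0 = s x.
Proof.
  intros H. unfold ptrs. rewrite nth_indep with (d' := s 0) by (now rewrite length_map, length_seq).
  rewrite map_nth, seq_nth by assumption. reflexivity.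
Qed.

Lemma nth_snoc_lt m (l : list nat) x y : length l = m -> x < m -> nth x (l ++ [y]) 0 = nth x l 0.
Proof. intros <- H. now apply app_nth1. Qed.

Lemma nth_snoc_eq m (l : list nat) y : length l = m -> nth m (l ++ [y]) 0 = y.
Proof. intros <-. apply nth_middle. Qed.

Lemma ptrs_length m s : length (ptrs m s) = m.
Proof. unfold ptrs. now rewrite length_map, length_seq. Qed.

Lemma ptrs_agree m s s' : agree m s s' -> ptrs m s' = ptrs m s.
Proof. intros H. apply map_ext_in. intros p Hp. apply in_seq in Hp. apply H; lia. Qed.

Lemma ptrs_S m s : ptrs (S m) s = ptrs m s ++ [s m].
Proof. unfold ptrs. now rewrite seq_S, map_app. Qed.

Lemma run_to_unique w x z z' : run_to w x z -> run_to w x z' -> z = z'.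
Proof.
  intros (H1 & H2 & H3) (H1' & H2' & H3'). destruct (Nat.lt_trichotomy z z') as [H|[H|H]]; auto.
  - destruct H3. apply H2'; lia.
  - destruct H3'. apply H2; lia.
Qed.

(** * The shape of the encoded instance *)

Lemma pos_bits_sbit p : Forall sbit (pos_bits p).
Proof.
  unfold sbit. induction p; cbn [pos_bits]; rewrite ?Forall_app; auto.
Qed.

Lemma bin_sbit o : Forall sbit (bin o).
Proof. unfold bin. destruct (N.of_nat o); [constructor|apply pos_bits_sbit]. Qed.

Lemma unary_sbit z : Forall sbit (unary z).
Proof.
  unfold unary, sbit. constructor; [destruct (Z.ltb z 0); auto|].
  apply Forall_forall. intros x Hx. apply repeat_spec in Hx. auto.
Qed.

Lemma pos_bits_nil p : pos_bits p <> [].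
Proof. destruct p; cbn [pos_bits]; intros E; try apply app_eq_nil in E; intuition discriminate. Qed.

Lemma pos_bits_inj p q : pos_bits p = pos_bits q -> p = q.
Proof.
  revert q; induction p; intros [q|q|]; cbn [pos_bits]; intros E; try reflexivity;
    try (apply app_inj_tail in E as [E E']; try discriminate; f_equal; auto);
    exfalso.
  - apply (app_inj_tail _ []) in E as [E _]. now apply pos_bits_nil in E.
  - apply (app_inj_tail _ []) in E as [E _]. now apply pos_bits_nil in E.
  - symmetry in E. apply (app_inj_tail _ []) in E as [E _]. now apply pos_bits_nil in E.
  - symmetry in E. apply (app_inj_tail _ []) in E as [E _]. now apply pos_bits_nil in E.
Qed.

Lemma bin_inj o o' : bin o = bin o' -> o = o'.
Proof.
  unfold bin. intros E. apply Nat2N.inj.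
  destruct (N.of_nat o), (N.of_nat o'); auto.
  - symmetry in E. now apply pos_bits_nil in E.
  - now apply pos_bits_nil in E.
  - f_equal. now apply pos_bits_inj.
Qed.

Lemma unary_length z : length (unary z) = S (Z.abs_nat z).
Proof. unfold unary. cbn. now rewrite repeat_length. Qed.

Lemma unary_inj z z' : unary z = unary z' -> z = z'.
Proof.
  intros E. pose proof (f_equal (@length nat) E) as El. rewrite !unary_length in El.
  apply (f_equal (hd 0)) in E. cbn [unary hd] in E.
  destruct (Z.ltb_spec z 0), (Z.ltb_spec z' 0); try discriminate; lia.
Qed.

Lemma not_sbit a : a = 0 \/ 3 <= a -> ~ sbit a.
Proof. unfold sbit. lia. Qed.

(** The parsing step: a delimiter that [u] does not contain can only be found behind [u]. *)
Lemma skip_block (c : nat) u v pre suf : ~ In c u -> u ++ v = pre ++ c :: suf ->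
  exists pre', pre = u ++ pre' /\ v = pre' ++ c :: suf.
Proof.
  revert pre; induction u as [|a u IH]; intros pre Hc E; [exists pre; auto|].
  destruct pre as [|b pre]; cbn in E; injection E as -> E.
  - destruct Hc. now left.
  - destruct (IH pre) as (pre' & -> & ->); [intros H; apply Hc; now right|assumption|]. exists pre'. auto.
Qed.

Lemma sbit_notin c u : ~ sbit c -> Forall sbit u -> ~ In c u.
Proof. intros Hc Hu H. now apply Hc, (Forall_in Hu). Qed.

Lemma sbit_split u v a b x y : Forall sbit u -> Forall sbit v -> ~ sbit a -> ~ sbit b ->
  u ++ a :: x = v ++ b :: y -> u = v /\ a :: x = b :: y.
Proof.
  intros Hu Hv Ha Hb. revert v Hv; induction Hu as [|c u Hc Hu IH]; intros [|d v] Hv E; auto.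
  - injection E as -> E. now inversion Hv.
  - injection E as -> E. contradiction.
  - injection E as -> E. inversion Hv; subst. destruct (IH v) as [-> ?]; auto.
Qed.

Definition oc (o : nat) : term := TObj (OConst o).
Definition tc (t : option Z) : list term := match t with Some z => [TTm (TConst z)] | None => [] end.
Definition mk_fact (p : pred) (os : list nat) (t : option Z) : atom := mkAtom p (map oc os ++ tc t).

Definition sorted_as (p : pred) (k : nat) (timed : bool) : Prop :=
  psorts p = repeat SObj k ++ (if timed then [STime] else []).

Definition isSome {A} (x : option A) : bool := if x then true else false.

Definition term_objs (t : term) : list nat := match t with TObj (OConst o) => [o] | _ => [] end.
Definition atom_objs (a : atom) : list nat := flat_map term_objs (aargs a).

(** A fact stripped to predicate, objects and optional time. Derivations, updates and the search in
    the word all work with such triples. *)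
Definition natom : Type := pred * list nat * option Z.
Definition fact_natom (a : atom) : natom := (apred a, atom_objs a, fact_time a).

Lemma all_obj_sorts ss : Forall (fun s => s = SObj) ss -> ss = repeat SObj (length ss).
Proof. intros H. induction H; cbn; congruence. Qed.

Lemma obj_args_ground ts k : Forall2 term_has_sort ts (repeat SObj k) -> Forall term_ground ts ->
  exists os, ts = map oc os /\ length os = k.
Proof.
  revert k; induction ts as [|t ts IH]; intros [|k] H G; inversion H; subst.
  - now exists [].
  - inversion G; subst. destruct (IH k) as (os & -> & <-); auto.
    destruct t as [[o|o]|]; cbn in *; try contradiction. now exists (o :: os).
Qed.

Lemma fact_canonical a : is_fact a ->
  exists os t, a = mk_fact (apred a) os t /\ sorted_as (apred a) (length os) (isSome t).
Proof.
  intros [[Hw Hp] Hg]. destruct a as [p ts]; unfold well_sorted in *; cbn [apred aargs] in *.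
  destruct Hp as [Hp|(rest & Hp & Hr)].
  - apply all_obj_sorts in Hp. rewrite Hp in Hw.
    destruct (obj_args_ground _ _ Hw Hg) as (os & -> & Hl).
    exists os, None. unfold mk_fact, sorted_as; cbn [tc isSome]. rewrite !app_nil_r, Hl. auto.
  - apply all_obj_sorts in Hr. rewrite Hp, Hr in Hw.
    apply Forall2_app_inv_r in Hw as (l1 & l2 & H1 & H2 & ->).
    apply Forall_app in Hg as [G1 G2]. destruct (obj_args_ground _ _ H1 G1) as (os & -> & Hl).
    inversion H2 as [|t s l2' ? Ht Hn]; subst. inversion Hn; subst.
    inversion G2; subst. destruct t as [|[z| |]]; cbn in *; try contradiction.
    exists os, (Some z). unfold mk_fact, sorted_as; cbn [tc isSome].
    rewrite Hp, Hr, Hl. auto.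
Qed.

Lemma fact_natom_mk p os t : fact_natom (mk_fact p os t) = (p, os, t).
Proof.
  unfold fact_natom, mk_fact, atom_objs, fact_time; cbn [apred aargs].
  assert (E : flat_map term_objs (map oc os) = os) by (induction os; cbn; congruence).
  rewrite flat_map_app, E. destruct t as [z|]; cbn [tc].
  - rewrite last_last. cbn [flat_map term_objs app]. now rewrite app_nil_r.
  - cbn [flat_map]. rewrite !app_nil_r. do 2 f_equal. destruct os as [|o os] using rev_ind; [reflexivity|].
    rewrite map_app. cbn [map]. now rewrite last_last.
Qed.

Lemma mk_fact_is_fact p os t : sorted_as p (length os) (isSome t) -> is_fact (mk_fact p os t).
Proof.
  intros H. unfold is_fact, atom_ok, well_sorted, mk_fact; cbn [apred aargs]. rewrite H.
  assert (F : forall l, Forall2 term_has_sort (map oc l) (repeat SObj (length l)))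
    by (induction l; cbn; constructor; cbn; auto).
  assert (R : forall k, Forall (fun s => s = SObj) (repeat SObj k))
    by (intros k; induction k; cbn; auto).
  assert (G : forall l, Forall term_ground (map oc l))
    by (induction l; cbn; constructor; cbn; auto).
  repeat split.
  - apply Forall2_app; [apply F|]. destruct t; cbn; repeat constructor.
  - unfold rigid, temporal. rewrite H. destruct t; cbn [isSome].
    + right. eauto.
    + left. rewrite app_nil_r. apply R.
  - apply Forall_app. split; [apply G|]. destruct t; cbn; repeat constructor.
Qed.

Lemma fact_natom_in D p os t : is_dataset D ->
  In (p, os, t) (map fact_natom D) <->
  pedb p = true /\ sorted_as p (length os) (isSome t) /\ In (mk_fact p os t) D.
Proof.
  intros HD. rewrite in_map_iff. split.
  - intros (a & E & Ha). destruct (Forall_in HD a Ha) as [Hf He].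
    destruct (fact_canonical a Hf) as (os' & t' & Ea & Hs).
    assert (Ea' := Ea). rewrite Ea, fact_natom_mk in E. injection E as E1 -> ->.
    subst p. rewrite <- Ea. auto.
  - intros (_ & _ & H). exists (mk_fact p os t). split; [apply fact_natom_mk|assumption].
Qed.

Definition enc_time (t : option Z) : list nat :=
  match t with Some z => 3 :: 2 :: unary z | None => [] end.

Definition enc_natom (f : natom) : list nat :=
  let '(p, os, t) := f in
  bin (pname p) ++ flat_map (fun o => 3 :: 1 :: bin o) os ++ enc_time t ++ [4].

Lemma enc_fact_mk p os t : enc_fact (mk_fact p os t) = enc_natom (p, os, t).
Proof.
  unfold enc_fact, mk_fact, enc_natom; cbn [apred aargs]. f_equal.
  rewrite flat_map_app, <- app_assoc. f_equal.
  - induction os; cbn; [reflexivity|]. now rewrite IHos.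
  - f_equal. destruct t; [|reflexivity]. cbn. now rewrite app_nil_r.
Qed.

Lemma enc_objs_inj os os' v v' :
  flat_map (fun o => 3 :: 1 :: bin o) os ++ v = flat_map (fun o => 3 :: 1 :: bin o) os' ++ v' ->
  (exists w, v = 4 :: w \/ v = 3 :: 2 :: w) -> (exists w, v' = 4 :: w \/ v' = 3 :: 2 :: w) ->
  os = os' /\ v = v'.
Proof.
  intros E Hv Hv'. assert (N3 : ~ sbit 3) by (apply not_sbit; lia).
  assert (N4 : ~ sbit 4) by (apply not_sbit; lia).
  assert (Hd : forall os v, (exists w, v = 4 :: w \/ v = 3 :: 2 :: w) -> exists a x,
    flat_map (fun o => 3 :: 1 :: bin o) os ++ v = a :: x /\ ~ sbit a).
  { intros [|o l] u (x & [->| ->]); cbn; eauto. }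
  revert os' E; induction os as [|o os IH]; intros [|o' os'] E.
  - auto.
  - exfalso. destruct Hv as (x & [->| ->]); discriminate.
  - exfalso. destruct Hv' as (x & [->| ->]); discriminate.
  - cbn in E. injection E as E. rewrite <- !app_assoc in E.
    destruct (Hd os v Hv) as (a & x & E1 & Ha). destruct (Hd os' v' Hv') as (b & y & E2 & Hb).
    rewrite E1, E2 in E. apply sbit_split in E as [E3 E4]; auto using bin_sbit.
    apply bin_inj in E3 as ->. rewrite <- E1, <- E2 in E4.
    destruct (IH os' E4) as [-> ->]. auto.
Qed.

(** A predicate is encoded by its name alone. Its sorts are recovered from the number of objects and
    the presence of a time, its EDB flag from the first hypothesis. *)
Lemma enc_natom_inj p os t p' os' t' :
  pedb p = pedb p' -> sorted_as p (length os) (isSome t) -> sorted_as p' (length os') (isSome t') ->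
  enc_natom (p, os, t) = enc_natom (p', os', t') -> (p, os, t) = (p', os', t').
Proof.
  intros He Hs Hs' E. unfold enc_natom in E.
  assert (N3 : ~ sbit 3) by (apply not_sbit; lia). assert (N4 : ~ sbit 4) by (apply not_sbit; lia).
  assert (Hd : forall os t, exists a x,
    flat_map (fun o => 3 :: 1 :: bin o) os ++ enc_time t ++ [4] = a :: x /\ ~ sbit a).
  { intros [|o l] [z|]; cbn; eauto. }
  destruct (Hd os t) as (a & x & E1 & Ha). destruct (Hd os' t') as (b & y & E2 & Hb).
  rewrite E1, E2 in E. apply sbit_split in E as [E3 E4]; auto using bin_sbit.
  apply bin_inj in E3. rewrite <- E1, <- E2 in E4.
  apply enc_objs_inj in E4 as [-> E5].
  - assert (t = t') as ->.
    { destruct t as [z|], t' as [z'|]; cbn [enc_time app] in E5; try discriminate; [|reflexivity].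
      f_equal. apply unary_inj. apply (f_equal (skipn 2)) in E5. cbn [skipn] in E5.
      now apply app_inj_tail in E5. }
    do 2 f_equal. destruct p, p'; cbn in *. unfold sorted_as in *; cbn in *. congruence.
  - destruct t; cbn; eauto.
  - destruct t'; cbn; eauto.
Qed.

Definition enc_body (f : natom) : list nat :=
  let '(p, os, t) := f in
  bin (pname p) ++ flat_map (fun o => 3 :: 1 :: bin o) os ++ enc_time t.

Lemma enc_natom_body f : enc_natom f = enc_body f ++ [4].
Proof. destruct f as [[p os] t]. unfold enc_natom, enc_body. now rewrite !app_assoc. Qed.

Lemma body_notin_4 f : ~ In 4 (enc_body f).
Proof.
  destruct f as [[p os] t]. assert (N4 : ~ sbit 4) by (apply not_sbit; lia).
  unfold enc_body. rewrite !in_app_iff. intros [H|[H|H]].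
  - revert H. apply sbit_notin; auto using bin_sbit.
  - apply in_flat_map in H as (o & _ & [H|[H|H]]); try discriminate.
    revert H. apply sbit_notin; auto using bin_sbit.
  - destruct t as [z|]; [|contradiction]. destruct H as [H|[H|H]]; try discriminate.
    revert H. apply sbit_notin; auto using unary_sbit.
Qed.

Definition natom_ok (f : natom) : Prop :=
  let '(p, os, t) := f in pedb p = true /\ sorted_as p (length os) (isSome t).

Lemma dataset_natoms D : is_dataset D ->
  Forall natom_ok (map fact_natom D) /\ flat_map enc_fact D = flat_map enc_natom (map fact_natom D).
Proof.
  induction 1 as [|a D [Hf He] _ [IH1 IH2]]; [split; [constructor|reflexivity]|].
  destruct (fact_canonical a Hf) as (os & t & Ea & Hs). cbn [map flat_map].
  rewrite Ea, fact_natom_mk, enc_fact_mk. split.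
  - constructor; [split; assumption|assumption].
  - now rewrite IH2.
Qed.

(** A fact has no opening symbol, so its start is recognised by the 4 that closes its
    predecessor. *)
Definition fact_start (w : list nat) (y : nat) : Prop := y = 0 \/ exists x, y = S x /\ sym w x = 4.

Definition enc_tail (i : instance) : list nat :=
  [5] ++ unary (itin i) ++ [5] ++ unary (itout i) ++ [5] ++ unary (itmem i).

Lemma tail_sym i x : In x (enc_tail i) -> x = 5 \/ sbit x.
Proof.
  assert (U : forall z, In x (unary z) -> sbit x) by (intros z; apply (Forall_in (unary_sbit z))).
  unfold enc_tail. rewrite !in_app_iff. cbn [In].
  intros [[<-|[]]|[H|[[<-|[]]|[H|[[<-|[]]|H]]]]]; eauto.
Qed.

(** The symbol 4 occurs only at the end of a fact. An occurrence that begins behind a 4 is therefore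
    aligned with the list of facts, and injectivity identifies it. *)
Lemma natom_occurs F f pre R suf :
  Forall natom_ok F -> natom_ok f -> ~ In 4 R ->
  (pre = [] \/ exists pre', pre = pre' ++ [4]) ->
  flat_map enc_natom F ++ R = pre ++ enc_natom f ++ suf -> In f F.
Proof.
  intros HF Hf HR. revert pre.
  induction HF as [|f1 F H1 HF IH]; intros pre Hpre E.
  - exfalso. cbn in E. apply HR. rewrite E, enc_natom_body, !in_app_iff. cbn. auto.
  - cbn [flat_map] in E. rewrite enc_natom_body, <- !app_assoc in E. cbn [app] in E.
    destruct Hpre as [->|(pre' & ->)].
    + left. cbn [app] in E. rewrite enc_natom_body, <- app_assoc in E. cbn [app] in E.
      apply skip_block in E as (u & Eu & Ev); [|apply body_notin_4].
      destruct u as [|c u].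
      * rewrite app_nil_r in Eu. destruct f as [[p os] t], f1 as [[p1 os1] t1].
        apply enc_natom_inj; try apply H1; try apply Hf.
        -- destruct H1, Hf. congruence.
        -- rewrite !enc_natom_body. now rewrite Eu.
      * exfalso. injection Ev as <- Ev. apply (body_notin_4 f). rewrite Eu. apply in_or_app. right. now left.
    + right. rewrite <- app_assoc in E. cbn [app] in E.
      apply skip_block in E as (u & Eu & Ev); [|apply body_notin_4].
      destruct u as [|c u]; cbn in Ev; [injection Ev as Ev|injection Ev as <- Ev].
      * apply (IH []); [now left|exact Ev].
      * apply (IH (u ++ [4])); [right; eauto|]. now rewrite Ev, <- app_assoc.
Qed.

Lemma natom_at F f : In f F -> forall R, exists y suf,
  flat_map enc_natom F ++ R = y ++ enc_natom f ++ suf /\ (y = [] \/ exists y', y = y' ++ [4]).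
Proof.
  intros Hf R. apply in_split in Hf as (F1 & F2 & ->).
  exists (flat_map enc_natom F1), (flat_map enc_natom F2 ++ R). split.
  - rewrite flat_map_app. cbn. now rewrite <- !app_assoc.
  - destruct F1 as [|f1 F1] using rev_ind; [now left|right].
    rewrite flat_map_app. cbn. rewrite app_nil_r, enc_natom_body, app_assoc. eauto.
Qed.

Lemma enc_instance_tail i : enc_instance i = flat_map enc_fact (idata i) ++ enc_tail i.
Proof. reflexivity. Qed.

Lemma fact_start_app u r : fact_start (u ++ r) (length u) <-> u = [] \/ exists u', u = u' ++ [4].
Proof.
  unfold fact_start. split.
  - intros [H|(x & Hx & H4)].
    + left. now apply length_zero_iff_nil.
    + right. destruct u as [|a u] using rev_ind; [discriminate|]. exists u. f_equal. f_equal.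
      rewrite length_app in Hx. cbn in Hx. assert (x = length u) as -> by lia.
      unfold sym in H4. rewrite <- app_assoc in H4. cbn in H4. now rewrite nth_middle in H4.
  - intros [->|(u' & ->)]; [now left|right]. exists (length u'). rewrite length_app. cbn. split; [lia|].
    unfold sym. rewrite <- app_assoc. cbn. apply nth_middle.
Qed.

(** Membership in the dataset becomes a search in the word. The condition [natom_ok] does not
    mention the instance and can be settled when the program is built. *)
Lemma natom_spec i f : is_dataset (idata i) ->
  In f (map fact_natom (idata i)) <->
  natom_ok f /\ exists y z, fact_start (enc_instance i) y /\ seg (enc_instance i) y z (enc_natom f).
Proof.
  intros HD. destruct (dataset_natoms _ HD) as [Hok E]. rewrite enc_instance_tail, E. split.
  - intros Hf. split; [now apply (Forall_in Hok)|].
    destruct (natom_at _ _ Hf (enc_tail i)) as (u & r & Eu & Hu). rewrite Eu.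
    exists (length u), (length u + length (enc_natom f)). split.
    + now apply fact_start_app.
    + exists u, r. auto.
  - intros (Hf & y & z & Hy & (u & r & Eu & <- & _)). rewrite Eu in Hy. apply fact_start_app in Hy.
    apply (natom_occurs _ f u (enc_tail i) r); auto.
    intros H. apply tail_sym in H as [H|H]; [discriminate|]. revert H. apply not_sbit. lia.
Qed.

(** The run starts at the tag 1, which is itself a digit symbol. Maximality of the run makes the
    object a function of [x]. *)
Definition tokis (w : list nat) (x o : nat) : Prop :=
  exists z, seg w x z (3 :: 1 :: bin o) /\ run_to w (S x) z.

Lemma run_to_app u v b r : Forall sbit v -> ~ sbit (sym r 0) -> b = length u + length v ->
  run_to (u ++ v ++ r) (length u) b.
Proof.
  intros Hv Hr ->. unfold run_to, sym. split; [lia|split].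
  - intros x Hx. rewrite app_nth2, app_nth1 by lia. apply (Forall_in Hv), nth_In. lia.
  - rewrite app_nth2_plus, app_nth2, Nat.sub_diag by lia. exact Hr.
Qed.

Definition enc_objs (os : list nat) : list nat := flat_map (fun o => 3 :: 1 :: bin o) os.

Lemma not_in_3 u : Forall sbit u -> ~ In 3 u.
Proof. apply sbit_notin, not_sbit. lia. Qed.

Lemma objs_find os v pre suf : enc_objs os ++ v = pre ++ 3 :: 1 :: suf ->
  (exists o os1 os2, os = os1 ++ o :: os2 /\ pre = enc_objs os1) \/
  exists pre', v = pre' ++ 3 :: 1 :: suf.
Proof.
  revert pre; induction os as [|o os IH]; intros pre E.
  - right. now exists pre.
  - cbn [enc_objs flat_map] in E. destruct pre as [|a pre].
    + left. exists o, [], os. auto.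
    + cbn in E. injection E as <- E. rewrite <- app_assoc in E.
      change ((1 :: bin o) ++ enc_objs os ++ v = pre ++ 3 :: 1 :: suf) in E.
      apply skip_block in E as (pre' & -> & E).
      * destruct (IH pre' E) as [(o' & os1 & os2 & -> & ->)|H]; [left|right; exact H].
        exists o', (o :: os1), os2. auto.
      * intros [H|H]; [discriminate|]. revert H. apply not_in_3, bin_sbit.
Qed.

(** The pair 3, 1 marks object arguments only: times are tagged 3, 2, and the tail of the instance
    contains no 3. Two symbols thus suffice to recognise a token. *)
Lemma natoms_find F R pre suf : ~ In 3 R ->
  flat_map enc_natom F ++ R = pre ++ 3 :: 1 :: suf ->
  exists p os1 o os2 t v, In (p, os1 ++ o :: os2, t) F /\
    pre = v ++ bin (pname p) ++ enc_objs os1 /\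
    exists r, flat_map enc_natom F ++ R = v ++ enc_natom (p, os1 ++ o :: os2, t) ++ r.
Proof.
  intros HR. revert pre; induction F as [|[[p os] t] F IH]; intros pre E.
  - exfalso. cbn in E. apply HR. rewrite E. apply in_or_app. right. now left.
  - cbn [flat_map] in E |- *. rewrite <- app_assoc in E |- *. assert (E0 := E).
    unfold enc_natom in E at 1. fold enc_natom in E. fold (enc_objs os) in E.
    rewrite <- app_assoc in E.
    apply skip_block in E as (pre1 & -> & E); [|apply not_in_3, bin_sbit].
    rewrite <- app_assoc in E. apply objs_find in E as [(o & os1 & os2 & -> & ->)|(pre2 & E)].
    + exists p, os1, o, os2, t, []. split; [now left|]. split; [reflexivity|]. eexists; reflexivity.
    + assert (exists pre3, flat_map enc_natom F ++ R = pre3 ++ 3 :: 1 :: suf /\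
        enc_natom (p, os, t) ++ pre3 = bin (pname p) ++ pre1) as (pre3 & E3 & Epre).
      { assert (Hx : exists pre3, flat_map enc_natom F ++ R = pre3 ++ 3 :: 1 :: suf).
        { destruct t as [z|]; cbn [enc_time] in E.
          - pose proof (unary_sbit z) as Hz. revert Hz E. generalize (unary z). intros uz Hz E.
            destruct pre2 as [|a [|b pre2]]; cbn [app] in E; try discriminate.
            injection E as <- <- E. rewrite <- app_assoc in E.
            apply skip_block in E as (pre4 & -> & E); [|now apply not_in_3].
            apply (skip_block 3 [4]) in E as (pre5 & -> & E); [eauto|]. cbn. lia.
          - apply (skip_block 3 [4]) in E as (pre5 & -> & E); [eauto|]. cbn. lia. }
        destruct Hx as (pre3 & E3). exists pre3. split; [assumption|].
        apply (app_inv_tail (3 :: 1 :: suf)). rewrite <- !app_assoc, <- E3. rewrite <- app_assoc in E0. exact E0. }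
      destruct (IH pre3 E3) as (p' & os1 & o & os2 & t' & v & H1 & -> & r & H3).
      exists p', os1, o, os2, t', (enc_natom (p, os, t) ++ v). split; [now right|]. split.
      * rewrite <- Epre. now rewrite !app_assoc.
      * exists r. now rewrite H3, <- app_assoc.
Qed.

Definition dobjs (D : dataset) : list nat := flat_map atom_objs D.

Lemma dobjs_natoms D o :
  In o (dobjs D) <-> exists p os t, In (p, os, t) (map fact_natom D) /\ In o os.
Proof.
  unfold dobjs. rewrite in_flat_map. split.
  - intros (a & Ha & Ho). exists (apred a), (atom_objs a), (fact_time a). split; [|assumption].
    apply in_map_iff. exists a. auto.
  - intros (p & os & t & Ha & Ho). apply in_map_iff in Ha as (a & [= <- <- <-] & Ha). eauto.
Qed.

Lemma tok_in_objs w v p os1 o os2 t r :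
  w = v ++ enc_natom (p, os1 ++ o :: os2, t) ++ r ->
  tokis w (length (v ++ bin (pname p) ++ enc_objs os1)) o.
Proof.
  intros ->. unfold tokis. set (u := v ++ bin (pname p) ++ enc_objs os1).
  set (r' := enc_objs os2 ++ enc_time t ++ [4] ++ r).
  assert (E : v ++ enc_natom (p, os1 ++ o :: os2, t) ++ r = u ++ (3 :: 1 :: bin o) ++ r').
  { unfold u, r', enc_natom, enc_objs. rewrite flat_map_app. cbn. rewrite <- !app_assoc. cbn.
    rewrite <- !app_assoc. reflexivity. }
  rewrite E. exists (length u + length (3 :: 1 :: bin o)). split.
  - exists u, r'. auto.
  - replace (u ++ (3 :: 1 :: bin o) ++ r') with ((u ++ [3]) ++ (1 :: bin o) ++ r')
      by now rewrite <- app_assoc.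
    replace (S (length u)) with (length (u ++ [3])) by (rewrite length_app; cbn; lia).
    apply run_to_app.
    + constructor; [now left|apply bin_sbit].
    + apply not_sbit. unfold r'. destruct os2; [destruct t|]; cbn; lia.
    + rewrite length_app. cbn. lia.
Qed.

Lemma dobjs_tok i o : is_dataset (idata i) -> In o (dobjs (idata i)) ->
  exists x, x <= length (enc_instance i) /\ tokis (enc_instance i) x o.
Proof.
  intros HD Ho. apply dobjs_natoms in Ho as (p & os & t & Hf & Ho).
  rewrite enc_instance_tail, (proj2 (dataset_natoms _ HD)).
  apply in_split in Ho as (os1 & os2 & ->).
  destruct (natom_at _ _ Hf (enc_tail i)) as (u & r & Eu & _).
  eexists. split; [|eapply tok_in_objs, Eu].
  rewrite Eu. unfold enc_natom, enc_objs. rewrite flat_map_app, !length_app. lia.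
Qed.

Lemma tok_dobjs i x : is_dataset (idata i) ->
  sym (enc_instance i) x = 3 -> sym (enc_instance i) (S x) = 1 ->
  exists o, tokis (enc_instance i) x o /\ In o (dobjs (idata i)).
Proof.
  intros HD H3 H1. set (w := enc_instance i) in *.
  assert (exists z, seg w x z [3; 1]) as (z & u & r & E & Hu & _).
  { exists (S (S x)). rewrite seg_cons, seg_one.
    assert (L : forall y, sym w y <> 0 -> S y <= length w).
    { intros y Hy. destruct (Nat.lt_ge_cases y (length w)); [lia|]. exfalso. apply Hy.
      unfold sym. now apply nth_overflow. }
    repeat split; auto; apply L; lia. }
  assert (E0 : w = flat_map enc_natom (map fact_natom (idata i)) ++ enc_tail i)
    by (unfold w; now rewrite enc_instance_tail, (proj2 (dataset_natoms _ HD))).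
  assert (E1 := E). rewrite E0 in E1. cbn [app] in E1.
  apply natoms_find in E1 as (p & os1 & o & os2 & t & v & Hin & Eu & r' & Er).
  - exists o. rewrite <- E0 in Er. split.
    + subst x u. eapply tok_in_objs, Er.
    + apply dobjs_natoms. exists p, (os1 ++ o :: os2), t. split; [assumption|]. apply in_or_app. right. now left.
  - intros H. apply tail_sym in H as [H|H]; [discriminate|]. revert H. apply not_sbit. lia.
Qed.

Lemma tokis_sym w x o : tokis w x o -> sym w x = 3 /\ sym w (S x) = 1.
Proof. intros (z & H & _). rewrite !seg_cons in H. tauto. Qed.

Lemma tokis_fun w x o o' : tokis w x o -> tokis w x o' -> o = o'.
Proof.
  intros (z & H & R) (z' & H' & R'). pose proof (run_to_unique _ _ _ _ R R') as <-.
  pose proof (seg_len _ _ _ _ H) as [L _]. pose proof (seg_len _ _ _ _ H') as [L' _]. cbn in L, L'.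
  apply bin_inj. assert (E : 3 :: 1 :: bin o = 3 :: 1 :: bin o').
  { eapply seg_fun; [|exact H|exact H']. cbn. lia. }
  now injection E.
Qed.

Lemma enc_instance_sym i x : In x (enc_instance i) -> 0 < x < 6.
Proof.
  assert (S1 : forall l x, Forall sbit l -> In x l -> 0 < x < 6).
  { intros l y Hl Hy. apply (Forall_in Hl) in Hy. unfold sbit in Hy. lia. }
  rewrite enc_instance_tail, in_app_iff. intros [H|H].
  - apply in_flat_map in H as (a & _ & H). unfold enc_fact in H. rewrite !in_app_iff in H.
    destruct H as [H|[H|[<-|[]]]]; [eapply S1; [apply bin_sbit|exact H]| |lia].
    apply in_flat_map in H as (t & _ & H).
    destruct t as [[o|]|[z| |]]; cbn [enc_arg] in H;
      repeat (destruct H as [<-|H]; [lia|]); try contradiction;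
      (eapply S1; [|exact H]); [apply bin_sbit|apply (unary_sbit z)].
  - apply tail_sym in H as [->|H]; [lia|]. unfold sbit in H. lia.
Qed.

Lemma enc_instance_nil i : enc_instance i <> [].
Proof. rewrite enc_instance_tail. intros E. apply app_eq_nil in E as [_ E]. discriminate. Qed.

(** * Predicates decided by pointer programs *)

Notation enc := enc_instance.

(* The truth value of [P i l] is computed on the word [enc i] from the positions [l] held by
   pointers [0 .. m-1], which are left unchanged. *)
Definition dec (m : nat) (P : instance -> list nat -> Prop) : Prop :=
  exists c, forall i s, valid_instance i -> rng (enc i) s ->
    exists b s', exec (enc i) c s b s' /\ agree m s s' /\ (b = true <-> P i (ptrs m s)).

Definition wfp (m : nat) (i : instance) (l : list nat) : Prop :=
  length l = m /\ forall x, nth x l 0 <= length (enc i).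

Lemma wfp_ptrs m i s : rng (enc i) s -> wfp m i (ptrs m s).
Proof.
  intros H. split; [apply ptrs_length|]. intros x. destruct (Nat.lt_ge_cases x m).
  - rewrite ptrs_nth by assumption. apply H.
  - rewrite nth_overflow by (now rewrite ptrs_length). lia.
Qed.

Lemma dec_ext m P Q : dec m P ->
  (forall i l, valid_instance i -> wfp m i l -> P i l <-> Q i l) -> dec m Q.
Proof.
  intros [c Hc] H. exists c. intros i s Hi Hs. destruct (Hc i s Hi Hs) as (b & s' & E & A & Hb).
  exists b, s'. split; [exact E|split; [exact A|]]. rewrite Hb. apply H; auto using wfp_ptrs.
Qed.

Lemma dec_not m P : dec m P -> dec m (fun i l => ~ P i l).
Proof.
  intros [c Hc]. exists (CNot c). intros i s Hi Hs. destruct (Hc i s Hi Hs) as (b & s' & E & A & Hb).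
  exists (negb b), s'. split; [now apply ex_not|split; [exact A|]]. rewrite <- Hb.
  destruct b; cbn; intuition congruence.
Qed.

Lemma dec_and m P Q : dec m P -> dec m Q -> dec m (fun i l => P i l /\ Q i l).
Proof.
  intros [c Hc] [d Hd]. exists (CIf c d CFalse). intros i s Hi Hs.
  destruct (Hc i s Hi Hs) as (b & s' & E & A & Hb).
  destruct b.
  - destruct (Hd i s' Hi (exec_rng _ _ _ _ _ E Hs)) as (b & s2 & E2 & A2 & Hb2).
    exists b, s2. rewrite (ptrs_agree _ _ _ A) in Hb2.
    split; [eapply ex_if; [exact E|exact E2]|split; [now apply (agree_trans m m _ s')|]].
    intuition.
  - exists false, s'. split; [eapply ex_if; [exact E|apply exec_false]|split; [exact A|]].
    intuition discriminate.
Qed.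

Lemma dec_or m P Q : dec m P -> dec m Q -> dec m (fun i l => P i l \/ Q i l).
Proof.
  intros HP HQ. eapply dec_ext; [apply dec_not, dec_and; apply dec_not; [exact HP|exact HQ]|].
  intros i l _ _. cbn. tauto.
Qed.

(** For a proposition independent of the instance one of the two constant programs is correct;
    excluded middle picks it. *)
Lemma dec_const m (A : Prop) : dec m (fun _ _ => A).
Proof.
  destruct (classic A) as [HA|HA].
  - exists CTrue. intros i s _ _. exists true, s. split; [apply exec_true|].
    split; [apply agree_refl|tauto].
  - exists CFalse. intros i s _ _. exists false, s. split; [apply exec_false|].
    split; [apply agree_refl|intuition discriminate].
Qed.

(** The list is known when the program is built, so the disjunction is unrolled into the code. *)
Lemma dec_exists_in {A} m (xs : list A) (P : A -> instance -> list nat -> Prop) :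
  (forall a, In a xs -> dec m (P a)) -> dec m (fun i l => exists a, In a xs /\ P a i l).
Proof.
  induction xs as [|a xs IH]; intros H.
  - eapply dec_ext; [apply (dec_const m False)|]. intros i l _ _. cbn. firstorder.
  - eapply dec_ext; [apply dec_or; [apply (H a); now left|apply IH; intros; apply H; now right]|].
    intros i l _ _. cbn. firstorder congruence.
Qed.

Lemma dec_forall_in {A} m (xs : list A) (P : A -> instance -> list nat -> Prop) :
  (forall a, In a xs -> dec m (P a)) -> dec m (fun i l => forall a, In a xs -> P a i l).
Proof.
  intros H. eapply dec_ext; [apply dec_not, (dec_exists_in m xs (fun a i l => ~ P a i l))|].
  - intros a Ha. apply dec_not; auto.
  - intros i l _ _. cbn. split; [|firstorder]. intros N a Ha. apply NNPP. firstorder.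
Qed.

Lemma dec_sym m x a : x < m -> dec m (fun i l => sym (enc i) (nth x l 0) = a).
Proof.
  intros Hx. exists (COp (OSym x a)). intros i s _ _. eexists _, s. split; [apply exec_sym|].
  split; [apply agree_refl|]. rewrite ptrs_nth by assumption. apply Nat.eqb_eq.
Qed.

Lemma dec_eq m x y : x < m -> y < m -> dec m (fun i l => nth x l 0 = nth y l 0).
Proof.
  intros Hx Hy. exists (COp (OEq x y)). intros i s _ _. eexists _, s. split; [apply exec_eq|].
  split; [apply agree_refl|]. rewrite !ptrs_nth by assumption. apply Nat.eqb_eq.
Qed.

Lemma enc_zero i x : sym (enc i) x = 0 <-> length (enc i) <= x.
Proof. exact (sym_zero (enc i) x (enc_instance_sym i)). Qed.

(** Pointer [m] runs through all positions; the program for [P] preserves it and takes its own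
    scratch pointers above it. *)
Lemma dec_ex m P : dec (S m) P ->
  dec m (fun i l => exists y, y <= length (enc i) /\ P i (l ++ [y])).
Proof.
  intros [c Hc].
  set (t := CIf c CFalse (CNot (COp (OSym m 0)))).
  (* A loop always returns true, so [c] runs once more at the position where the loop stopped. *)
  exists (CSeq (COp (OReset m)) (CSeq (CWhile t (COp (OInc m))) c)).
  intros i s Hi Hs. set (w := enc i) in *.
  destruct (while_rule w t (COp (OInc m)) (fun s' => length w - s' m)
    (fun s' => rng w s' /\ agree m s s' /\ forall y, y < s' m -> ~ P i (ptrs m s ++ [y]))
    (fun s' => rng w s' /\ agree m s s' /\ (forall y, y < s' m -> ~ P i (ptrs m s ++ [y])) /\
       (P i (ptrs m s ++ [s' m]) \/ s' m = length w))) with (s := upd s m 0) as (s1 & E & R & A & N & H).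
  - intros s1 (R & A & N). destruct (Hc i s1 Hi R) as (b & s2 & E & A2 & Hb).
    rewrite ptrs_S, (ptrs_agree _ _ _ A) in Hb.
    pose proof (exec_rng _ _ _ _ _ E R) as R2. fold w in R2. pose proof (A2 m ltac:(lia)) as Em.
    assert (A' : agree m s s2) by (intros p Hp; rewrite A2 by lia; now apply A).
    destruct b.
    + exists false, s2. split; [eapply ex_if; [exact E|apply exec_false]|].
      rewrite Em. repeat split; auto. left. now apply Hb.
    + exists (negb (sym w (s2 m) =? 0)), s2.
      split; [eapply ex_if; [exact E|apply ex_not, exec_sym]|].
      destruct (Nat.eqb_spec (sym w (s2 m)) 0) as [E0|E0]; cbn [negb].
      * apply enc_zero in E0. fold w in E0. pose proof (R2 m). rewrite Em in *.
        repeat split; auto. right. lia.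
      * assert (s2 m < length w).
        { destruct (Nat.lt_ge_cases (s2 m) (length w)); [assumption|]. exfalso.
          now apply E0, enc_zero. }
        eexists _, _. split; [now apply exec_inc|]. rewrite upd_eq, Em in *.
        repeat split; try lia.
        -- apply rng_upd; [assumption|lia].
        -- apply agree_upd; [assumption|lia].
        -- intros y Hy. destruct (Nat.eq_dec y (s1 m)) as [->|]; [|apply N; lia].
           intros HP. apply Hb in HP. discriminate.
  - rewrite upd_eq. repeat split.
    + apply rng_upd; [assumption|lia].
    + apply agree_upd; [apply agree_refl|lia].
    + lia.
  - destruct (Hc i s1 Hi R) as (b & s2 & E2 & A2 & Hb).
    rewrite ptrs_S, (ptrs_agree _ _ _ A) in Hb.
    exists b, s2. split; [|split].
    + eapply exec_seq; [apply exec_reset|]. eapply exec_seq; [exact E|exact E2].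
    + intros p Hp. rewrite A2 by lia. now apply A.
    + rewrite Hb. fold w. split.
      * intros HP. exists (s1 m). split; [apply R|assumption].
      * intros (y & Hy & HP). destruct H as [H|H]; [assumption|].
        destruct (Nat.eq_dec y (s1 m)) as [<-|]; [assumption|]. exfalso. apply (N y); [lia|assumption].
Qed.

(** At the end of the word an increment leaves the pointer in place; the test for the blank keeps
    [x = y = length (enc i)] from passing. *)
Lemma dec_succ m x y : x < m -> y < m -> dec m (fun i l => nth y l 0 = S (nth x l 0)).
Proof.
  intros Hx Hy.
  exists (CSeq (CCopy m x) (CIf (COp (OSym m 0)) CFalse (CSeq (COp (OInc m)) (COp (OEq m y))))).
  intros i s Hi Hs. destruct (exec_copy (enc i) m x s) as (s1 & E1 & Em & A); [lia|assumption|].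
  assert (A1 : agree m s s1) by (intros p Hp; apply A; lia).
  rewrite !ptrs_nth by assumption.
  pose proof (enc_zero i (s x)) as Z. pose proof (Hs y).
  destruct (Nat.eq_dec (sym (enc i) (s x)) 0) as [E0|E0].
  - exists false, s1. split; [|split; [assumption|]].
    + eapply exec_seq; [exact E1|]. eapply ex_if; [apply exec_sym|]. rewrite Em, E0. apply exec_false.
    + split; [discriminate|]. intros Hy0. apply Z in E0. lia.
  - exists (S (s x) =? s y), (upd s1 m (S (s x))). split; [|split].
    + eapply exec_seq; [exact E1|]. eapply ex_if; [apply exec_sym|].
      rewrite Em. apply Nat.eqb_neq in E0 as E0'. rewrite E0'.
      eapply exec_seq; [apply exec_inc; rewrite Em; lia|]. rewrite Em.
      pose proof (exec_eq (enc i) m y (upd s1 m (S (s x)))) as E2.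
      rewrite upd_eq, upd_neq, (A1 y) in E2 by lia. exact E2.
    + apply agree_upd; [assumption|lia].
    + rewrite Nat.eqb_eq. split; auto.
Qed.

Lemma dec_run m x z : x < m -> z < m -> dec m (fun i l => run_to (enc i) (nth x l 0) (nth z l 0)).
Proof.
  intros Hx Hz.
  set (t := CIf (COp (OSym m 1)) CTrue (COp (OSym m 2))).
  exists (CSeq (CCopy m x) (CSeq (CWhile t (COp (OInc m))) (COp (OEq m z)))).
  intros i s Hi Hs. set (w := enc i) in *.
  destruct (exec_copy w m x s) as (s0 & E0 & Em & A); [lia|assumption|].
  assert (T : forall s, exec w t s ((sym w (s m) =? 1) || (sym w (s m) =? 2)) s).
  { intros s'. eapply ex_if; [apply exec_sym|]. destruct (sym w (s' m) =? 1); [apply exec_true|apply exec_sym]. }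
  assert (TB : forall a, ((a =? 1) || (a =? 2))%bool = true <-> sbit a).
  { intros a. unfold sbit. rewrite Bool.orb_true_iff, !Nat.eqb_eq. reflexivity. }
  destruct (while_rule w t (COp (OInc m)) (fun s' => length w - s' m)
    (fun s' => agree m s s' /\ s x <= s' m <= length w /\ forall u, s x <= u < s' m -> sbit (sym w u))
    (fun s' => agree m s s' /\ run_to w (s x) (s' m))) with (s := s0) as (s1 & E & A1 & R).
  - intros s1 (A1 & R & H). eexists _, s1. split; [apply T|].
    destruct ((sym w (s1 m) =? 1) || (sym w (s1 m) =? 2))%bool eqn:Eb.
    + apply TB in Eb. assert (s1 m < length w).
      { destruct (Nat.lt_ge_cases (s1 m) (length w)) as [|Hge]; [assumption|]. exfalso.
        apply (enc_zero i) in Hge. fold w in Hge. unfold sbit in Eb. lia. }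
      eexists _, _. split; [now apply exec_inc|]. rewrite upd_eq. repeat split; try lia.
      * apply agree_upd; [assumption|lia].
      * intros u Hu. destruct (Nat.eq_dec u (s1 m)) as [->|]; [assumption|apply H; lia].
    + split; [assumption|]. split; [lia|]. split; [assumption|]. rewrite <- TB. congruence.
  - split; [intros p Hp; apply A; lia|]. rewrite Em. pose proof (Hs x).
    split; [unfold w in *; lia|]. lia.
  - exists (s1 m =? s1 z), s1. split; [|split; [assumption|]].
    + eapply exec_seq; [exact E0|]. eapply exec_seq; [exact E|]. apply exec_eq.
    + rewrite !ptrs_nth, (A1 z) by assumption. rewrite Nat.eqb_eq. split.
      * intros <-. exact R.
      * intros R'. eapply run_to_unique; eassumption.
Qed.

(** No operation compares the symbols under two pointers, so the code goes through the alphabet. *)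
Definition CSymEqIn (xs : list nat) (p q : nat) : cmd :=
  fold_right (fun a c => CIf (COp (OSym p a)) (COp (OSym q a)) c) CFalse xs.

Lemma exec_symeq_in w xs p q s : exists b, exec w (CSymEqIn xs p q) s b s /\
  (b = true <-> In (sym w (s p)) xs /\ sym w (s p) = sym w (s q)).
Proof.
  induction xs as [|a xs (b & E & H)].
  - exists false. split; [apply exec_false|]. cbn. intuition discriminate.
  - exists (if sym w (s p) =? a then sym w (s q) =? a else b). cbn [CSymEqIn fold_right In]. split.
    + eapply ex_if; [apply exec_sym|]. destruct (sym w (s p) =? a); [apply exec_sym|exact E].
    + destruct (Nat.eqb_spec (sym w (s p)) a) as [E1|E1]; [rewrite Nat.eqb_eq|rewrite H];
        intuition congruence.
Qed.

(** The blank is left out, so that after a success both pointers can still be advanced. *)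
Definition CSymEq : nat -> nat -> cmd := CSymEqIn [1; 2; 3; 4; 5].

Lemma exec_symeq i p q s : let w := enc i in
  exec w (CSymEq p q) s (negb (sym w (s p) =? 0) && (sym w (s p) =? sym w (s q))) s.
Proof.
  intros w. destruct (exec_symeq_in w [1; 2; 3; 4; 5] p q s) as (b & E & H).
  replace (negb (sym w (s p) =? 0) && (sym w (s p) =? sym w (s q)))%bool with b; [exact E|].
  apply Bool.eq_iff_eq_true. rewrite H, Bool.andb_true_iff, Bool.negb_true_iff, Nat.eqb_neq, Nat.eqb_eq.
  pose proof (sym_bound w (s p) (enc_instance_sym i)) as B. cbn [In]. lia.
Qed.

Lemma dec_segeq m x x' y y' : x < m -> x' < m -> y < m -> y' < m ->
  dec m (fun i l => segeq (enc i) (nth x l 0) (nth x' l 0) (nth y l 0) (nth y' l 0)).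
Proof.
  intros Hx Hx' Hy Hy'.
  set (t := CIf (CNot (COp (OEq m x'))) (CSymEq m (S m)) CFalse).
  exists (CSeq (CCopy m x) (CSeq (CCopy (S m) y)
    (CSeq (CWhile t (CSeq (COp (OInc m)) (COp (OInc (S m)))))
          (CIf (COp (OEq m x')) (COp (OEq (S m) y')) CFalse)))).
  intros i s Hi Hs. set (w := enc i) in *.
  destruct (exec_copy w m x s) as (s0 & E0 & Em & A); [lia|assumption|].
  destruct (exec_copy w (S m) y s0) as (s1 & E1 & ESm & A1);
    [lia|now apply (exec_rng _ _ _ _ _ E0)|].
  assert (A2 : agree m s s1) by (intros p Hp; rewrite A1 by lia; apply A; lia).
  set (T s := (negb (s m =? s x') && (negb (sym w (s m) =? 0) && (sym w (s m) =? sym w (s (S m)))))%bool).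
  assert (HT : forall s, exec w t s (T s) s).
  { intros s'. apply exec_and; [apply ex_not, exec_eq|apply exec_symeq]. }
  destruct (while_rule w t (CSeq (COp (OInc m)) (COp (OInc (S m)))) (fun s' => length w - s' m)
    (fun s' => agree m s s' /\ exists k, s' m = s x + k /\ s' (S m) = s y + k /\
       (s x <= s x' -> k <= s x' - s x) /\ forall u, u < k -> sym w (s x + u) = sym w (s y + u))
    (fun s' => agree m s s' /\ T s' = false /\ exists k, s' m = s x + k /\ s' (S m) = s y + k /\
       (s x <= s x' -> k <= s x' - s x) /\ forall u, u < k -> sym w (s x + u) = sym w (s y + u)))
    with (s := s1) as (s2 & E2 & A3 & HF & k & K1 & K2 & K3 & K4).
  - intros s2 (A3 & k & K1 & K2 & K3 & K4). exists (T s2), s2. split; [apply HT|].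
    destruct (T s2) eqn:ET.
    + apply andb_prop in ET as [T1 ET]. apply andb_prop in ET as [T2 T3].
      apply Bool.negb_true_iff, Nat.eqb_neq in T1, T2. apply Nat.eqb_eq in T3.
      assert (s2 m < length w /\ s2 (S m) < length w) as [L1 L2].
      { split; apply Nat.nle_gt; intros Hge; apply (enc_zero i) in Hge; fold w in Hge; congruence. }
      exists true, (upd (upd s2 m (S (s2 m))) (S m) (S (s2 (S m)))). split.
      { eapply exec_seq; [now apply exec_inc|].
        pose proof (exec_inc w (S m) (upd s2 m (S (s2 m)))) as E.
        rewrite upd_neq in E by lia. now apply E. }
      assert (U : upd (upd s2 m (S (s2 m))) (S m) (S (s2 (S m))) m = S (s2 m))
        by (rewrite upd_neq, upd_eq by lia; reflexivity).
      rewrite (A3 x') in T1 by assumption. cbv beta. rewrite !U.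
      split; [split|lia].
      * apply agree_upd; [|lia]. apply agree_upd; [assumption|lia].
      * exists (S k). rewrite upd_eq. repeat split; try lia.
        intros u Hu. destruct (Nat.eq_dec u k) as [->|]; [congruence|apply K4; lia].
    + eauto 10.
  - split; [assumption|]. exists 0. rewrite ESm, (A1 m), Em, (A y) by lia.
    repeat split; lia.
  - eexists _, s2. split; [|split; [assumption|]].
    + eapply exec_seq; [exact E0|]. eapply exec_seq; [exact E1|]. eapply exec_seq; [exact E2|].
      apply exec_and; apply exec_eq.
    + rewrite !ptrs_nth by assumption. rewrite (A3 x'), (A3 y') by assumption.
      rewrite Bool.andb_true_iff, !Nat.eqb_eq, K1, K2. unfold segeq. split.
      * intros [H1 H2]. split; [lia|split; [lia|]]. intros u Hu. apply K4. lia.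
      (* If the scan stopped before [x'], the symbols agree by [H3], so it stopped at a blank; but
         the positions before [x'] lie inside the word. *)
      * intros (H1 & H2 & H3). enough (k = s x' - s x) by lia.
        destruct (Nat.eq_dec k (s x' - s x)) as [|Hk]; [assumption|exfalso].
        unfold T in HF. rewrite K1, K2, (A3 x'), H3, Nat.eqb_refl, Bool.andb_true_r in HF
          by (assumption || (specialize (K3 H1); lia)).
        rewrite <- H3 in HF by (specialize (K3 H1); lia).
        apply Bool.andb_false_iff in HF as [HF|HF]; apply Bool.negb_false_iff, Nat.eqb_eq in HF.
        -- lia.
        -- apply (enc_zero i) in HF. fold w in HF. pose proof (Hs x'). specialize (K3 H1).
           unfold w in *. lia.
Qed.

Lemma dec_ex_ext m (Q : instance -> list nat -> nat -> Prop) (R : instance -> list nat -> Prop) :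
  dec (S m) R -> (forall i l y, valid_instance i -> length l = m -> y <= length (enc i) ->
    R i (l ++ [y]) <-> Q i l y) ->
  dec m (fun i l => exists y, y <= length (enc i) /\ Q i l y).
Proof.
  intros H HR. eapply dec_ext; [apply dec_ex, H|]. intros i l Hi [Hl _]. cbn.
  split; intros (y & Hy & H1); exists y; (split; [assumption|]); now apply (HR i l y).
Qed.

Lemma dec_seg m x y v : x < m -> y < m -> dec m (fun i l => seg (enc i) (nth x l 0) (nth y l 0) v).
Proof.
  revert m x; induction v as [|a v IH]; intros m x Hx Hy.
  - eapply dec_ext; [apply (dec_eq m x y); assumption|]. intros i l _ [_ Hl]. cbn.
    rewrite seg_nil. pose proof (Hl x). tauto.
  - eapply dec_ext with (P := fun i l => sym (enc i) (nth x l 0) = a /\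
      exists z, z <= length (enc i) /\ (z = S (nth x l 0) /\ seg (enc i) z (nth y l 0) v)).
    + apply dec_and; [now apply dec_sym|].
      eapply dec_ex_ext; [apply dec_and; [apply (dec_succ (S m) x m)|apply (IH (S m) m)]; lia|].
      intros i l z _ Hl _. cbn. rewrite !(nth_snoc_eq m), !(nth_snoc_lt m) by assumption. reflexivity.
    + intros i l _ _. cbn. rewrite seg_cons. split.
      * intros (H1 & z & H2 & -> & H3). auto.
      * intros (H1 & H2 & H3). eauto 6.
Qed.

Lemma seg_iff_sym w x y v :
  seg w x y v <-> y = x + length v /\ x + length v <= length w /\
    forall k, k < length v -> sym w (x + k) = nth k v 0.
Proof.
  split.
  - intros H. pose proof (seg_len _ _ _ _ H) as [-> L]. split; [reflexivity|]. split; [assumption|].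
    intros k Hk. exact (seg_sym _ _ _ _ _ H Hk).
  - revert x; induction v as [|a v IH]; intros x (-> & L & H); cbn [length] in *.
    + apply seg_nil. lia.
    + apply seg_cons. split; [|split; [lia|]].
      * rewrite <- (Nat.add_0_r x). now rewrite H by lia.
      * apply IH. split; [lia|]. split; [lia|]. intros k Hk. specialize (H (S k)). cbn in H.
        rewrite <- H by lia. f_equal. lia.
Qed.

(** Once one place is known to hold [v], comparing two places amounts to finding [v], although [v]
    is not known to the program. *)
Lemma segeq_seg w a b x y v : seg w a b v -> y <= length w -> segeq w a b x y <-> seg w x y v.
Proof.
  rewrite !seg_iff_sym. intros (-> & La & Ha) Ly. unfold segeq. split.
  - intros (_ & -> & H). replace (a + length v - a) with (length v) in * by lia.
    split; [reflexivity|]. split; [lia|]. intros k Hk. rewrite <- H by lia. now apply Ha.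
  - intros (-> & Lx & H). replace (a + length v - a) with (length v) by lia.
    split; [lia|]. split; [lia|]. intros u Hu. rewrite Ha, H by assumption. reflexivity.
Qed.

(** * Adding a constant to a unary number *)

Lemma unary_app z z' n : Z.ltb z 0 = Z.ltb z' 0 -> Z.abs_nat z' = Z.abs_nat z + n ->
  unary z' = unary z ++ repeat 1 n.
Proof. intros Hs Ha. unfold unary. rewrite Hs, Ha, repeat_app. reflexivity. Qed.

Definition small (n : nat) : list Z := map (fun k => (Z.of_nat k - Z.of_nat n)%Z) (seq 0 (2 * n + 1)).

Lemma in_small n z : In z (small n) <-> (Z.abs z <= Z.of_nat n)%Z.
Proof.
  unfold small. rewrite in_map_iff. split.
  - intros (k & <- & Hk). apply in_seq in Hk. lia.
  - intros H. exists (Z.to_nat (z + Z.of_nat n)). rewrite in_seq. lia.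
Qed.

(** If [[a .. b)] holds [z], this says that [[x .. y)] holds [z + j], for unbounded [z] and constant
    [j]. Values up to [|j|] in size are enumerated, because the sign may change there. Beyond them
    [z + j] has the sign of [z], and one of the two words is the other followed by [n] ones: the
    second clause is for numbers moving away from 0, the third for numbers moving towards it. *)
Definition shift_test (w : list nat) (j : Z) (a b x y : nat) : Prop :=
  let n := Z.abs_nat j in
  (exists k, In k (small n) /\ (seg w a b (unary k) /\ seg w x y (unary (k + j)))) \/
  ((forall k, In k (small n) -> ~ seg w a b (unary k)) /\
   (if Z.ltb j 0 then sym w a = 2 else sym w a = 1) /\
   exists t, t <= length w /\ (segeq w a b x t /\ seg w t y (repeat 1 n))) \/
  ((forall k, In k (small n) -> ~ seg w a b (unary k)) /\
   (if Z.ltb j 0 then sym w a = 1 else sym w a = 2) /\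
   exists t, t <= length w /\ (seg w t b (repeat 1 n) /\ segeq w a t x y)).

Lemma unary_seg_inj w a b z z' : seg w a b (unary z) -> seg w a b (unary z') -> z = z'.
Proof.
  intros H H'. apply unary_inj. eapply seg_fun; eauto.
  pose proof (seg_len _ _ _ _ H) as [E _]. pose proof (seg_len _ _ _ _ H') as [E' _]. lia.
Qed.

Lemma shift_test_spec w j a b x y z : seg w a b (unary z) -> y <= length w ->
  shift_test w j a b x y <-> seg w x y (unary (z + j)).
Proof.
  intros Hz Hy. unfold shift_test. set (n := Z.abs_nat j).
  assert (Hs : sym w a = if Z.ltb z 0 then 2 else 1).
  { rewrite <- (Nat.add_0_r a), (seg_sym _ _ _ _ 0 Hz); [reflexivity|]. rewrite unary_length. lia. }
  assert (Hsmall : (forall k, In k (small n) -> ~ seg w a b (unary k)) <-> ~ In z (small n)).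
  { split; [intros H Hin; now apply (H z)|]. intros H k Hk Hseg.
    now rewrite (unary_seg_inj _ _ _ _ _ Hseg Hz) in Hk. }
  rewrite Hsmall. destruct (classic (In z (small n))) as [Hin|Hin].
  - split; [|intros H; left; now exists z].
    intros [(k & _ & H1 & H2)|[[H _]|[H _]]]; try contradiction.
    now rewrite (unary_seg_inj _ _ _ _ _ Hz H1).
  - assert (Hfst : ~ exists k, In k (small n) /\ (seg w a b (unary k) /\ seg w x y (unary (k + j)))).
    { intros (k & Hk & H1 & _). now rewrite (unary_seg_inj _ _ _ _ _ H1 Hz) in Hk. }
    (* Outside the enumerated range, adding [j] cannot change the sign. *)
    assert (Hlarge : (Z.abs z > Z.abs j)%Z) by (rewrite in_small in Hin; lia).
    rewrite Hs. destruct (Bool.eqb (Z.ltb z 0) (Z.ltb j 0)) eqn:Esgn.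
    + apply Bool.eqb_prop in Esgn.
      assert (E : unary (z + j) = unary z ++ repeat 1 n).
      { apply unary_app; destruct (Z.ltb_spec z 0), (Z.ltb_spec j 0), (Z.ltb_spec (z + j) 0);
          try discriminate; try reflexivity; lia. }
      rewrite E, seg_app. split.
      * intros [H|[(_ & _ & t & Ht & H1 & H2)|(_ & H & _)]]; [contradiction| |].
        -- exists t. split; [|assumption]. now apply (segeq_seg w a b).
        -- exfalso. revert H. rewrite Esgn. destruct (Z.ltb j 0); discriminate.
      * intros (t & H1 & H2). right; left. split; [assumption|].
        split; [rewrite Esgn; now destruct (Z.ltb j 0)|].
        pose proof (seg_len _ _ _ _ H1) as [_ L]. exists t. split; [assumption|].
        split; [|assumption]. now apply (segeq_seg w a b _ _ (unary z)).
    + apply Bool.eqb_false_iff in Esgn.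
      assert (E : unary z = unary (z + j) ++ repeat 1 n).
      { apply unary_app; destruct (Z.ltb_spec z 0), (Z.ltb_spec j 0), (Z.ltb_spec (z + j) 0);
          try congruence; lia. }
      rewrite E in Hz. apply seg_app in Hz as (t & Hz1 & Hz2).
      pose proof (seg_len _ _ _ _ Hz2) as [Lb _]. split.
      * intros [H|[(_ & H & _)|(_ & _ & t' & Ht' & H1 & H2)]]; [contradiction| |].
        -- exfalso. revert H. destruct (Z.ltb z 0), (Z.ltb j 0); congruence.
        -- pose proof (seg_len _ _ _ _ H1) as [Lb' _]. assert (t' = t) as -> by lia.
           now apply (segeq_seg w a t).
      * intros H. right; right. split; [assumption|].
        split; [destruct (Z.ltb z 0), (Z.ltb j 0); congruence|].
        pose proof (seg_len _ _ _ _ Hz1) as [_ L]. exists t. split; [assumption|].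
        split; [assumption|]. now apply (segeq_seg w a t _ _ (unary (z + j))).
Qed.

Ltac snoc m := cbv beta; rewrite ?(nth_snoc_eq m), ?(nth_snoc_lt m) by (assumption || lia).

Lemma dec_shift_test m j a b x y : a < m -> b < m -> x < m -> y < m ->
  dec m (fun i l => shift_test (enc i) j (nth a l 0) (nth b l 0) (nth x l 0) (nth y l 0)).
Proof.
  intros Ha Hb Hx Hy. unfold shift_test. cbv zeta.
  assert (Hsm : dec m (fun i l => forall k, In k (small (Z.abs_nat j)) ->
    ~ seg (enc i) (nth a l 0) (nth b l 0) (unary k))).
  { apply dec_forall_in.
    intros k _. apply dec_not, dec_seg; assumption. }
  apply dec_or; [|apply dec_or]; repeat apply dec_and; try exact Hsm;
    try (destruct (Z.ltb j 0); apply dec_sym; assumption).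
  - apply dec_exists_in.
    intros k _. apply dec_and; apply dec_seg; assumption.
  - eapply dec_ex_ext.
    + apply dec_and; [apply (dec_segeq (S m) a b x m)|apply (dec_seg (S m) m y)]; lia.
    + intros i l t _ Hl _. snoc m. reflexivity.
  - eapply dec_ex_ext.
    + apply dec_and; [apply (dec_seg (S m) m b)|apply (dec_segeq (S m) a m x y)]; lia.
    + intros i l t _ Hl _. snoc m. reflexivity.
Qed.

(** * Locating the three time points of the instance *)

Lemma sep_unique w A U B a u v : w = A ++ a :: U ++ B -> Forall sbit U -> ~ sbit a ->
  ~ sbit (sym B 0) -> v = length A + 1 + length U ->
  sym w u = a /\ run_to w (S u) v <-> u = length A.
Proof.
  intros -> HU Ha HB ->. unfold run_to, sym in *.
  assert (EA : nth (length A) (A ++ a :: U ++ B) 0 = a) by apply nth_middle.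
  assert (EU : forall x, length A < x < length A + 1 + length U -> sbit (nth x (A ++ a :: U ++ B) 0)).
  { intros x Hx. rewrite app_nth2 by lia. replace (x - length A) with (S (x - length A - 1)) by lia.
    cbn [nth]. rewrite app_nth1 by lia. apply (Forall_in HU), nth_In. lia. }
  assert (EB : nth (length A + 1 + length U) (A ++ a :: U ++ B) 0 = nth 0 B 0).
  { rewrite app_nth2 by lia. replace (length A + 1 + length U - length A) with (S (length U)) by lia.
    cbn [nth]. rewrite app_nth2, Nat.sub_diag by lia. reflexivity. }
  split.
  - intros (E & H1 & H2 & _). destruct (Nat.lt_trichotomy u (length A)) as [H|[H|H]]; [|assumption|].
    + exfalso. apply Ha. rewrite <- EA. apply H2. lia.
    + exfalso. apply Ha. rewrite <- E. apply EU. lia.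
  - intros ->. split; [assumption|]. split; [lia|]. split; [|now rewrite EB].
    intros x Hx. apply EU. lia.
Qed.

Definition parses (A : instance -> list nat) (z : instance -> Z) : Prop :=
  exists B, forall i, enc i = A i ++ 5 :: unary (z i) ++ B i /\ ~ sbit (sym (B i) 0).

Definition fstart (A : instance -> list nat) (i : instance) : nat := S (length (A i)).
Definition fend (A : instance -> list nat) (z : instance -> Z) (i : instance) : nat :=
  length (A i) + 1 + length (unary (z i)).

Definition dec_point (f : instance -> nat) : Prop :=
  forall m x, x < m -> dec m (fun i l => nth x l 0 = f i).

Lemma fend_bound A z i : parses A z -> fend A z i <= length (enc i).
Proof.
  intros (B & H). destruct (H i) as [-> _]. unfold fend. rewrite length_app. cbn [length].
  rewrite length_app. lia.
Qed.

(** All three numbers are introduced by the same symbol 5, so they are told apart from the right: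
    the delimiter of a field is the only 5 followed by a digit run up to the known end of the
    field. *)
Lemma dec_before A z : parses A z -> dec_point (fend A z) -> dec_point (fun i => length (A i)).
Proof.
  intros HP He m x Hx. assert (HP' := HP). destruct HP' as (B & H).
  eapply dec_ext with (P := fun i l => sym (enc i) (nth x l 0) = 5 /\
    exists u, u <= length (enc i) /\ (u = S (nth x l 0) /\
      exists v, v <= length (enc i) /\ (v = fend A z i /\ run_to (enc i) u v))).
  - apply dec_and; [now apply dec_sym|]. eapply dec_ex_ext.
    + apply dec_and; [apply (dec_succ (S m) x m); lia|].
      eapply (dec_ex_ext (S m) (fun i l v => v = fend A z i /\ run_to (enc i) (nth m l 0) v)).
      * apply dec_and; [apply (He (S (S m)) (S m)); lia|apply (dec_run (S (S m)) m (S m)); lia].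
      * intros i l v _ Hl _. snoc (S m). reflexivity.
    + intros i l u _ Hl _. snoc m. reflexivity.
  - intros i l _ _. cbn beta. destruct (H i) as [E HB].
    rewrite <- (sep_unique _ _ _ _ 5 (nth x l 0) (fend A z i) E (unary_sbit _)
      (not_sbit 5 ltac:(lia)) HB eq_refl).
    pose proof (fend_bound A z i HP) as Lf. split.
    + intros (H5 & u & _ & -> & v & _ & -> & R). auto.
    + intros (H5 & R). split; [assumption|]. pose proof R as (R1 & _). exists (S (nth x l 0)).
      split; [lia|]. split; [reflexivity|]. eauto.
Qed.

Lemma dec_point_S f : dec_point f -> dec_point (fun i => S (f i)).
Proof.
  intros H m x Hx.
  eapply dec_ext with (P := fun i l => exists u, u <= length (enc i) /\
    (u = f i /\ nth x l 0 = S u)).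
  - eapply dec_ex_ext.
    + apply dec_and; [apply (H (S m) m); lia|apply (dec_succ (S m) m x); lia].
    + intros i l u _ Hl _. snoc m. reflexivity.
  - intros i l _ [_ Hl]. cbn beta. split; [intros (u & _ & -> & E); exact E|].
    intros E. exists (f i). specialize (Hl x). lia || (split; [lia|auto]).
Qed.

Definition pre_in (i : instance) : list nat := flat_map enc_fact (idata i).
Definition pre_out (i : instance) : list nat := pre_in i ++ 5 :: unary (itin i).
Definition pre_mem (i : instance) : list nat := pre_out i ++ 5 :: unary (itout i).

Lemma enc_pre_mem i : enc i = pre_mem i ++ 5 :: unary (itmem i).
Proof.
  unfold enc, pre_mem, pre_out, pre_in. rewrite <- !app_assoc. cbn [app].
  reflexivity.
Qed.

Lemma parses_mem : parses pre_mem itmem.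
Proof.
  exists (fun _ => []). intros i. rewrite app_nil_r. split; [apply enc_pre_mem|]. apply not_sbit. now left.
Qed.

Lemma parses_out : parses pre_out itout.
Proof.
  exists (fun i => 5 :: unary (itmem i)). intros i. split; [|apply not_sbit; cbn; lia].
  rewrite enc_pre_mem. unfold pre_mem. rewrite <- app_assoc. reflexivity.
Qed.

Lemma parses_in : parses pre_in itin.
Proof.
  exists (fun i => 5 :: unary (itout i) ++ 5 :: unary (itmem i)).
  intros i. split; [|apply not_sbit; cbn; lia].
  rewrite enc_pre_mem. unfold pre_mem, pre_out. rewrite <- !app_assoc. reflexivity.
Qed.

Lemma dec_point_ext f g : (forall i, f i = g i) -> dec_point f -> dec_point g.
Proof.
  intros E H m x Hx. eapply dec_ext; [apply (H m x Hx)|]. intros i l _ _. cbn beta. now rewrite E.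
Qed.

(** The start of the parse from the right: the last field ends where the blank is read. *)
Lemma point_end_mem : dec_point (fend pre_mem itmem).
Proof.
  intros m x Hx. eapply dec_ext; [apply (dec_sym m x 0 Hx)|]. intros i l _ [_ Hl]. cbn beta.
  rewrite enc_zero. specialize (Hl x).
  assert (fend pre_mem itmem i = length (enc i)) as ->.
  { rewrite enc_pre_mem. unfold fend. rewrite length_app. cbn [length]. lia. }
  lia.
Qed.

Lemma point_mem : dec_point (fun i => length (pre_mem i)).
Proof. exact (dec_before _ _ parses_mem point_end_mem). Qed.

Lemma point_end_out : dec_point (fend pre_out itout).
Proof.
  apply dec_point_ext with (2 := point_mem). intros i. unfold pre_mem, fend. rewrite length_app. cbn [length]. lia.
Qed.

Lemma point_out : dec_point (fun i => length (pre_out i)).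
Proof. exact (dec_before _ _ parses_out point_end_out). Qed.

Lemma point_end_in : dec_point (fend pre_in itin).
Proof.
  apply dec_point_ext with (2 := point_out). intros i. unfold pre_out, fend. rewrite length_app. cbn [length]. lia.
Qed.

Lemma point_in : dec_point (fun i => length (pre_in i)).
Proof. exact (dec_before _ _ parses_in point_end_in). Qed.

Lemma field_seg A z i : parses A z -> seg (enc i) (fstart A i) (fend A z i) (unary (z i)).
Proof.
  intros (B & H). destruct (H i) as [E _]. exists (A i ++ [5]), (B i).
  rewrite E, length_app, <- app_assoc. unfold fstart, fend. cbn [length app]. repeat split; lia.
Qed.

(** Gives access to a field by two extra pointers at its ends; they are introduced by quantifiers
    and pinned down by [dec_point]. *)
Lemma dec_field m A z (Q : instance -> list nat -> nat -> nat -> Prop) R : parses A z ->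
  dec_point (fun i => length (A i)) -> dec_point (fend A z) ->
  dec (S (S m)) R ->
  (forall i l a b, valid_instance i -> length l = m -> b <= length (enc i) ->
    R i ((l ++ [a]) ++ [b]) <-> Q i l a b) ->
  dec m (fun i l => Q i l (fstart A i) (fend A z i)).
Proof.
  intros HP HA He HR HQ.
  eapply dec_ext with (P := fun i l => exists a, a <= length (enc i) /\ (a = fstart A i /\
    exists b, b <= length (enc i) /\ (b = fend A z i /\ Q i l a b))).
  - eapply dec_ex_ext.
    + apply dec_and; [apply (dec_point_S _ HA (S m) m); lia|].
      eapply (dec_ex_ext (S m) (fun i l b => b = fend A z i /\ R i (l ++ [b]))).
      * apply dec_and; [apply (He (S (S m)) (S m)); lia|exact HR].
      * intros i l b Hi Hl Hb. cbv beta. rewrite (nth_snoc_eq (S m)) by assumption.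
        reflexivity.
    + intros i l a Hi Hl Ha. cbv beta. rewrite (nth_snoc_eq m) by assumption.
      split; (intros (E & b & Hb & Eb & H); split; [exact E|]; exists b; split; [exact Hb|]; split; [exact Eb|]);
        now apply (HQ i l a b).
  - intros i l Hi _. cbn beta. pose proof (fend_bound A z i HP) as L. split.
    + intros (a & _ & -> & b & _ & -> & H). exact H.
    + intros H. exists (fstart A i). unfold fend, fstart in *. split; [lia|]. split; [reflexivity|].
      eexists. split; [exact L|]. auto.
Qed.

(** Times are only ever compared with [itmem i + j] for a constant [j]. *)
Lemma dec_time m x y j : x < m -> y < m ->
  dec m (fun i l => seg (enc i) (nth x l 0) (nth y l 0) (unary (itmem i + j))).
Proof.
  intros Hx Hy. eapply dec_ext.
  - apply (dec_field m pre_mem itmem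
      (fun i l a b => shift_test (enc i) j a b (nth x l 0) (nth y l 0)) _
      parses_mem point_mem point_end_mem (dec_shift_test (S (S m)) j m (S m) x y
        ltac:(lia) ltac:(lia) ltac:(lia) ltac:(lia))).
    intros i l a b _ Hl _. assert (Hl' : length (l ++ [a]) = S m) by (rewrite length_app, Hl; cbn; lia).
    cbv beta. rewrite (nth_snoc_eq (S m)), !(nth_snoc_lt (S m) (l ++ [a])), (nth_snoc_eq m), !(nth_snoc_lt m l)
      by (assumption || lia).
    reflexivity.
  - intros i l _ [_ Hl]. cbn beta. apply shift_test_spec; [apply field_seg, parses_mem|apply Hl].
Qed.

Lemma dec_field_eq m A z j : parses A z -> dec_point (fun i => length (A i)) -> dec_point (fend A z) ->
  dec m (fun i _ => z i = (itmem i + j)%Z).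
Proof.
  intros HP HA He. eapply dec_ext.
  - apply (dec_field m A z
      (fun i l a b => seg (enc i) a b (unary (itmem i + j))) _
      HP HA He (dec_time (S (S m)) m (S m) j ltac:(lia) ltac:(lia))).
    intros i l a b _ Hl _. assert (Hl' : length (l ++ [a]) = S m) by (rewrite length_app, Hl; cbn; lia).
    cbv beta. rewrite (nth_snoc_eq (S m)), (nth_snoc_lt (S m) (l ++ [a])), (nth_snoc_eq m)
      by (assumption || lia).
    reflexivity.
  - intros i l _ _. cbn beta. pose proof (field_seg A z i HP) as H. split.
    + intros H'. exact (unary_seg_inj _ _ _ _ _ H H').
    + now intros <-.
Qed.

(** As the field is at least [itmem i], the inequality leaves finitely many values, and each is
    tested for equality. *)
Lemma dec_le_field m A z j : parses A z -> dec_point (fun i => length (A i)) -> dec_point (fend A z) ->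
  (forall i, valid_instance i -> (itmem i <= z i)%Z) ->
  dec m (fun i _ => (z i <= itmem i + j)%Z).
Proof.
  intros HP HA He Hz. eapply dec_ext.
  - apply (dec_exists_in m (small (Z.abs_nat j)) (fun k i _ => (k <= j)%Z /\ z i = (itmem i + k)%Z)).
    intros k _. apply dec_and; [apply dec_const|now apply (dec_field_eq m A)].
  - intros i l Hi _. cbn beta. specialize (Hz i Hi). split.
    + intros (k & _ & H1 & H2). lia.
    + intros H. exists (z i - itmem i)%Z. rewrite in_small. lia.
Qed.

Lemma dec_tout m j : dec m (fun i _ => (itout i <= itmem i + j)%Z).
Proof.
  apply (dec_le_field m pre_out itout j parses_out point_out point_end_out).
  intros i (_ & H & _). exact H.
Qed.

Lemma dec_tin m j : dec m (fun i _ => (itin i < itmem i + j)%Z).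
Proof.
  eapply dec_ext; [apply (dec_le_field m pre_in itin (j - 1) parses_in point_in point_end_in)|].
  - intros i (_ & H1 & H2). lia.
  - intros i l _ _. cbn beta. lia.
Qed.

(** * Predicates of objects *)

Section Objects.
Variables c nsym : nat.

(* Symbolic object [k]: the constant [k] itself if [k < c], otherwise an object above [c] that does not
   occur in the data. *)
Definition symval (i : instance) (k : nat) : nat :=
  if k <? c then k else S (list_max (dobjs (idata i))) + k.

Lemma symval_inj i k k' : symval i k = symval i k' -> k = k'.
Proof. unfold symval. destruct (Nat.ltb_spec k c), (Nat.ltb_spec k' c); lia. Qed.

Lemma symval_const i k : k < c -> symval i k = k.
Proof. intros H. unfold symval. now apply Nat.ltb_lt in H as ->. Qed.

Lemma symval_fresh i k : c <= k -> ~ In (symval i k) (dobjs (idata i)).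
Proof.
  intros H Hin. unfold symval in Hin. destruct (Nat.ltb_spec k c); [lia|].
  pose proof (proj1 (list_max_le _ _) (Nat.le_refl (list_max (dobjs (idata i))))) as F.
  apply (Forall_in F) in Hin. lia.
Qed.

Definition idom (i : instance) (o : nat) : Prop :=
  In o (dobjs (idata i)) \/ exists k, k < nsym /\ o = symval i k.

(* An object variable is either a pointer to a token of the word ([None]) or a fixed symbolic object. *)
Definition kind := option nat.

Definition denotes (i : instance) (q : kind) (x o : nat) : Prop :=
  match q with None => tokis (enc i) x o | Some k => o = symval i k end.

Definition kof (ks : list kind) (x : nat) : kind := nth x ks None.

Definition den (i : instance) (ks : list kind) (l e : list nat) : Prop :=
  length e = length ks /\ forall x, x < length ks -> denotes i (kof ks x) (nth x l 0) (nth x e 0).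

(** First-order definability over tuples of objects. The kinds are fixed outside of the program, so
    a separate program exists for each way of making variables symbolic. As pointers and kinds
    determine [e], the quantifier over [e] merely evaluates them. *)
Definition odef (m : nat) (P : instance -> list nat -> Prop) : Prop :=
  forall ks, length ks = m -> dec m (fun i l => exists e, den i ks l e /\ P i e).

Lemma denotes_fun i q x o o' : denotes i q x o -> denotes i q x o' -> o = o'.
Proof. destruct q; cbn; [congruence|apply tokis_fun]. Qed.

Lemma den_fun i ks l e e' : den i ks l e -> den i ks l e' -> e = e'.
Proof.
  intros [H1 H2] [H1' H2']. apply (nth_ext _ _ 0 0); [congruence|]. intros x Hx.
  rewrite H1 in Hx. exact (denotes_fun _ _ _ _ _ (H2 x Hx) (H2' x Hx)).
Qed.

Lemma list_choice (R : nat -> nat -> Prop) m : (forall x, x < m -> exists o, R x o) ->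
  exists e, length e = m /\ forall x, x < m -> R x (nth x e 0).
Proof.
  induction m as [|m IH]; intros H.
  - exists []. split; [reflexivity|lia].
  - destruct IH as (e & He & HR); [intros; apply H; lia|]. destruct (H m) as [o Ho]; [lia|].
    exists (e ++ [o]). rewrite length_app, He. split; [cbn; lia|]. intros x Hx.
    destruct (Nat.eq_dec x m) as [->|].
    + now rewrite (nth_snoc_eq m).
    + rewrite (nth_snoc_lt m) by (assumption || lia). apply HR. lia.
Qed.

(** The successor of a pointer at the end of the word is not a position, yet [sym] reads a blank
    there; hence the separate case [a = 0]. *)
Lemma dec_succ_sym m x a : x < m -> dec m (fun i l => sym (enc i) (S (nth x l 0)) = a).
Proof.
  intros Hx. destruct (Nat.eq_dec a 0) as [->|Ha].
  - eapply dec_ext with (P := fun i l => ~ exists y, y <= length (enc i) /\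
      (y = S (nth x l 0) /\ ~ sym (enc i) y = 0)).
    + apply dec_not. eapply dec_ex_ext.
      * apply dec_and; [apply (dec_succ (S m) x m); lia|apply dec_not, (dec_sym (S m) m 0); lia].
      * intros i l y _ Hl _. snoc m. reflexivity.
    + intros i l _ [_ Hl]. cbn beta. specialize (Hl x).
      pose proof (enc_zero i (S (nth x l 0))) as Z. split.
      * intros N. apply NNPP. intros N'. apply N. exists (S (nth x l 0)). repeat split; auto.
        destruct (Nat.le_gt_cases (length (enc i)) (S (nth x l 0))); [|lia].
        exfalso. apply N', Z. assumption.
      * intros E (y & _ & -> & N). contradiction.
  - eapply dec_ext with (P := fun i l => exists y, y <= length (enc i) /\
      (y = S (nth x l 0) /\ sym (enc i) y = a)).
    + eapply dec_ex_ext.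
      * apply dec_and; [apply (dec_succ (S m) x m); lia|apply (dec_sym (S m) m a); lia].
      * intros i l y _ Hl _. snoc m. reflexivity.
    + intros i l _ _. cbn beta. split.
      * intros (y & _ & -> & E). exact E.
      * intros E. exists (S (nth x l 0)). repeat split; auto.
        pose proof (enc_zero i (S (nth x l 0))). lia.
Qed.

Lemma istok_iff i x : valid_instance i ->
  (sym (enc i) x = 3 /\ sym (enc i) (S x) = 1) <->
  exists o, tokis (enc i) x o.
Proof.
  intros [[HD _] _]. split.
  - intros [H3 H1]. destruct (tok_dobjs i x HD H3 H1) as (o & Ho & _). eauto.
  - intros [o Ho]. now apply tokis_sym in Ho.
Qed.

Lemma tokis_dobjs i x o : valid_instance i -> tokis (enc i) x o -> In o (dobjs (idata i)).
Proof.
  intros [[HD _] _] H. destruct (tokis_sym _ _ _ H) as [H3 H1].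
  destruct (tok_dobjs i x HD H3 H1) as (o' & H' & Hin). now rewrite (tokis_fun _ _ _ _ H H').
Qed.

Lemma dec_den m ks : length ks <= m -> dec m (fun i l => exists e, den i ks l e).
Proof.
  intros Hk. eapply dec_ext with (P := fun i l => forall x, In x (seq 0 (length ks)) ->
    match kof ks x with None => sym (enc i) (nth x l 0) = 3 /\
       sym (enc i) (S (nth x l 0)) = 1 | Some _ => True end).
  - apply dec_forall_in.
    intros x Hx. apply in_seq in Hx. destruct (kof ks x); [apply dec_const|].
    apply dec_and; [apply dec_sym|apply dec_succ_sym]; lia.
  - intros i l Hi _. cbn beta. split.
    + intros H. destruct (list_choice (fun x o => denotes i (kof ks x) (nth x l 0) o) (length ks)) as (e & He).
      * intros x Hx. specialize (H x ltac:(apply in_seq; lia)). destruct (kof ks x) as [k|]; cbn.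
        -- eauto.
        -- now apply istok_iff.
      * exists e. exact He.
    + intros (e & _ & H) x Hx. apply in_seq in Hx. specialize (H x ltac:(lia)).
      destruct (kof ks x) as [k|]; [exact I|]. cbn in H. now apply tokis_sym in H.
Qed.

Lemma odef_ext m P Q : odef m P ->
  (forall i e, valid_instance i -> length e = m -> P i e <-> Q i e) -> odef m Q.
Proof.
  intros H HPQ ks Hk. eapply dec_ext; [apply (H ks Hk)|]. intros i l Hi _. cbn beta.
  split; intros (e & He & HP); exists e; (split; [assumption|]);
    apply (HPQ i e Hi); auto; destruct He; congruence.
Qed.

Lemma odef_const m A : odef m (fun _ _ => A).
Proof.
  intros ks Hk. eapply dec_ext; [apply dec_and; [apply (dec_den m ks); lia|apply (dec_const m A)]|].
  intros i l _ _. cbn beta. firstorder.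
Qed.

Lemma odef_dec m (P : instance -> Prop) : (forall m, dec m (fun i _ => P i)) -> odef m (fun i _ => P i).
Proof.
  intros H ks Hk. eapply dec_ext; [apply dec_and; [apply (dec_den m ks); lia|apply (H m)]|].
  intros i l _ _. cbn beta. firstorder.
Qed.

(** Only the property is negated: that the pointers stand at tokens must still hold, and [dec_den]
    tests it. *)
Lemma odef_not m P : odef m P -> odef m (fun i e => ~ P i e).
Proof.
  intros H ks Hk. eapply dec_ext; [apply dec_and; [apply (dec_den m ks); lia|apply dec_not, (H ks Hk)]|].
  intros i l _ _. cbn beta. split.
  - intros [[e He] N]. exists e. firstorder.
  - intros (e & He & N). split; [eauto|]. intros (e' & He' & HP).
    now rewrite (den_fun _ _ _ _ _ He He') in N.
Qed.

Lemma odef_and m P Q : odef m P -> odef m Q -> odef m (fun i e => P i e /\ Q i e).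
Proof.
  intros H H' ks Hk. eapply dec_ext; [apply dec_and; [apply (H ks Hk)|apply (H' ks Hk)]|].
  intros i l _ _. cbn beta. split.
  - intros [(e & He & HP) (e' & He' & HQ)]. rewrite (den_fun _ _ _ _ _ He' He) in HQ. eauto.
  - intros (e & He & HP & HQ). split; eauto.
Qed.

Lemma odef_or m P Q : odef m P -> odef m Q -> odef m (fun i e => P i e \/ Q i e).
Proof.
  intros H H'. eapply odef_ext; [apply odef_not, odef_and; apply odef_not; [exact H|exact H']|].
  intros i e _ _. cbn beta. tauto.
Qed.

Lemma odef_exists_in {A} m (xs : list A) (P : A -> instance -> list nat -> Prop) :
  (forall a, In a xs -> odef m (P a)) -> odef m (fun i e => exists a, In a xs /\ P a i e).
Proof.
  induction xs as [|a xs IH]; intros H.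
  - eapply odef_ext; [apply (odef_const m False)|]. intros i l _ _. cbn. firstorder.
  - eapply odef_ext; [apply odef_or; [apply (H a); now left|apply IH; intros; apply H; now right]|].
    intros i l _ _. cbn. firstorder congruence.
Qed.

Lemma odef_forall_in {A} m (xs : list A) (P : A -> instance -> list nat -> Prop) :
  (forall a, In a xs -> odef m (P a)) -> odef m (fun i e => forall a, In a xs -> P a i e).
Proof.
  intros H. eapply odef_ext; [apply odef_not, (odef_exists_in m xs (fun a i e => ~ P a i e))|].
  - intros a Ha. apply odef_not; auto.
  - intros i l _ _. cbn. split; [|firstorder]. intros N a Ha. apply NNPP. firstorder.
Qed.

Lemma kof_snoc_lt ks q x : x < length ks -> kof (ks ++ [q]) x = kof ks x.
Proof. intros H. unfold kof. now rewrite app_nth1. Qed.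

Lemma kof_snoc_eq ks q : kof (ks ++ [q]) (length ks) = q.
Proof. apply nth_middle. Qed.

Lemma den_snoc i ks q l y e' : length l = length ks ->
  den i (ks ++ [q]) (l ++ [y]) e' <->
  exists e o, e' = e ++ [o] /\ den i ks l e /\ denotes i q y o.
Proof.
  intros Hl. unfold den. rewrite length_app. cbn [length]. split.
  - intros [Hlen H]. destruct e' as [|o e] using rev_ind; [cbn in Hlen; lia|]. clear IHe.
    rewrite length_app in Hlen. cbn in Hlen. assert (He : length e = length ks) by lia.
    exists e, o. split; [reflexivity|]. split; [split; [assumption|]|].
    + intros x Hx. specialize (H x ltac:(lia)).
      now rewrite kof_snoc_lt, (nth_snoc_lt _ l _ _ Hl), (nth_snoc_lt _ e _ _ He) in H.
    + specialize (H (length ks) ltac:(lia)).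
      now rewrite kof_snoc_eq, (nth_snoc_eq _ l _ Hl), (nth_snoc_eq _ e _ He) in H.
  - intros (e & o & -> & [He H] & Hq). rewrite length_app. split; [cbn; lia|]. intros x Hx.
    destruct (Nat.eq_dec x (length ks)) as [->|].
    + now rewrite kof_snoc_eq, (nth_snoc_eq _ l _ Hl), (nth_snoc_eq _ e _ He).
    + rewrite kof_snoc_lt, (nth_snoc_lt _ l _ _ Hl), (nth_snoc_lt _ e _ _ He) by lia. apply H. lia.
Qed.

(** The quantifier splits into a loop over the tokens of the word and a finite disjunction over the
    symbolic objects. *)
Lemma odef_ex m P : odef (S m) P -> odef m (fun i e => exists o, idom i o /\ P i (e ++ [o])).
Proof.
  intros H ks Hk.
  set (D q := fun i l => exists y, y <= length (enc i) /\
    exists e', den i (ks ++ [q]) (l ++ [y]) e' /\ P i e').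
  assert (HD : forall q, dec m (D q)).
  { intros q. apply (dec_ex m (fun i l => exists e', den i (ks ++ [q]) l e' /\ P i e')). apply H. rewrite length_app. cbn. lia. }
  eapply dec_ext with (P := fun i l => D None i l \/ exists k, In k (seq 0 nsym) /\ D (Some k) i l).
  - apply dec_or; [apply HD|]. apply dec_exists_in. intros; apply HD.
  - intros i l Hi [Hl _]. unfold D. cbn beta.
    assert (E : forall q y, (exists e', den i (ks ++ [q]) (l ++ [y]) e' /\ P i e') <->
      exists e, den i ks l e /\ exists o, denotes i q y o /\ P i (e ++ [o])).
    { intros q y. split.
      - intros (e' & He' & HP). apply den_snoc in He' as (e & o & -> & He & Ho); [|congruence]. eauto 6.
      - intros (e & He & o & Ho & HP). exists (e ++ [o]). split; [|assumption].
        apply den_snoc; [congruence|]. eauto. }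
    split.
    + intros [(y & _ & H1)|(k & Hk' & y & _ & H1)]; apply E in H1 as (e & He & o & Ho & HP);
        exists e; (split; [assumption|]); exists o; (split; [|assumption]).
      * left. eapply tokis_dobjs; eauto.
      * right. apply in_seq in Hk'. exists k. split; [lia|exact Ho].
    + intros (e & He & o & [Ho|(k & Hk' & Ho)] & HP).
      * left. destruct (dobjs_tok i o) as (y & Hy & Ht); [apply Hi|assumption|].
        exists y. split; [assumption|]. apply E. exists e. split; [assumption|]. now exists o.
      (* A symbolic object is not tied to a position; 0 fills its pointer. *)
      * right. exists k. split; [apply in_seq; lia|]. exists 0. split; [lia|]. apply E.
        exists e. split; [assumption|]. now exists o.
Qed.

Lemma odef_ex_list m n P : odef (n + m) P ->
  odef m (fun i e => exists v, length v = n /\ Forall (idom i) v /\ P i (e ++ v)).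
Proof.
  revert m; induction n as [|n IH]; intros m H.
  - eapply odef_ext; [exact H|]. intros i e _ _. cbn beta. split.
    + intros HP. exists []. rewrite app_nil_r. auto.
    + intros ([|] & Hv & _ & HP); [|discriminate]. now rewrite app_nil_r in HP.
  - eapply odef_ext; [apply odef_ex, IH|].
    + now rewrite Nat.add_succ_r.
    + intros i e _ _. cbn beta. split.
      * intros (o & Ho & v & Hv & Fv & HP). exists (o :: v). rewrite <- app_assoc in HP. cbn in *.
        repeat split; auto.
      * intros ([|o v] & Hv & Fv & HP); [discriminate|]. inversion Fv; subst. exists o.
        split; [assumption|]. exists v. rewrite <- app_assoc. auto.
Qed.

(** * Equality of objects and membership in the data *)

Inductive ot := OV (x : nat) | OK (k : nat).

Definition oval (e : list nat) (t : ot) : nat := match t with OV x => nth x e 0 | OK k => k end.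
Definition ot_ok (m : nat) (t : ot) : Prop := match t with OV x => x < m | OK k => k < c end.
Definition okind (ks : list kind) (t : ot) : kind := match t with OV x => kof ks x | OK k => Some k end.
Definition optr (t : ot) : nat := match t with OV x => x | OK _ => 0 end.

Lemma oval_denotes i ks l e t : den i ks l e -> ot_ok (length ks) t ->
  denotes i (okind ks t) (nth (optr t) l 0) (oval e t).
Proof.
  intros [_ H] Ht. destruct t as [x|k]; cbn in *; [now apply H|]. now rewrite symval_const.
Qed.

Lemma optr_lt ks m t : length ks <= m -> ot_ok (length ks) t -> okind ks t = None -> optr t < m.
Proof. destruct t; cbn; [lia|discriminate]. Qed.

(* The segment [y .. y') holds the token of the object denoted by kind [q] and pointer [x]. *)
Definition tok_test (i : instance) (q : kind) (x y y' : nat) : Prop :=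
  match q with
  | None => exists u, u <= length (enc i) /\ (u = S x /\
      exists z, z <= length (enc i) /\ (run_to (enc i) u z /\ segeq (enc i) x z y y'))
  | Some k => k < c /\ seg (enc i) y y' (3 :: 1 :: bin k)
  end.

Lemma dec_tok_test m q x y y' : (q = None -> x < m) -> y < m -> y' < m ->
  dec m (fun i l => tok_test i q (nth x l 0) (nth y l 0) (nth y' l 0)).
Proof.
  intros Hx Hy Hy'. destruct q as [k|]; cbn [tok_test].
  - apply dec_and; [apply dec_const|now apply dec_seg].
  - specialize (Hx eq_refl). eapply dec_ex_ext.
    + apply dec_and; [apply (dec_succ (S m) x m); lia|].
      eapply (dec_ex_ext (S m) (fun i l z => run_to (enc i) (nth m l 0) z /\
        segeq (enc i) (nth x l 0) z (nth y l 0) (nth y' l 0))).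
      * apply dec_and; [apply (dec_run (S (S m)) m (S m))|apply (dec_segeq (S (S m)) x (S m) y y')]; lia.
      * intros i l z _ Hl _. snoc (S m). reflexivity.
    + intros i l u _ Hl _. snoc m. reflexivity.
Qed.

Lemma tok_test_spec i q x o y y' : y' <= length (enc i) -> denotes i q x o ->
  match q with Some k => k < c | None => True end ->
  tok_test i q x y y' <-> seg (enc i) y y' (3 :: 1 :: bin o).
Proof.
  intros Hy' Ho Hq. destruct q as [k|]; cbn [tok_test denotes] in *.
  - rewrite Ho, symval_const by assumption. tauto.
  - destruct Ho as (z & Hz & Rz). pose proof (seg_len _ _ _ _ Hz) as [Lz1 Lz2]. cbn in Lz1. split.
    + intros (u & _ & -> & z' & _ & R & E). rewrite (run_to_unique _ _ _ _ R Rz) in E.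
      now apply (segeq_seg _ x z).
    + intros H. exists (S x). split; [lia|]. split; [reflexivity|]. exists z. split; [assumption|].
      split; [assumption|]. now apply (segeq_seg _ x z _ _ (3 :: 1 :: bin o)).
Qed.

(* The object of kind [q] at [x] is the one whose token starts at [x']. *)
Definition obj_test (i : instance) (q : kind) (x x' : nat) : Prop :=
  exists u, u <= length (enc i) /\ (u = S x' /\
  exists z, z <= length (enc i) /\ (run_to (enc i) u z /\ tok_test i q x x' z)).

Lemma dec_obj_test m q x x' : (q = None -> x < m) -> x' < m ->
  dec m (fun i l => obj_test i q (nth x l 0) (nth x' l 0)).
Proof.
  intros Hx Hx'. unfold obj_test. set (x1 := if q then 0 else x).
  assert (Hx1 : x1 < m) by (destruct q; cbn; [lia|auto]).
  eapply dec_ext with (P := fun i l => exists u, u <= length (enc i) /\ (u = S (nth x' l 0) /\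
    exists z, z <= length (enc i) /\ (run_to (enc i) u z /\
      tok_test i q (nth x1 l 0) (nth x' l 0) z))).
  - eapply dec_ex_ext.
    + apply dec_and; [apply (dec_succ (S m) x' m); lia|].
      eapply (dec_ex_ext (S m) (fun i l z => run_to (enc i) (nth m l 0) z /\
        tok_test i q (nth x1 l 0) (nth x' l 0) z)).
      * apply dec_and; [apply (dec_run (S (S m)) m (S m))|apply (dec_tok_test (S (S m)) q x1 x' (S m))]; lia.
      * intros i l z _ Hl _. snoc (S m). reflexivity.
    + intros i l u _ Hl _. snoc m. reflexivity.
  - intros i l _ _. destruct q; reflexivity.
Qed.

(** A token can denote the same object as a symbolic constant, so names have to be compared there; a
    fresh object differs from every token, since it does not occur in the data. *)
Lemma obj_test_spec i q x x' o o' : valid_instance i ->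
  denotes i q x o -> tokis (enc i) x' o' -> obj_test i q x x' <-> o = o'.
Proof.
  intros Hi Ho Ho'. assert (Hd := tokis_dobjs _ _ _ Hi Ho'). destruct Ho' as (z & Hz & Rz).
  pose proof (seg_len _ _ _ _ Hz) as [Lz1 Lz2]. cbn in Lz1.
  assert (E : obj_test i q x x' <-> tok_test i q x x' z).
  { split.
    - intros (u & _ & -> & z' & _ & R & H). now rewrite (run_to_unique _ _ _ _ R Rz) in H.
    - intros H. exists (S x'). split; [lia|]. split; [reflexivity|]. eauto. }
  rewrite E. destruct (match q with Some k => c <=? k | None => false end) eqn:Eq.
  - destruct q as [k|]; [|discriminate]. apply Nat.leb_le in Eq. cbn in *. subst o. split; [lia|].
    intros <-. exfalso. exact (symval_fresh i k Eq Hd).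
  - rewrite (tok_test_spec i q x o); try assumption.
    + split; [|now intros ->]. intros H. apply bin_inj.
      pose proof (seg_len _ _ _ _ H) as [L _]. cbn in L.
      assert (E' : 3 :: 1 :: bin o = 3 :: 1 :: bin o').
      { eapply seg_fun; [|exact H|exact Hz]. cbn. lia. }
      now injection E'.
    + destruct q as [k|]; [|exact I]. apply Nat.leb_gt in Eq. exact Eq.
Qed.

Lemma odef_eq m t1 t2 : ot_ok m t1 -> ot_ok m t2 -> odef m (fun i e => oval e t1 = oval e t2).
Proof.
  intros H1 H2 ks Hk. subst m.
  set (T := fun (i : instance) (l : list nat) =>
    match okind ks t1, okind ks t2 with
    | Some k, Some k' => k = k'
    | q, None => obj_test i q (nth (optr t1) l 0) (nth (optr t2) l 0)
    | None, q => obj_test i q (nth (optr t2) l 0) (nth (optr t1) l 0)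
    end).
  assert (HT : dec (length ks) T).
  { unfold T. pose proof (optr_lt ks (length ks) t1 (Nat.le_refl _) H1) as O1.
    pose proof (optr_lt ks (length ks) t2 (Nat.le_refl _) H2) as O2.
    destruct (okind ks t1) as [k1|], (okind ks t2) as [k2|]; try apply dec_const; apply dec_obj_test; auto. }
  eapply dec_ext; [apply dec_and; [apply (dec_den (length ks) ks); lia|exact HT]|].
  intros i l Hi _. cbn beta.
  assert (HTe : forall e, den i ks l e -> T i l <-> oval e t1 = oval e t2).
  { intros e He. pose proof (oval_denotes i ks l e t1 He H1) as D1.
    pose proof (oval_denotes i ks l e t2 He H2) as D2. unfold T.
    destruct (okind ks t1) as [k1|] eqn:E1, (okind ks t2) as [k2|] eqn:E2.
    - cbn in D1, D2. rewrite D1, D2. split; [congruence|apply symval_inj].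
    - now apply obj_test_spec.
    - rewrite (obj_test_spec i (Some k2) _ _ _ _ Hi D2 D1). split; congruence.
    - now apply obj_test_spec. }
  split.
  - intros [[e He] H]. exists e. split; [assumption|]. now apply HTe.
  - intros (e & He & H). split; [eauto|]. now apply (HTe e).
Qed.

Lemma den_weaken i ks l r e : length ks <= length l -> den i ks (l ++ r) e <-> den i ks l e.
Proof.
  intros Hl. unfold den. split; intros [H1 H2]; (split; [assumption|]); intros x Hx; specialize (H2 x Hx);
    rewrite app_nth1 in * by lia; assumption.
Qed.

(** Tokens are matched from left to right, each leaving its end in a new pointer where the next one
    begins; [T i] is the word behind the last object. New pointers go behind those of [ks], so
    denotations do not change. *)
Lemma dec_objs ks ts (T : instance -> list nat) :
  (forall m y z, y < m -> z < m -> dec m (fun i l => seg (enc i) (nth y l 0) (nth z l 0) (T i))) ->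
  Forall (ot_ok (length ks)) ts ->
  (forall t, In t ts -> match okind ks t with Some k => k < c | None => True end) ->
  forall m y z, length ks <= m -> y < m -> z < m ->
  dec m (fun i l => exists e, den i ks l e /\
    seg (enc i) (nth y l 0) (nth z l 0) (enc_objs (map (oval e) ts) ++ T i)).
Proof.
  intros HT. induction ts as [|t ts IH]; intros Hok Hfr m y z Hm Hy Hz.
  - eapply dec_ext; [apply dec_and; [apply (dec_den m ks Hm)|apply (HT m y z Hy Hz)]|].
    intros i l _ _. cbn. firstorder.
  - inversion Hok as [|? ? Ht Hts]; subst.
    set (x := if okind ks t then 0 else optr t).
    assert (Hx : okind ks t = None -> optr t < m) by now apply optr_lt.
    assert (Hxm : x < m) by (unfold x; destruct (okind ks t); [lia|auto]).
    assert (Et : forall i a y y', tok_test i (okind ks t) (nth x a 0) y y' =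
      tok_test i (okind ks t) (nth (optr t) a 0) y y')
      by (intros; unfold x; destruct (okind ks t); reflexivity).
    clearbody x.
    eapply dec_ext with (P := fun i l => exists y', y' <= length (enc i) /\
      (tok_test i (okind ks t) (nth (optr t) l 0) (nth y l 0) y' /\
       exists e, den i ks l e /\ seg (enc i) y' (nth z l 0) (enc_objs (map (oval e) ts) ++ T i))).
    + eapply dec_ex_ext.
      * apply dec_and.
        -- apply (dec_tok_test (S m) (okind ks t) x y m); lia.
        -- apply (IH Hts (fun t' Ht' => Hfr t' (or_intror Ht')) (S m) m z); lia.
      * intros i l y' _ Hl _. snoc m. rewrite Et.
        split; (intros [A (e & B & C)]; split; [exact A|]; exists e; split; [|exact C]).
        -- apply (den_weaken i ks l [y']); [lia|exact B].
        -- apply (den_weaken i ks l [y']); [lia|exact B].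
    + intros i l Hi [Hl Hb]. cbn beta.
      pose proof (Hfr t (or_introl eq_refl)) as Hq.
      assert (E : forall e, den i ks l e -> forall y', y' <= length (enc i) ->
        tok_test i (okind ks t) (nth (optr t) l 0) (nth y l 0) y' <->
        seg (enc i) (nth y l 0) y' (3 :: 1 :: bin (oval e t))).
      { intros e He y' Hy'. apply tok_test_spec; auto using oval_denotes. }
      split.
      * intros (y' & Hy' & Ht' & e & He & Hs). exists e. split; [assumption|].
        cbn [map enc_objs flat_map]. rewrite <- app_assoc, seg_app. exists y'. split; [|exact Hs].
        now apply E.
      * intros (e & He & Hs). cbn [map enc_objs flat_map] in Hs. rewrite <- app_assoc, seg_app in Hs.
        destruct Hs as (y' & Hs1 & Hs2). pose proof (seg_len _ _ _ _ Hs1) as [_ Ly].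
        exists y'. split; [assumption|]. split; [now apply (E e)|]. eauto.
Qed.

Lemma dec_time_tail m y z jo : y < m -> z < m ->
  dec m (fun i l => seg (enc i) (nth y l 0) (nth z l 0)
    (enc_time (option_map (Z.add (itmem i)) jo) ++ [4])).
Proof.
  intros Hy Hz. destruct jo as [j|]; cbn [option_map enc_time].
  - eapply dec_ext with (P := fun i l => exists a, a <= length (enc i) /\
      (seg (enc i) (nth y l 0) a [3; 2] /\ exists b, b <= length (enc i) /\
        (seg (enc i) a b (unary (itmem i + j)) /\ seg (enc i) b (nth z l 0) [4]))).
    + eapply dec_ex_ext.
      * apply dec_and; [apply (dec_seg (S m) y m); lia|].
        eapply (dec_ex_ext (S m) (fun i l b => seg (enc i) (nth m l 0) b (unary (itmem i + j)) /\
          seg (enc i) b (nth z l 0) [4])).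
        -- apply dec_and; [apply (dec_time (S (S m)) m (S m))|apply (dec_seg (S (S m)) (S m) z)]; lia.
        -- intros i l b _ Hl _. snoc (S m). reflexivity.
      * intros i l a _ Hl _. snoc m. reflexivity.
    + intros i l _ _. cbn beta.
      change ((3 :: 2 :: unary (itmem i + j)) ++ [4]) with ([3; 2] ++ unary (itmem i + j) ++ [4]).
      rewrite seg_app. split.
      * intros (a & _ & H1 & b & _ & H2 & H3). exists a. split; [assumption|]. apply seg_app. eauto.
      * intros (a & H1 & H). apply seg_app in H as (b & H2 & H3).
        pose proof (seg_len _ _ _ _ H1). pose proof (seg_len _ _ _ _ H2). exists a.
        split; [tauto|]. split; [assumption|]. exists b. tauto.
  - now apply (dec_seg m y z [4]).
Qed.

Lemma dec_fact_start m y : y < m -> dec m (fun i l => fact_start (enc i) (nth y l 0)).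
Proof.
  intros Hy. unfold fact_start.
  eapply dec_ext with (P := fun i l => (~ exists x, x <= length (enc i) /\ nth y l 0 = S x) \/
    exists x, x <= length (enc i) /\ (nth y l 0 = S x /\ sym (enc i) x = 4)).
  - apply dec_or; [apply dec_not|].
    + eapply dec_ex_ext; [apply (dec_succ (S m) m y); lia|].
      intros i l x _ Hl _. snoc m. reflexivity.
    + eapply dec_ex_ext; [apply dec_and; [apply (dec_succ (S m) m y); lia|apply (dec_sym (S m) m); lia]|].
      intros i l x _ Hl _. snoc m. reflexivity.
  - intros i l _ [_ Hl]. cbn beta. specialize (Hl y). split.
    + intros [N|(x & _ & H)]; [left|right; eauto].
      destruct (nth y l 0) as [|x]; [reflexivity|]. exfalso. apply N. exists x. split; [lia|reflexivity].
    + intros [->|(x & E & H)]; [left|right].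
      * intros (x & _ & E). discriminate.
      * exists x. split; [lia|auto].
Qed.

Lemma odef_mem m p ts jo : Forall (ot_ok m) ts ->
  odef m (fun i e => In (p, map (oval e) ts, option_map (Z.add (itmem i)) jo) (map fact_natom (idata i))).
Proof.
  intros Hts ks Hk. subst m.
  (* A fresh object among the arguments excludes the fact from the data. Otherwise every symbolic
     argument is a constant, whose name can be searched for. *)
  destruct (classic (exists t k, In t ts /\ okind ks t = Some k /\ c <= k)) as [(t & k & Ht & Eq & Hc)|N].
  - eapply dec_ext; [apply (dec_const _ False)|]. intros i l Hi _. cbn beta. split; [contradiction|].
    intros (e & He & Hin). apply (symval_fresh i k Hc). apply dobjs_natoms. do 3 eexists. split; [exact Hin|].
    pose proof (oval_denotes i ks l e t He (Forall_in Hts t Ht)) as D.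
    rewrite Eq in D. cbn in D. rewrite <- D. now apply in_map.
  - set (T := fun i : instance => enc_time (option_map (Z.add (itmem i)) jo) ++ [4]).
    set (m := length ks).
    set (ok := pedb p = true /\ sorted_as p (length ts) (isSome jo)).
    assert (HO : forall m' y z, m <= m' -> y < m' -> z < m' ->
      dec m' (fun i l => exists e, den i ks l e /\
        seg (enc i) (nth y l 0) (nth z l 0) (enc_objs (map (oval e) ts) ++ T i))).
    { apply dec_objs; auto.
      - intros; now apply dec_time_tail.
      - intros t Ht. destruct (okind ks t) as [k|] eqn:Eq; [|exact I].
        destruct (Nat.lt_ge_cases k c); [assumption|]. exfalso. eauto 6. }
    eapply dec_ext with (P := fun i l => ok /\ exists y, y <= length (enc i) /\
      (fact_start (enc i) y /\ exists x, x <= length (enc i) /\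
        (seg (enc i) y x (bin (pname p)) /\ exists z, z <= length (enc i) /\
          exists e, den i ks l e /\ seg (enc i) x z (enc_objs (map (oval e) ts) ++ T i)))).
    + apply dec_and; [apply dec_const|]. eapply dec_ex_ext.
      * apply dec_and; [apply (dec_fact_start (S m) m); lia|].
        eapply (dec_ex_ext (S m) (fun i l x => seg (enc i) (nth m l 0) x (bin (pname p)) /\
          exists z, z <= length (enc i) /\
          exists e, den i ks l e /\ seg (enc i) x z (enc_objs (map (oval e) ts) ++ T i))).
        -- apply dec_and; [apply (dec_seg (S (S m)) m (S m)); lia|].
           eapply (dec_ex_ext (S (S m)) (fun i l z =>
             exists e, den i ks l e /\ seg (enc i) (nth (S m) l 0) z (enc_objs (map (oval e) ts) ++ T i))).
           ++ apply (HO (S (S (S m))) (S m) (S (S m))); lia.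
           ++ intros i l z _ Hl _. snoc (S (S m)).
              split; intros (e & B & C); exists e; (split; [|exact C]);
                apply (den_weaken i ks l [z]); (lia || exact B).
        -- intros i l x _ Hl _. snoc (S m). apply and_iff_compat_l.
           split; intros (z & Hz & e & B & C); exists z; (split; [exact Hz|]); exists e; (split; [|exact C]);
             apply (den_weaken i ks l [x]); (lia || exact B).
      * intros i l y _ Hl _. snoc m. apply and_iff_compat_l.
        split; intros (x & Hx & A & z & Hz & e & B & C); exists x; (split; [exact Hx|]); (split; [exact A|]);
          exists z; (split; [exact Hz|]); exists e; (split; [|exact C]);
          apply (den_weaken i ks l [y]); (lia || exact B).
    + intros i l Hi _. cbn beta.
      assert (HD : is_dataset (idata i)) by apply Hi.
      assert (Hok : forall e, natom_ok (p, map (oval e) ts, option_map (Z.add (itmem i)) jo) <-> ok).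
      { intros e. unfold natom_ok, ok. rewrite length_map. now destruct jo. }
      assert (HE : forall e, enc_natom (p, map (oval e) ts, option_map (Z.add (itmem i)) jo) =
        bin (pname p) ++ enc_objs (map (oval e) ts) ++ T i) by reflexivity.
      split.
      * intros (Hok' & y & _ & Hst & x & _ & H1 & z & _ & e & He & H2). exists e. split; [assumption|].
        apply natom_spec; [assumption|]. split; [now apply Hok|]. exists y, z. split; [assumption|].
        rewrite HE. apply seg_app. eauto.
      * intros (e & He & Hin). apply natom_spec in Hin as (Ho & y & z & Hst & Hs); [|assumption].
        split; [now apply (Hok e)|]. rewrite HE in Hs. apply seg_app in Hs as (x & H1 & H2).
        pose proof (seg_len _ _ _ _ H1). pose proof (seg_len _ _ _ _ H2). exists y. split; [lia|].
        split; [assumption|]. exists x. split; [lia|]. split; [assumption|]. exists z. split; [lia|]. eauto.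
Qed.
End Objects.

(** * Nonrecursive connected programs *)

(* Atom patterns: an object-term tuple and the offset of the time argument, if any, from the unique
   time variable of the rule. *)
Definition patom : Type := pred * list oterm * option Z.
Definition nrule : Type := list patom * patom.

Definition otval (vo : nat -> nat) (t : oterm) : nat := match t with OConst k => k | OVar x => vo x end.
Definition peval (vo : nat -> nat) (s : Z) (a : patom) : natom :=
  let '(p, ts, jo) := a in (p, map (otval vo) ts, option_map (Z.add s) jo).

Definition term_oterms (t : term) : list oterm := match t with TObj o => [o] | TTm _ => [] end.
Definition norm_atom (a : atom) : patom :=
  (apred a, flat_map term_oterms (aargs a),
   match last (aargs a) (TObj (OVar 0)) with
   | TTm (TVar _) => Some 0%Z
   | TTm (TShift _ k) => Some k
   | _ => None
   end).
Definition norm_rule (r : rule) : nrule := (map norm_atom (body r), norm_atom (Defs.head r)).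

Definition npred {A B} (f : pred * A * B) : pred := fst (fst f).
Definition ntime {A B} (f : A * B) : B := snd f.

Definition gat (f : natom) : gatom :=
  let '(p, os, t) := f in (p, map VObj os ++ match t with Some z => [VTime z] | None => [] end).

Lemma gat_inj f f' : gat f = gat f' -> f = f'.
Proof.
  destruct f as [[p os] t], f' as [[p' os'] t']. cbn. intros [= -> E].
  assert (os = os' /\ t = t') as [-> ->]; [|reflexivity].
  revert os' E; induction os as [|o os IH]; intros [|o' os'] E; cbn in E.
  - destruct t, t'; try discriminate; [|auto]. injection E as ->. auto.
  - destruct t; discriminate.
  - destruct t'; discriminate.
  - injection E as -> E. destruct (IH os' E) as [-> ->]. auto.
Qed.

Lemma atom_canonical a : atom_ok a -> exists os tt,
  aargs a = map TObj os ++ match tt with Some t => [TTm t] | None => [] end.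
Proof.
  intros [Hw Hp]. unfold well_sorted in Hw.
  assert (O : forall ts k, Forall2 term_has_sort ts (repeat SObj k) -> exists os, ts = map TObj os).
  { induction ts as [|t ts IH]; intros [|k] H; inversion H; subst.
    - now exists [].
    - destruct (IH k) as (os & ->); [assumption|]. destruct t as [o|]; [|contradiction].
      now exists (o :: os). }
  destruct Hp as [Hp|(rest & Hp & Hr)].
  - apply all_obj_sorts in Hp. rewrite Hp in Hw. destruct (O _ _ Hw) as (os & ->).
    exists os, None. now rewrite app_nil_r.
  - apply all_obj_sorts in Hr. rewrite Hp, Hr in Hw.
    apply Forall2_app_inv_r in Hw as (l1 & l2 & H1 & H2 & ->).
    destruct (O _ _ H1) as (os & ->).
    inversion H2 as [|t s l2' ? Ht Hn]; subst. inversion Hn; subst.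
    destruct t as [|t]; [contradiction|]. now exists os, (Some t).
Qed.

Lemma oterms_of os : flat_map term_oterms (map TObj os) = os.
Proof. induction os; cbn; congruence. Qed.

Lemma last_obj os : exists o, last (map TObj os) (TObj (OVar 0)) = TObj o.
Proof.
  destruct os as [|o os] using rev_ind; [now eexists|]. rewrite map_app. cbn [map].
  rewrite last_last. now eexists.
Qed.

Lemma norm_atom_eval a x vo vt : atom_ok a -> atom_no_timepoint a ->
  (forall y, In y (atom_tvars a) -> y = x) ->
  eval_atom vo vt a = gat (peval vo (vt x) (norm_atom a)).
Proof.
  intros Hok Hnt Hx. destruct (atom_canonical a Hok) as (os & tt & E).
  destruct a as [p ts]; cbn [apred aargs] in *. subst ts.
  unfold eval_atom, norm_atom, peval, gat; cbn [apred aargs]. f_equal.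
  rewrite map_app, flat_map_app, oterms_of, !map_app, !map_map. rewrite <- app_assoc. f_equal.
  - apply map_ext. intros [k|y]; reflexivity.
  - destruct tt as [t|].
    + rewrite last_last. cbn [map flat_map term_oterms app].
      apply Forall_app in Hnt as [_ Hnt]. inversion Hnt as [|? ? Ht _]; subst.
      unfold atom_tvars in Hx. cbn [aargs] in Hx. rewrite flat_map_app in Hx.
      destruct t as [z|y|y k]; [contradiction| |]; cbn;
        rewrite (Hx y) by (apply in_or_app; right; now left); [now rewrite Z.add_0_r|reflexivity].
    + rewrite app_nil_r. destruct (last_obj os) as [o ->]. reflexivity.
Qed.

Lemma norm_atom_time a : atom_ok a -> atom_no_timepoint a ->
  ntime (norm_atom a) = None <-> atom_tvars a = [].
Proof.
  intros Hok Hnt. destruct (atom_canonical a Hok) as (os & tt & E).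
  destruct a as [p ts]; cbn [apred aargs] in *. subst ts.
  unfold norm_atom, atom_tvars, ntime; cbn [apred aargs snd].
  assert (flat_map term_tvars (map TObj os) = []) as E by (clear; induction os; cbn; auto).
  rewrite flat_map_app, E. destruct tt as [t|].
  - rewrite last_last. apply Forall_app in Hnt as [_ Hnt]. inversion Hnt; subst.
    destruct t; cbn; [contradiction| |]; split; discriminate.
  - rewrite app_nil_r. destruct (last_obj os) as [o ->]. now split.
Qed.

Lemma fact_eval a vo vt : is_fact a -> eval_atom vo vt a = gat (fact_natom a).
Proof.
  intros Hf. destruct (fact_canonical a Hf) as (os & t & E & _). rewrite E, fact_natom_mk.
  unfold eval_atom, mk_fact; cbn. f_equal. rewrite map_app, map_map. f_equal. now destruct t.
Qed.

(** * Derivations of bounded height *)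

Section Derivations.
Variable rs : list nrule.

(** Facts of [I] are accepted at every height, so [n] is only an upper bound. *)
Fixpoint nder (I : natom -> Prop) (n : nat) (g : natom) : Prop :=
  I g \/
  match n with
  | 0 => False
  | S n' => exists r vo s, In r rs /\ peval vo s (snd r) = g /\
      forall b, In b (fst r) -> nder I n' (peval vo s b)
  end.

Lemma nder_step I n g : nder I (S n) g <-> I g \/ exists r vo s, In r rs /\ peval vo s (snd r) = g /\
      forall b, In b (fst r) -> nder I n (peval vo s b).
Proof. reflexivity. Qed.

Lemma nder_base (I : natom -> Prop) n g : I g -> nder I n g.
Proof. destruct n; now left. Qed.

Lemma nder_mono I I' n n' g : (forall f, I f -> I' f) -> n <= n' -> nder I n g -> nder I' n' g.
Proof.
  intros HI. revert n' g; induction n as [|n IH]; intros n' g Hn.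
  - intros [H|[]]. now apply nder_base, HI.
  - destruct n' as [|n']; [lia|]. rewrite !nder_step.
    intros [H|(r & vo & s & Hr & Hg & Hb)]; [left; auto|right].
    exists r, vo, s. split; [assumption|]. split; [assumption|]. intros b Hin. apply IH; [lia|auto].
Qed.

Definition ndep (p p' : pred) : Prop :=
  exists r, In r rs /\ npred (snd r) = p /\ exists b, In b (fst r) /\ npred b = p'.

Lemma peval_pred vo s a : npred (peval vo s a) = npred a.
Proof. now destruct a as [[p ts] jo]. Qed.

(* The head predicates along a branch of a derivation are pairwise distinct. *)
Lemma nder_bound I n g : (forall p, ~ clos_trans pred ndep p p) ->
  nder I n g -> nder I (length rs) g.
Proof.
  intros Hnr.
  (* [A] collects the head predicates above the current goal. Acyclicity keeps them distinct, so
     each rule application uses up one of at most [length rs] predicates. *)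
  enough (H : forall n g A, NoDup A -> incl A (map (fun r => npred (snd r)) rs) ->
    (forall a, In a A -> clos_trans pred ndep a (npred g)) ->
    nder I n g -> nder I (length rs - length A) g).
  { intros Hg. rewrite <- (Nat.sub_0_r (length rs)). apply (H n g []); auto.
    - constructor.
    - intros x [].
    - intros x []. }
  clear n g. induction n as [|n IH]; intros g A ND HA Hc.
  - intros [H|[]]. now apply nder_base.
  - rewrite nder_step. intros [H|(r & vo & s & Hr & Hg & Hb)]; [now apply nder_base|].
    assert (Hp : npred (snd r) = npred g) by (rewrite <- Hg, peval_pred; reflexivity).
    assert (ND' : NoDup (npred g :: A)).
    { constructor; [|assumption]. intros Hin. exact (Hnr _ (Hc _ Hin)). }
    assert (HA' : incl (npred g :: A) (map (fun r => npred (snd r)) rs)).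
    { intros x [<-|Hx]; [|now apply HA]. rewrite <- Hp. apply in_map_iff. eauto. }
    pose proof (NoDup_incl_length ND' HA') as L. rewrite length_map in L. cbn [length] in L.
    assert (S (length A) <= length rs) by exact L.
    assert (length rs - length A = S (length rs - S (length A))) as -> by (clear L; lia).
    rewrite nder_step. right. exists r, vo, s. split; [assumption|]. split; [assumption|].
    intros b Hin. apply (IH _ (npred g :: A)); auto. rewrite peval_pred.
    assert (D : ndep (npred g) (npred b)) by (exists r; eauto 6).
    intros a [<-|Ha]; [now apply t_step|]. eapply t_trans; [now apply Hc|now apply t_step].
Qed.

Definition pconsts (a : patom) : list nat :=
  flat_map (fun t => match t with OConst k => [k] | _ => [] end) (snd (fst a)).
Definition pvars (a : patom) : list nat :=
  flat_map (fun t => match t with OVar x => [x] | _ => [] end) (snd (fst a)).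
Definition ratoms (r : nrule) : list patom := snd r :: fst r.

Definition nmap (f : nat -> nat) (g : natom) : natom := let '(p, os, t) := g in (p, map f os, t).

Lemma nmap_peval f vo vo' s a :
  (forall k, In k (pconsts a) -> f k = k) -> (forall x, In x (pvars a) -> vo' x = f (vo x)) ->
  peval vo' s a = nmap f (peval vo s a).
Proof.
  destruct a as [[p ts] jo]. unfold pconsts, pvars. cbn [fst snd peval nmap]. intros Hk Hx.
  do 2 f_equal. rewrite map_map. apply map_ext_in. intros [k|x] Ht; cbn.
  - symmetry. apply Hk, in_flat_map. exists (OConst k). split; [assumption|now left].
  - apply Hx, in_flat_map. exists (OVar x). split; [assumption|now left].
Qed.

Definition fixes (f : nat -> nat) : Prop :=
  forall r a k, In r rs -> In a (ratoms r) -> In k (pconsts a) -> f k = k.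

(** Bodies are positive and express only equalities between objects, which every renaming preserves;
    so [f] need not be injective. *)
Lemma nder_map f (I I' : natom -> Prop) n g : fixes f -> (forall h, I h -> I' (nmap f h)) ->
  nder I n g -> nder I' n (nmap f g).
Proof.
  intros Hf HI. revert g; induction n as [|n IH]; intros g.
  - intros [H|[]]. now apply nder_base, HI.
  - rewrite !nder_step. intros [H|(r & vo & s & Hr & <- & Hb)]; [left; now apply HI|right].
    exists r, (fun x => f (vo x)), s. split; [assumption|].
    split; [apply nmap_peval; auto; intros; eapply Hf; eauto; now left|].
    intros b Hin. rewrite (nmap_peval f vo); auto.
    intros k Hk. eapply Hf; eauto. now right.
Qed.

Variable V : nat.

(** The assignment is a list of [V] objects of the domain, so a rule application becomes a block of
    [V] quantifiers. *)
Fixpoint nderd (dom : nat -> Prop) (I : natom -> Prop) (n : nat) (g : natom) : Prop :=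
  I g \/
  match n with
  | 0 => False
  | S n' => exists r v s, In r rs /\ (length v = V /\ Forall dom v) /\
      peval (fun x => nth x v 0) s (snd r) = g /\
      forall b, In b (fst r) -> nderd dom I n' (peval (fun x => nth x v 0) s b)
  end.

Lemma nderd_nder dom I n g : nderd dom I n g -> nder I n g.
Proof.
  revert g; induction n as [|n IH]; intros g.
  - intros [H|[]]. now apply nder_base.
  - intros [H|(r & v & s & Hr & _ & Hg & Hb)]; [now apply nder_base|].
    apply nder_step. right. exists r, (fun x => nth x v 0), s. auto.
Qed.

(* A retraction onto a domain containing all constants and all objects of [I] maps derivations into
   derivations over the domain. *)
Lemma nder_nderd f (dom : nat -> Prop) I n g : fixes f -> (forall o, dom (f o)) ->
  (forall h, I h -> nmap f h = h) ->
  (forall r a x, In r rs -> In a (ratoms r) -> In x (pvars a) -> x < V) ->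
  nder I n g -> nderd dom I n (nmap f g).
Proof.
  intros Hf Hdom HI HV. revert g; induction n as [|n IH]; intros g.
  - intros [H|[]]. left. now rewrite HI.
  - rewrite nder_step. intros [H|(r & vo & s & Hr & <- & Hb)]; [left; now rewrite HI|right].
    exists r, (map (fun x => f (vo x)) (seq 0 V)), s. split; [assumption|].
    assert (E : forall a, In a (ratoms r) ->
      peval (fun x => nth x (map (fun x => f (vo x)) (seq 0 V)) 0) s a = nmap f (peval vo s a)).
    { intros a Ha. apply nmap_peval.
      - intros k Hk. eapply Hf; eauto.
      - intros x Hx. apply (ptrs_nth V (fun x => f (vo x))). eapply HV; eauto. }
    split; [split|split].
    + now rewrite length_map, length_seq.
    + apply Forall_forall. intros o Ho. apply in_map_iff in Ho as (x & <- & _). apply Hdom.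
    + apply E. now left.
    + intros b Hin. rewrite E by now right. apply IH. auto.
Qed.

Variables B R : nat.
Hypothesis body_small : forall r, In r rs -> length (fst r) <= B.
Hypothesis rule_local : forall r b, In r rs -> In b (fst r) ->
  match ntime (snd r), ntime b with
  | Some k, Some k' => (Z.abs (k - k') <= Z.of_nat R)%Z
  | None, Some _ => False
  | _, None => True
  end.

(** Each rule application moves the time by at most [R]. A temporal fact can support only a temporal
    goal, since a rigid head has a rigid body. *)
Definition near (n : nat) (g f : natom) : Prop :=
  match ntime f with
  | None => True
  | Some t' => exists t, ntime g = Some t /\ (Z.abs (t - t') <= Z.of_nat (n * R))%Z
  end.

Definition body_preds : list pred := flat_map (fun r => map npred (fst r)) rs.

Lemma near_self n g : near n g g.
Proof. unfold near. destruct (ntime g) as [t|]; [|exact I]. exists t. split; [reflexivity|lia]. Qed.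

Lemma near_body r b vo s n f : In r rs -> In b (fst r) ->
  near n (peval vo s b) f -> near (S n) (peval vo s (snd r)) f.
Proof.
  intros Hr Hb. pose proof (rule_local r b Hr Hb) as HL. unfold near.
  destruct (ntime f) as [t'|]; [|auto]. intros (t & Et & Ht).
  destruct b as [[p ts] jo], r as [bs [[p' ts'] jo']]. unfold ntime in *. cbn in *.
  destruct jo as [k|]; [|discriminate]. injection Et as <-.
  destruct jo' as [k'|]; [|contradiction]. eexists. split; [reflexivity|]. lia.
Qed.

(** A tree of height [n] with at most [B] children per node has at most [S B ^ n] leaves, also for
    [B = 0]. A leaf other than the root matches a body atom, which restricts its predicate. *)
Lemma nder_support I n g : nder I n g -> exists F, length F <= S B ^ n /\
  (forall f, In f F -> I f /\ near n g f /\ (npred f = npred g \/ In (npred f) body_preds)) /\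
  nder (fun f => In f F) n g.
Proof.
  revert g; induction n as [|n IH]; intros g.
  - intros [H|[]]. exists [g]. split; [cbn; lia|]. split; [|left; now left].
    intros f [<-|[]]. auto using near_self.
  - rewrite nder_step. intros [H|(r & vo & s & Hr & <- & Hb)].
    + exists [g]. split; [cbn [length]; pose proof (Nat.pow_nonzero (S B) (S n)); lia|].
      split; [|apply nder_base; now left]. intros f [<-|[]]. auto using near_self.
    + assert (HF : forall bs, incl bs (fst r) -> exists F, length F <= length bs * S B ^ n /\
        (forall f, In f F -> I f /\ near (S n) (peval vo s (snd r)) f /\ In (npred f) body_preds) /\
        forall b, In b bs -> nder (fun f => In f F) n (peval vo s b)).
      { induction bs as [|b bs IHbs]; intros Hi.
        - exists []. cbn. repeat split; try lia; contradiction.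
        - destruct IHbs as (F1 & L1 & P1 & D1); [intros x Hx; apply Hi; now right|].
          assert (Hbr : In b (fst r)) by (apply Hi; now left).
          destruct (IH _ (Hb b Hbr)) as (F2 & L2 & P2 & D2).
          exists (F2 ++ F1). rewrite length_app. split; [cbn [length]; lia|]. split.
          + intros f Hf. apply in_app_or in Hf as [Hf|Hf]; [|now apply P1].
            destruct (P2 f Hf) as (If & Nf & Pf). split; [assumption|].
            split; [eapply near_body; eauto|]. destruct Pf as [Pf|Pf]; [|assumption].
            rewrite Pf, peval_pred. apply in_flat_map. exists r. split; [assumption|]. now apply in_map.
          + intros b' [<-|Hb'].
            * eapply nder_mono; [|reflexivity|exact D2]. intros f Hf. apply in_or_app. now left.
            * eapply nder_mono; [|reflexivity|exact (D1 b' Hb')]. intros f Hf. apply in_or_app. now right. }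
      destruct (HF (fst r) (incl_refl _)) as (F & L & PF & D). exists F. split; [|split].
      * specialize (body_small r Hr). cbn [Nat.pow]. nia.
      * intros f Hf. destruct (PF f Hf) as (? & ? & ?). auto.
      * apply nder_step. right. eauto 6.
Qed.

End Derivations.

Lemma rule_tvar r : rule_connected r -> exists x, forall a y, In a (Defs.head r :: body r) ->
  In y (atom_tvars a) -> y = x.
Proof.
  intros [H _]. unfold rule_tvars in H.
  destruct (flat_map atom_tvars (Defs.head r :: body r)) as [|x l] eqn:E.
  - exists 0. intros a y Ha Hy. exfalso.
    assert (In y (flat_map atom_tvars (Defs.head r :: body r))) by (apply in_flat_map; eauto).
    rewrite E in *. contradiction.
  - exists x. intros a y Ha Hy. apply H; [|now left]. rewrite <- E. apply in_flat_map. eauto.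
Qed.

(** From left to right, entailment is applied to the set of derivable facts, which is a model; from
    right to left, induction on the height works in any model. *)
Lemma entails_nder P D g : program_wf P -> Forall rule_connected P ->
  Forall (fun r => atom_no_timepoint (Defs.head r) /\ Forall atom_no_timepoint (body r)) P ->
  is_dataset D ->
  entails (P ++ map fact_rule D) (gat g) <->
  exists n, nder (map norm_rule P) (fun f => In f (map fact_natom D)) n g.
Proof.
  intros Hwf Hcon Hnt HD. set (I0 := fun f => In f (map fact_natom D)).
  assert (Hev : forall r, In r P -> exists x, forall vo vt a, In a (Defs.head r :: body r) ->
    eval_atom vo vt a = gat (peval vo (vt x) (norm_atom a))).
  { intros r Hr. destruct (rule_tvar r (Forall_in Hcon r Hr)) as [x Hx]. exists x.
    intros vo vt a Ha. destruct (Forall_in Hwf r Hr) as (Ok1 & Ok2 & _).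
    destruct (Forall_in Hnt r Hr) as (Nt1 & Nt2).
    apply norm_atom_eval; [| |eauto]; destruct Ha as [<-|Ha]; auto;
      [apply (Forall_in Ok2 a Ha)|apply (Forall_in Nt2 a Ha)]. }
  split.
  - intros H. destruct (H (fun gg => exists g n, gg = gat g /\ nder (map norm_rule P) I0 n g))
      as (g' & n & E & Hn); [|apply gat_inj in E as ->; eauto].
    intros r Hr vo vt Hb. apply in_app_or in Hr as [Hr|Hr].
    + destruct (Hev r Hr) as [x Hx].
      (* The body atoms are derived at different heights; the maximum of these serves for all. *)
      assert (HN : forall bs, incl bs (body r) -> exists N, forall b, In b bs ->
        nder (map norm_rule P) I0 N (peval vo (vt x) (norm_atom b))).
      { induction bs as [|b bs IH]; intros Hi.
        - exists 0. contradiction.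
        - destruct IH as [N HN]; [intros y Hy; apply Hi; now right|].
          assert (Hbr : In b (body r)) by (apply Hi; now left).
          destruct (Hb b Hbr) as (g' & n & E & Hn).
          rewrite (Hx vo vt b) in E by now right. apply gat_inj in E. subst g'.
          exists (Nat.max N n). intros b' [<-|Hb'].
          + eapply nder_mono; [intros f Hf; exact Hf| |exact Hn]. lia.
          + eapply nder_mono; [intros f Hf; exact Hf| |exact (HN b' Hb')]. lia. }
      destruct (HN (body r) (incl_refl _)) as [N HN']. clear HN. rename HN' into HN.
      rewrite (Hx vo vt) by now left.
      exists (peval vo (vt x) (norm_atom (Defs.head r))), (S N). split; [reflexivity|].
      apply nder_step. right. exists (norm_rule r), vo, (vt x). split; [now apply in_map|].
      split; [reflexivity|]. intros b Hb'. apply in_map_iff in Hb' as (b' & <- & Hb'). now apply HN.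
    + apply in_map_iff in Hr as (a & <- & Ha). cbn [fact_rule Defs.head].
      destruct (Forall_in HD a Ha) as [Hf _]. rewrite fact_eval by assumption.
      exists (fact_natom a), 0. split; [reflexivity|]. left. now apply in_map.
  - intros [n Hn] M HM. revert g Hn. induction n as [|n IH]; intros g Hn.
    + destruct Hn as [H|[]]. apply in_map_iff in H as (a & <- & Ha).
      destruct (Forall_in HD a Ha) as [Hf _].
      rewrite <- (fact_eval a (fun _ => 0) (fun _ => 0%Z) Hf).
      apply (HM (fact_rule a)); [apply in_or_app; right; now apply in_map|contradiction].
    + apply nder_step in Hn as [H|(r & vo & s & Hr & <- & Hb)].
      * apply IH. now apply nder_base.
      * apply in_map_iff in Hr as (r0 & <- & Hr). destruct (Hev r0 Hr) as [x Hx].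
        cbn [norm_rule fst snd] in *. rewrite <- (Hx vo (fun _ => s) (Defs.head r0)) by now left.
        apply (HM r0); [apply in_or_app; now left|]. intros b Hb'.
        rewrite (Hx vo (fun _ => s)) by now right. apply IH, Hb. now apply in_map.
Qed.

(** * Definability of derivations *)

Lemma restrict_natoms D tau f : In f (map fact_natom (restrict D tau)) <->
  In f (map fact_natom D) /\ match ntime f with Some t => (tau < t)%Z | None => True end.
Proof.
  rewrite !in_map_iff. split.
  - intros (a & <- & Ha). apply filter_In in Ha as [Ha Ht]. split; [eauto|].
    unfold fact_natom, ntime; cbn [snd]. destruct (fact_time a); [now apply Z.ltb_lt|exact I].
  - intros [(a & <- & Ha) Ht]. exists a. split; [reflexivity|]. apply filter_In. split; [assumption|].
    unfold fact_natom, ntime in Ht; cbn [snd] in Ht. destruct (fact_time a); [now apply Z.ltb_lt|reflexivity].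
Qed.

(* A fact of the update: predicate, indices of its objects in the environment, time relative to [itmem]. *)
Definition ufact : Type := pred * list nat * Z.

Definition ufact_natom (i : instance) (e : list nat) (u : ufact) : natom :=
  let '(p, xs, j) := u in (p, map (fun x => nth x e 0) xs, Some (itmem i + j)%Z).

Definition ufact_below (m : nat) (u : ufact) : Prop := Forall (fun x => x < m) (snd (fst u)).

Definition base_facts (forget : bool) (i : instance) (us : list ufact) (e : list nat) (f : natom) : Prop :=
  In f (map fact_natom (if forget then restrict (idata i) (itmem i) else idata i)) \/
  In f (map (ufact_natom i e) us).

Lemma base_facts_app forget i us e v : Forall (ufact_below (length e)) us ->
  base_facts forget i us (e ++ v) = base_facts forget i us e.
Proof.
  intros H. unfold base_facts.
  replace (map (ufact_natom i (e ++ v)) us) with (map (ufact_natom i e) us); [reflexivity|].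
  apply map_ext_in. intros [[p xs] j] Hu. apply (Forall_in H) in Hu.
  unfold ufact_natom. do 2 f_equal. apply map_ext_in. intros x Hx.
  symmetry. apply app_nth1. exact (Forall_in Hu x Hx).
Qed.

(** Turns equality of tuples into a conjunction over a finite list, the form that [odef_forall_in]
    accepts. *)
Lemma map_eq_combine {X Y Z} (f : X -> Z) (g : Y -> Z) xs ys : length xs = length ys ->
  map f xs = map g ys <-> forall xy, In xy (combine xs ys) -> f (fst xy) = g (snd xy).
Proof.
  revert ys; induction xs as [|x xs IH]; intros [|y ys] Hl; try discriminate; cbn.
  - split; [contradiction|reflexivity].
  - injection Hl as Hl. specialize (IH ys Hl). split.
    + intros E. injection E as E1 E2. intros xy [<-|H]; [exact E1|]. now apply IH.
    + intros H. f_equal; [exact (H (x, y) (or_introl eq_refl))|]. apply IH. auto.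
Qed.

Section Definability.
Variables (c nsym : nat) (rs : list nrule) (V : nat).
Hypothesis consts_lt : forall r a k, In r rs -> In a (ratoms r) -> In k (pconsts a) -> k < c.
Hypothesis vars_lt : forall r a x, In r rs -> In a (ratoms r) -> In x (pvars a) -> x < V.
Hypothesis untimed : forall r b, In r rs -> In b (fst r) -> ntime (snd r) = None -> ntime b = None.

Variables (forget : bool) (us : list ufact) (m0 : nat).
Hypothesis us_below : Forall (ufact_below m0) us.

Lemma odef_base m p ts jo : m0 <= m -> Forall (ot_ok c m) ts ->
  odef c m (fun i e => base_facts forget i us e (p, map (oval e) ts, option_map (Z.add (itmem i)) jo)).
Proof.
  intros Hm Hts. unfold base_facts. apply odef_or.
  (* As times are relative to [itmem], forgetting amounts to the condition [0 < j], which does not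
     depend on the instance. *)
  - eapply odef_ext; [apply odef_and; [now apply (odef_mem c m p ts jo)|
      apply (odef_const c m (forget = true -> match jo with Some j => (0 < j)%Z | None => True end))]|].
    intros i e _ _. cbn beta. destruct forget.
    + rewrite restrict_natoms. apply and_iff_compat_l. destruct jo as [j|]; cbn; intuition lia.
    + intuition discriminate.
  - set (same u := fun (i : instance) e => (npred u = p /\ jo = Some (ntime u) /\
      length ts = length (snd (fst u))) /\
      forall xy, In xy (combine ts (snd (fst (u : ufact)))) -> oval e (fst xy) = oval e (OV (snd xy))).
    eapply odef_ext with (P := fun i e => exists u, In u us /\ same u i e).
    + apply odef_exists_in. intros u Hu. unfold same. apply odef_and; [apply odef_const|].
      apply odef_forall_in.
      intros [t x] Hin. apply odef_eq.
      * apply in_combine_l in Hin. exact (Forall_in Hts t Hin).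
      * apply in_combine_r in Hin. apply (Forall_in us_below) in Hu.
        apply (Forall_in Hu) in Hin. cbn. lia.
    + intros i e _ _. cbn beta. rewrite in_map_iff. unfold same, npred, ntime.
      split; intros ([[p' xs] j] & H1 & H2); cbn [fst snd] in *.
      * destruct H2 as ((-> & -> & Hl) & H). exists (p, xs, j). split; [|assumption].
        cbn. do 2 f_equal. symmetry. now apply (map_eq_combine (oval e) (fun x => nth x e 0)).
      * destruct jo as [j'|]; [|discriminate]. cbn in H1. injection H1 as -> E Ej.
        assert (Hl : length ts = length xs) by (apply (f_equal (@length nat)) in E; now rewrite !length_map in E).
        exists (p, xs, j). split; [assumption|]. cbn [fst snd].
        split; [repeat split; [f_equal; lia|assumption]|].
        now apply (map_eq_combine (oval e) (fun x => nth x e 0)).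
Qed.

(** The values of the rule variables are appended to an environment of length [m]. *)
Definition lift (m : nat) (t : oterm) : ot := match t with OVar x => OV (m + x) | OConst k => OK k end.

Lemma oval_lift e v t : oval (e ++ v) (lift (length e) t) = otval (fun x => nth x v 0) t.
Proof. destruct t; cbn; [reflexivity|]. apply app_nth2_plus. Qed.

Lemma oval_app m e v t : length e = m -> ot_ok c m t -> oval (e ++ v) t = oval e t.
Proof. intros <-. destruct t; cbn; [apply app_nth1|reflexivity]. Qed.

Lemma lift_ok m r a : In r rs -> In a (ratoms r) ->
  Forall (ot_ok c (V + m)) (map (lift m) (snd (fst a))).
Proof.
  intros Hr Ha. apply Forall_forall. intros t Ht. apply in_map_iff in Ht as (t0 & <- & Ht).
  destruct t0 as [k|x]; cbn.
  - eapply consts_lt; eauto. apply in_flat_map. exists (OConst k). split; [assumption|now left].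
  - enough (x < V) by lia. eapply vars_lt; eauto. apply in_flat_map. exists (OVar x). split; [assumption|now left].
Qed.

Lemma ot_ok_mono m m' t : m <= m' -> ot_ok c m t -> ot_ok c m' t.
Proof. destruct t; cbn; lia. Qed.

(** The value of the time variable, relative to [itmem], at which a head with offset [k] meets a
    goal at [j]. A rigid head has a rigid body, so 0 does no harm there. *)
Definition delay (jo ko : option Z) : Z := match jo, ko with Some j, Some k => (j - k)%Z | _, _ => 0%Z end.

(** The recursion on the height unrolls into one fixed formula. Time needs no quantifier, because
    the goal determines the time variable of the rule. *)
Lemma odef_nderd n m p ts jo : m0 <= m -> Forall (ot_ok c m) ts ->
  odef c m (fun i e => nderd rs V (idom c nsym i) (base_facts forget i us e) n
    (p, map (oval e) ts, option_map (Z.add (itmem i)) jo)).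
Proof.
  revert m p ts jo; induction n as [|n IH]; intros m p ts jo Hm Hts.
  - eapply odef_ext; [apply (odef_base m p ts jo Hm Hts)|]. intros i e _ _. cbn. tauto.
  - set (St := fun (r : nrule) (i : instance) (e' : list nat) =>
      (forall xy, In xy (combine ts (snd (fst (snd r)))) -> oval e' (fst xy) = oval e' (lift m (snd xy))) /\
      (forall b, In b (fst r) -> nderd rs V (idom c nsym i) (base_facts forget i us e') n
        (npred b, map (oval e') (map (lift m) (snd (fst b))),
         option_map (Z.add (itmem i)) (option_map (Z.add (delay jo (ntime (snd r)))) (ntime b))))).
    eapply odef_ext with (P := fun i e =>
      base_facts forget i us e (p, map (oval e) ts, option_map (Z.add (itmem i)) jo) \/
      exists r, In r rs /\
        ((npred (snd r) = p /\ length ts = length (snd (fst (snd r))) /\ isSome jo = isSome (ntime (snd r))) /\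
         exists v, length v = V /\ Forall (idom c nsym i) v /\ St r i (e ++ v))).
    + apply odef_or; [now apply odef_base|].
      apply odef_exists_in.
      intros r Hr. apply odef_and; [apply odef_const|]. apply odef_ex_list. unfold St. apply odef_and.
      * apply odef_forall_in.
        intros [t h] Hin. apply odef_eq.
        -- apply in_combine_l in Hin. apply (ot_ok_mono m); [lia|].
           exact (Forall_in Hts t Hin).
        -- apply in_combine_r in Hin.
           apply (Forall_in (lift_ok m r (snd r) Hr (or_introl eq_refl))).
           now apply in_map.
      * apply odef_forall_in.
        intros b Hb. apply IH; [lia|]. apply (lift_ok m r b Hr). now right.
    + intros i e _ He. cbn beta. cbn [nderd].
      assert (Hbelow : Forall (ufact_below (length e)) us).
      { eapply Forall_impl; [|exact us_below]. intros u Hu. eapply Forall_impl; [|exact Hu]. cbn. lia. }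
      assert (Hhead : forall (r : nrule) v, length ts = length (snd (fst (snd r))) ->
        (forall xy, In xy (combine ts (snd (fst (snd r)))) -> oval (e ++ v) (fst xy) = oval (e ++ v) (lift m (snd xy)))
        <-> map (oval e) ts = map (otval (fun x => nth x v 0)) (snd (fst (snd r)))).
      { intros r v Hl.
        rewrite <- (map_eq_combine (oval (e ++ v)) (fun h => oval (e ++ v) (lift m h))) by assumption.
        replace (map (oval (e ++ v)) ts) with (map (oval e) ts).
        2: { apply map_ext_in. intros t Ht. symmetry. apply (oval_app m); [assumption|].
             exact (Forall_in Hts t Ht). }
        replace (map (fun h => oval (e ++ v) (lift m h)) (snd (fst (snd r))))
          with (map (otval (fun x => nth x v 0)) (snd (fst (snd r)))); [reflexivity|].
        apply map_ext. intros t. rewrite <- He. symmetry. apply oval_lift. }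
      assert (Hbody : forall (r : nrule) (b : patom) v s, In r rs -> In b (fst r) ->
        (ntime (snd r) <> None -> s = (itmem i + delay jo (ntime (snd r)))%Z) ->
        (npred b, map (oval (e ++ v)) (map (lift m) (snd (fst b))),
           option_map (Z.add (itmem i)) (option_map (Z.add (delay jo (ntime (snd r)))) (ntime b)))
        = peval (fun x => nth x v 0) s b).
      { intros r b v s Hr Hb Hs. pose proof (untimed r b Hr Hb) as Hu.
        destruct b as [[q bs] bo]. unfold npred, ntime in *. cbn [fst snd peval] in *. f_equal; [f_equal|].
        - rewrite map_map. apply map_ext. intros t. rewrite <- He. apply oval_lift.
        - destruct bo as [k|]; [|reflexivity]. cbn. f_equal. rewrite Hs; [lia|].
          intros E. specialize (Hu E). discriminate. }
      apply or_iff_compat_l. split.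
      * intros (r & Hr & (Hp & Hl & Ho) & v & Hv & Fv & H1 & H2).
        exists r, v, (itmem i + delay jo (ntime (snd r)))%Z. split; [assumption|]. split; [auto|]. split.
        -- apply Hhead in H1; [|assumption]. destruct r as [bs [[q hs] ho]].
           unfold npred, ntime in *. cbn [fst snd peval] in *. subst q. rewrite <- H1. f_equal.
           destruct jo as [j|], ho as [k|]; try discriminate; cbn; [|reflexivity]. f_equal. lia.
        -- intros b Hb. rewrite <- (Hbody r b v _ Hr Hb) by reflexivity.
           rewrite <- (base_facts_app forget i us e v) by assumption. now apply H2.
      * intros (r & v & s & Hr & (Hv & Fv) & Hg & Hb). exists r. split; [assumption|].
        destruct (snd r) as [[q hs] ho] eqn:Er. cbn [peval] in Hg. injection Hg as -> E1 E2.
        assert (Hl : length ts = length hs) by (apply (f_equal (@length nat)) in E1; now rewrite !length_map in E1).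
        split; [repeat split|].
        -- exact Hl.
        -- destruct jo, ho; try discriminate; reflexivity.
        -- exists v. split; [assumption|]. split; [assumption|]. split.
           ++ apply Hhead; rewrite Er; [exact Hl|]. symmetry. exact E1.
           ++ intros b Hin. rewrite base_facts_app by assumption.
              rewrite (Hbody r b v s Hr Hin); [now apply Hb|]. rewrite Er. unfold ntime. cbn [snd].
              destruct ho as [k|]; [|congruence]. intros _.
              destruct jo as [j|]; [|discriminate]. cbn in E2 |- *. injection E2. lia.
Qed.

End Definability.

(** * The criterion *)

Lemma norm_atom_sorted a : atom_ok a -> atom_no_timepoint a ->
  sorted_as (apred a) (length (snd (fst (norm_atom a)))) (isSome (ntime (norm_atom a))).
Proof.
  intros Hok Hnt. destruct (atom_canonical a Hok) as (os & tt & E). destruct Hok as [Hw _].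
  destruct a as [p ts]; unfold well_sorted in Hw; cbn [apred aargs] in *. subst ts.
  assert (O : forall (l : list oterm) ss, Forall2 term_has_sort (map TObj l) ss -> ss = repeat SObj (length l)).
  { induction l as [|o l IH]; intros ss H; inversion H; subst; [reflexivity|]. cbn. f_equal; [|now apply IH].
    destruct y; [reflexivity|contradiction]. }
  apply Forall2_app_inv_l in Hw as (s1 & s2 & H1 & H2 & E). apply O in H1 as ->.
  unfold sorted_as, norm_atom, ntime; cbn [apred aargs fst snd].
  rewrite flat_map_app, oterms_of, E. destruct tt as [t|].
  - rewrite last_last. cbn [flat_map term_oterms]. rewrite app_nil_r.
    inversion H2 as [|? s ? ? Ht Hn]; subst. inversion Hn; subst.
    apply Forall_app in Hnt as [_ Hnt]. inversion Hnt as [|? ? Ht' _]; subst.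
    destruct s; [contradiction|]. destruct t; [contradiction| |]; reflexivity.
  - inversion H2; subst. cbn [flat_map]. rewrite !app_nil_r.
    destruct (last_obj os) as [o ->]. cbn [isSome]. now rewrite app_nil_r.
Qed.

Fixpoint idx (o : nat) (l : list nat) : nat :=
  match l with [] => 0 | a :: l' => if o =? a then 0 else S (idx o l') end.

Lemma idx_lt o l : idx o l < length l <-> In o l.
Proof.
  induction l as [|a l IH]; cbn; [lia|]. destruct (Nat.eqb_spec o a) as [->|H].
  - split; [auto|lia].
  - rewrite <- IH. split; [intros H'; right; lia|]. intros [->|H']; [congruence|lia].
Qed.

Lemma nth_idx o l : In o l -> nth (idx o l) l 0 = o.
Proof.
  induction l as [|a l IH]; [contradiction|]. cbn. destruct (Nat.eqb_spec o a) as [->|H]; [auto|].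
  intros [->|H']; [congruence|auto].
Qed.

Fixpoint power {A} (xs : list A) (n : nat) : list (list A) :=
  match n with 0 => [[]] | S n' => flat_map (fun a => map (cons a) (power xs n')) xs end.

Lemma in_power {A} (xs : list A) n l : In l (power xs n) <-> length l = n /\ incl l xs.
Proof.
  revert l; induction n as [|n IH]; intros l; cbn [power].
  - split.
    + intros [<-|[]]. split; [reflexivity|intros x []].
    + intros [H _]. apply length_zero_iff_nil in H as ->. now left.
  - rewrite in_flat_map. split.
    + intros (a & Ha & H). apply in_map_iff in H as (l' & <- & H). apply IH in H as [<- H].
      split; [reflexivity|]. intros x [<-|Hx]; auto.
    + destruct l as [|a l]; [intros [H _]; discriminate|]. intros [[= H] Hi]. exists a.
      split; [apply Hi; now left|]. apply in_map, IH. split; [assumption|]. intros x Hx. apply Hi. now right.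
Qed.

Definition nats (n : nat) : list Z := map Z.of_nat (seq 0 (S n)).

Lemma in_nats n z : In z (nats n) <-> (0 <= z <= Z.of_nat n)%Z.
Proof.
  unfold nats. rewrite in_map_iff. split.
  - intros (k & <- & Hk). apply in_seq in Hk. lia.
  - intros H. exists (Z.to_nat z). rewrite in_seq. lia.
Qed.

Lemma classic_filter {A} (P : A -> Prop) (l : list A) :
  exists l', length l' <= length l /\ forall x, In x l' <-> In x l /\ P x.
Proof.
  induction l as [|a l (l' & Hl & H)].
  - exists []. cbn. firstorder.
  - destruct (classic (P a)) as [Ha|Ha].
    + exists (a :: l'). cbn. split; [lia|]. intros x. rewrite H. split.
      * intros [<-|[? ?]]; auto.
      * intros [[<-|?] ?]; auto.
    + exists l'. cbn. split; [lia|]. intros x. rewrite H. split.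
      * intros [? ?]; auto.
      * intros [[<-|?] ?]; [contradiction|auto].
Qed.

Definition nobjs (f : natom) : list nat := snd (fst f).

Lemma nmap_id f g : (forall o, In o (nobjs g) -> f o = o) -> nmap f g = g.
Proof.
  destruct g as [[p os] t]. cbn. intros H. do 2 f_equal.
  rewrite <- (map_id os) at 2. apply map_ext_in. exact H.
Qed.

Lemma nmap_nmap f f' g : nmap f (nmap f' g) = nmap (fun o => f (f' o)) g.
Proof. destruct g as [[p os] t]. cbn. now rewrite map_map. Qed.

Lemma in_list_max x l : In x l -> x <= list_max l.
Proof. apply (proj1 (Forall_forall _ _) (proj1 (list_max_le l _) (Nat.le_refl _))). Qed.

Section Criterion.
Variable Q : query.
Hypothesis Q_wf : query_wf Q.
Hypothesis Q_nonrec : nonrecursive Q.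
Hypothesis Q_conn : connected Q.
Hypothesis Q_notime : no_time_points Q.

(** Bounds fixed by the query. [R] bounds the difference of two offsets, hence the factor 2. [N]
    bounds heights, [D0] the distance of a used fact from the goal, [M] the number of used facts.
    [W] gives room for the [a0] objects of the answer and those of [M] update facts, [nsym] for the
    constants and [W] fresh objects. *)
Let rs := map norm_rule (qprog Q).
Let c := S (list_max (flat_map (fun r => flat_map pconsts (ratoms r)) rs)).
Let V := S (list_max (flat_map (fun r => flat_map pvars (ratoms r)) rs)).
Let B := list_max (map (fun r : nrule => length (fst r)) rs).
Definition offsets (a : patom) : list nat := match ntime a with Some k => [Z.abs_nat k] | None => [] end.
Let R := 2 * list_max (flat_map (fun r => flat_map offsets (ratoms r)) rs).
Let N := length rs.
Let D0 := N * R.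
Let M := S B ^ N.
Let a0 := length (psorts (qpred Q)) - 1.
Let A := list_max (map (fun p => length (psorts p)) (body_preds rs)).
Let W := a0 + M * A.
Let nsym := c + W + 1.

Lemma consts_lt r a k : In r rs -> In a (ratoms r) -> In k (pconsts a) -> k < c.
Proof.
  intros Hr Ha Hk. unfold c. apply Nat.lt_succ_r, in_list_max. apply in_flat_map.
  exists r. split; [assumption|]. apply in_flat_map. eauto.
Qed.

Lemma vars_lt r a x : In r rs -> In a (ratoms r) -> In x (pvars a) -> x < V.
Proof.
  intros Hr Ha Hk. unfold V. apply Nat.lt_succ_r, in_list_max. apply in_flat_map.
  exists r. split; [assumption|]. apply in_flat_map. eauto.
Qed.

Lemma body_small r : In r rs -> length (fst r) <= B.
Proof. intros Hr. apply in_list_max. apply (in_map (fun r : nrule => length (fst r))). exact Hr. Qed.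

(** The second half of connectedness: a time variable of the body occurs in the head. *)
Lemma untimed r b : In r rs -> In b (fst r) -> ntime (snd r) = None -> ntime b = None.
Proof.
  intros Hr Hb. apply in_map_iff in Hr as (r0 & <- & Hr). cbn [norm_rule fst snd] in *.
  apply in_map_iff in Hb as (b0 & <- & Hb).
  destruct Q_wf as (Hwf & _). destruct (Forall_in Hwf r0 Hr) as (Ok1 & Ok2 & _).
  destruct (Forall_in Q_notime r0 Hr) as (Nt1 & Nt2).
  destruct (Forall_in Q_conn r0 Hr) as (_ & Hc).
  rewrite !norm_atom_time; try assumption;
    try exact (Forall_in Ok2 b0 Hb); try exact (Forall_in Nt2 b0 Hb).
  intros E. destruct (atom_tvars b0) as [|x l] eqn:Eb; [reflexivity|]. exfalso.
  assert (H : In x (flat_map atom_tvars (body r0))) by (apply in_flat_map; exists b0; rewrite Eb; cbn; auto).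
  apply Hc in H. rewrite E in H. exact H.
Qed.

Lemma rule_local r b : In r rs -> In b (fst r) ->
  match ntime (snd r), ntime b with
  | Some k, Some k' => (Z.abs (k - k') <= Z.of_nat R)%Z
  | None, Some _ => False
  | _, None => True
  end.
Proof.
  intros Hr Hb. pose proof (untimed r b Hr Hb) as Hu.
  assert (HR : forall a k, In a (ratoms r) -> ntime a = Some k -> 2 * Z.abs_nat k <= R).
  { intros a k Ha Hk. unfold R. apply Nat.mul_le_mono_l, in_list_max. apply in_flat_map.
    exists r. split; [assumption|]. apply in_flat_map. exists a. split; [assumption|].
    unfold offsets. rewrite Hk. now left. }
  destruct (ntime (snd r)) as [k|] eqn:E1, (ntime b) as [k'|] eqn:E2; auto.
  - pose proof (HR (snd r) k (or_introl eq_refl) E1). pose proof (HR b k' (or_intror Hb) E2). lia.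
  - specialize (Hu eq_refl). discriminate.
Qed.

Lemma rs_acyclic p : ~ clos_trans pred (ndep rs) p p.
Proof.
  intros H. apply (Q_nonrec p).
  assert (S1 : forall p p', ndep rs p p' -> depends (qprog Q) p p').
  { intros q q' (r & Hr & <- & b & Hb & <-). apply in_map_iff in Hr as (r0 & <- & Hr).
    apply in_map_iff in Hb as (b0 & <- & Hb). exists r0. split; [assumption|]. split; [reflexivity|]. eauto. }
  clear - H S1. revert H. generalize p at 2 4. intros p' H.
  induction H as [q q' H|q q' q'' _ IH1 _ IH2]; [apply t_step; auto|eapply t_trans; eauto].
Qed.

Lemma fixes_consts f : (forall k, k < c -> f k = k) -> fixes rs f.
Proof. intros H r a k Hr Ha Hk. apply H. eapply consts_lt; eauto. Qed.

Lemma answer_nder D tau os : is_dataset D ->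
  answer Q D tau os <-> nder rs (fun f => In f (map fact_natom D)) N (qpred Q, os, Some tau).
Proof.
  intros HD. unfold answer.
  change (qpred Q, map VObj os ++ [VTime tau]) with (gat (qpred Q, os, Some tau)).
  rewrite entails_nder; try assumption; [|apply Q_wf]. fold rs. split.
  - intros [n H]. eapply nder_bound; [apply rs_acyclic|exact H].
  - eauto.
Qed.

Definition domlist (i : instance) : list nat := dobjs (idata i) ++ map (symval c i) (seq 0 nsym).

Lemma in_domlist i o : In o (domlist i) <-> idom c nsym i o.
Proof.
  unfold domlist, idom. rewrite in_app_iff, in_map_iff. apply or_iff_compat_l. split.
  - intros (k & <- & Hk). apply in_seq in Hk. exists k. split; [lia|reflexivity].
  - intros (k & Hk & ->). exists k. rewrite in_seq. split; [reflexivity|lia].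
Qed.

Definition retract (i : instance) (o : nat) : nat :=
  if in_dec Nat.eq_dec o (domlist i) then o else symval c i 0.

Lemma retract_in i o : idom c nsym i (retract i o).
Proof.
  unfold retract. destruct (in_dec Nat.eq_dec o (domlist i)); [now apply in_domlist|].
  right. exists 0. split; [unfold nsym; lia|reflexivity].
Qed.

Lemma retract_id i o : idom c nsym i o -> retract i o = o.
Proof.
  intros H. unfold retract. destruct (in_dec Nat.eq_dec o (domlist i)) as [|N0]; [reflexivity|].
  exfalso. apply N0. now apply in_domlist.
Qed.

Lemma const_in_dom i k : k < c -> idom c nsym i k.
Proof. intros H. right. exists k. split; [unfold nsym; lia|]. symmetry. now apply symval_const. Qed.

Definition der_on (i : instance) (fg : bool) (us : list ufact) (e : list nat) (g : natom) : Prop :=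
  nderd rs V (idom c nsym i) (base_facts fg i us e) N g.

Lemma fact_objs_in_dom D o f : In f (map fact_natom D) -> In o (nobjs f) -> In o (dobjs D).
Proof. intros Hf Ho. apply dobjs_natoms. destruct f as [[p os] t]. eauto. Qed.

(** Restricting rule variables to [idom] loses nothing, because [retract] fixes the constants and
    all objects of the data, the update and the goal. *)
Lemma der_on_nder i fg us e g : Forall (idom c nsym i) e -> Forall (ufact_below (length e)) us ->
  (forall o, In o (nobjs g) -> idom c nsym i o) ->
  der_on i fg us e g <-> nder rs (base_facts fg i us e) N g.
Proof.
  intros He Hus Hg. split; [apply nderd_nder|]. intros H.
  rewrite <- (nmap_id (retract i) g) by (intros o Ho; apply retract_id; auto).
  apply nder_nderd; auto.
  - apply fixes_consts. intros k Hk. apply retract_id. now apply const_in_dom.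
  - apply retract_in.
  - intros h Hh. apply nmap_id. intros o Ho. apply retract_id. destruct Hh as [Hh|Hh].
    + left. apply (fact_objs_in_dom _ o h); [|assumption]. destruct fg; [|assumption].
      now apply restrict_natoms in Hh.
    + apply in_map_iff in Hh as ([[p xs] j] & <- & Hu). apply (Forall_in Hus) in Hu.
      unfold nobjs in Ho. cbn in Ho. apply in_map_iff in Ho as (x & <- & Hx).
      apply (Forall_in Hu) in Hx. apply (Forall_in He). now apply nth_In.
  - apply vars_lt.
Qed.

(** The goal is at most [D0] after [itmem], and a used fact is within [D0] of the goal; hence
    [2 * D0]. Update facts come after [itin], so their relative times are not negative. The last
    sort is the time, hence [length (psorts p) - 1] objects. *)
Definition ufacts : list ufact :=
  flat_map (fun p => flat_map (fun xs => map (fun j => (p, xs, j)) (nats (2 * D0)))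
    (power (seq 0 W) (length (psorts p) - 1))) (body_preds rs).

Definition updates : list (list ufact) := flat_map (power ufacts) (seq 0 (S M)).

Definition goal (i : instance) (e qx : list nat) (j : Z) : natom :=
  (qpred Q, map (oval e) (map OV qx), option_map (Z.add (itmem i)) (Some j)).

Definition ufact_ok (i : instance) (u : ufact) : Prop :=
  (pedb (npred u) = true /\ sorted_as (npred u) (length (snd (fst u))) true) /\ (itin i < itmem i + ntime u)%Z.

Definition witness (j : Z) (qx : list nat) (us : list ufact) (i : instance) (e : list nat) : Prop :=
  ((itout i <= itmem i + j)%Z /\ forall u, In u us -> ufact_ok i u) /\
  der_on i false us e (goal i e qx j) /\ ~ der_on i true us e (goal i e qx j).

(** Only the objects [e] depend on the instance. The tuple [qx] and the facts [us] are written with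
    indices into [e], so they range over lists fixed by the query. *)
Definition counterexample (i : instance) : Prop :=
  exists j, In j (nats D0) /\ exists qx, In qx (power (seq 0 W) a0) /\ exists us, In us updates /\
  exists e, length e = W /\ Forall (idom c nsym i) e /\ witness j qx us i e.

Lemma ufacts_below us : In us updates -> Forall (ufact_below W) us.
Proof.
  intros H. apply in_flat_map in H as (k & _ & H). apply in_power in H as [_ H].
  apply Forall_forall. intros u Hu. apply H in Hu. apply in_flat_map in Hu as (p & _ & Hu).
  apply in_flat_map in Hu as (xs & Hx & Hu). apply in_map_iff in Hu as (j & <- & _).
  apply in_power in Hx as [_ Hx]. apply Forall_forall. intros x Hin. apply Hx in Hin.
  apply in_seq in Hin. lia.
Qed.

Lemma odef_counterexample : odef c 0 (fun i _ => counterexample i).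
Proof.
  unfold counterexample.
  apply odef_exists_in.
  intros j _.
  apply odef_exists_in.
  intros qx Hqx.
  apply odef_exists_in.
  intros us Hus.
  eapply odef_ext with (P := fun i e => exists v, length v = W /\ Forall (idom c nsym i) v /\
    witness j qx us i (e ++ v)).
  2: { intros i [|] _ He; [reflexivity|discriminate]. }
  apply odef_ex_list. rewrite Nat.add_0_r.
  assert (Hts : Forall (ot_ok c W) (map OV qx)).
  { apply in_power in Hqx as [_ Hqx]. apply Forall_forall. intros t Ht. apply in_map_iff in Ht as (x & <- & Hx).
    apply Hqx, in_seq in Hx. cbn. lia. }
  assert (Hder : forall fg, odef c W (fun i e => der_on i fg us e (goal i e qx j))).
  { intros fg. apply (odef_nderd c nsym rs V consts_lt vars_lt untimed fg us W (ufacts_below us Hus) N W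
      (qpred Q) (map OV qx) (Some j)); auto. }
  unfold witness. apply odef_and; [|apply odef_and; [apply Hder|apply odef_not, Hder]].
  apply odef_and; [apply (odef_dec c W (fun i => itout i <= itmem i + j)%Z); intros; apply dec_tout|].
  apply odef_forall_in. intros u _. unfold ufact_ok.
  apply odef_and; [apply odef_const|].
  apply (odef_dec c W (fun i => itin i < itmem i + ntime u)%Z). intros; apply dec_tin.
Qed.

Lemma base_facts_dataset fg i us e f U : map fact_natom U = map (ufact_natom i e) us ->
  base_facts fg i us e f <->
  In f (map fact_natom ((if fg then restrict (idata i) (itmem i) else idata i) ++ U)).
Proof. intros E. unfold base_facts. now rewrite map_app, in_app_iff, E. Qed.

Lemma restrict_dataset D tau : is_dataset D -> is_dataset (restrict D tau).
Proof. intros H. unfold is_dataset, restrict. apply incl_Forall with (2 := H). apply incl_filter. Qed.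

Lemma nder_iff_base I I' n g : (forall f, I f <-> I' f) -> nder rs I n g <-> nder rs I' n g.
Proof. intros H. split; apply nder_mono; try lia; apply H. Qed.

Lemma counterexample_sound i : valid_instance i -> counterexample i -> ~ Forget Q i.
Proof.
  intros Hi (j & Hj & qx & Hqx & us & Hus & e & He & Fe & (Hout & Hok) & H1 & H2) HF.
  pose proof (ufacts_below us Hus) as Hb. rewrite <- He in Hb.
  set (U := map (fun u : ufact => mk_fact (npred u) (map (fun x => nth x e 0) (snd (fst u))) (Some (itmem i + ntime u)%Z)) us).
  assert (EU : map fact_natom U = map (ufact_natom i e) us).
  { unfold U. rewrite map_map. apply map_ext. intros [[p xs] k]. apply fact_natom_mk. }
  assert (HU : is_update (itin i) U).
  { split; apply Forall_forall; intros a Ha; unfold U in Ha; apply in_map_iff in Ha as (u & <- & Hu);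
      destruct (Hok u Hu) as ((He1 & Hs) & Ht).
    - split; [|exact He1]. apply mk_fact_is_fact. now rewrite length_map.
    - split.
      + exists (repeat SObj (length (snd (fst u)))). split; [exact Hs|].
        apply Forall_forall. intros s Hin. now apply repeat_spec in Hin.
      + exists (itmem i + ntime u)%Z. split; [|exact Ht].
        pose proof (fact_natom_mk (npred u) (map (fun x => nth x e 0) (snd (fst u))) (Some (itmem i + ntime u)%Z)) as E.
        now injection E. }
  assert (HD : is_dataset (idata i)) by apply Hi.
  assert (Hg : forall o, In o (nobjs (goal i e qx j)) -> idom c nsym i o).
  { intros o Ho. unfold nobjs, goal in Ho. cbn in Ho. rewrite map_map in Ho.
    apply in_map_iff in Ho as (x & <- & Hx). apply in_power in Hqx as [_ Hqx]. apply Hqx, in_seq in Hx.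
    apply (Forall_in Fe). apply nth_In. lia. }
  assert (Hans : forall fg, der_on i fg us e (goal i e qx j) <->
    answer Q ((if fg then restrict (idata i) (itmem i) else idata i) ++ U) (itmem i + j)
      (map (oval e) (map OV qx))).
  { intros fg. rewrite der_on_nder by assumption. rewrite answer_nder.
    - apply nder_iff_base. intros f. now apply base_facts_dataset.
    - apply Forall_app. split; [|apply HU]. destruct fg; [now apply restrict_dataset|assumption]. }
  apply H2, (Hans true). apply (HF U (itmem i + j)%Z HU); [lia|]. now apply (Hans false).
Qed.

Lemma nder_inv (I : natom -> Prop) n f : nder rs I n f ->
  I f \/ exists r vo s, In r rs /\ peval vo s (snd r) = f.
Proof.
  destruct n; [intros [H|[]]; auto|]. rewrite nder_step. intros [H|(r & vo & s & H1 & H2 & _)]; [auto|].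
  right. eauto.
Qed.

(** The query predicate is IDB, so an answer is not a fact of the dataset but an instance of a
    well-sorted rule head. *)
Lemma answer_length D tau os n : is_dataset D ->
  nder rs (fun f => In f (map fact_natom D)) n (qpred Q, os, Some tau) -> length os = a0.
Proof.
  intros HD H. apply nder_inv in H as [H|(r & vo & s & Hr & Hg)].
  - exfalso. apply fact_natom_in in H as (He & _); [|assumption]. destruct Q_wf as (_ & Hq & _). congruence.
  - apply in_map_iff in Hr as (r0 & <- & Hr). cbn [norm_rule snd] in Hg.
    destruct Q_wf as (Hwf & _). destruct (Forall_in Hwf r0 Hr) as (Ok1 & _).
    destruct (Forall_in Q_notime r0 Hr) as (Nt1 & _).
    pose proof (norm_atom_sorted _ Ok1 Nt1) as Hs.
    assert (Hp : npred (norm_atom (Defs.head r0)) = apred (Defs.head r0)) by reflexivity.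
    destruct (norm_atom (Defs.head r0)) as [[p ts] jo]. cbn [peval] in Hg. injection Hg as -> <- Hj.
    unfold npred, ntime in *. cbn [fst snd] in *. rewrite <- Hp in Hs.
    unfold a0. rewrite Hs, length_map, length_app, repeat_length.
    destruct jo; [|discriminate]. cbn. lia.
Qed.

Lemma flat_map_length_le {X Y} (h : X -> list Y) l k : (forall x, In x l -> length (h x) <= k) ->
  length (flat_map h l) <= length l * k.
Proof.
  induction l as [|x l IH]; intros H; cbn; [lia|]. rewrite length_app.
  specialize (IH (fun y Hy => H y (or_intror Hy))). specialize (H x (or_introl eq_refl)). lia.
Qed.

Lemma counterexample_complete i : valid_instance i -> ~ Forget Q i -> counterexample i.
Proof.
  intros Hi HF. assert (HD : is_dataset (idata i)) by apply Hi.
  assert (HDt := Hi). destruct HDt as ((_ & Hhist) & Hmo & Hoi).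
  (* By monotonicity forgetting can only lose answers, so a failure of [Forget] is a lost answer. *)
  assert (exists U tau os, is_update (itin i) U /\ (itout i <= tau)%Z /\
    answer Q (idata i ++ U) tau os /\ ~ answer Q (restrict (idata i) (itmem i) ++ U) tau os)
    as (U & tau & os & HU & Htau & Hans & Hnans).
  { apply NNPP. intros N0. apply HF. intros U tau HU Htau os. split.
    - intros H1. apply NNPP. intros H2. apply N0. eauto 10.
    - assert (HDU : is_dataset (idata i ++ U)) by (apply Forall_app; split; [assumption|apply HU]).
      assert (HDU' : is_dataset (restrict (idata i) (itmem i) ++ U))
        by (apply Forall_app; split; [now apply restrict_dataset|apply HU]).
      rewrite !answer_nder by assumption. apply nder_mono; [|lia]. intros f.
      rewrite !map_app, !in_app_iff. intros [H|H]; [left; now apply restrict_natoms in H|now right]. }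
  assert (HDU : is_dataset (idata i ++ U)) by (apply Forall_app; split; [assumption|apply HU]).
  assert (HDU' : is_dataset (restrict (idata i) (itmem i) ++ U))
    by (apply Forall_app; split; [now apply restrict_dataset|apply HU]).
  apply answer_nder in Hans; [|assumption]. rewrite answer_nder in Hnans by assumption.
  set (g := (qpred Q, os, Some tau) : natom) in *.
  assert (Hlen : length os = a0) by exact (answer_length _ _ _ _ HDU Hans).
  destruct (nder_support rs B R body_small rule_local _ N g Hans) as (F & LF & PF & DF).
  (* Some used fact is forgotten, so its time [t0] is at most [itmem i], while
     [tau >= itout i >= itmem i]; as [tau] and [t0] differ by at most [D0], so do [tau] and
     [itmem i]. *)
  assert (Hj : In (tau - itmem i)%Z (nats D0)).
  { assert (exists f0, In f0 F /\ ~ In f0 (map fact_natom (restrict (idata i) (itmem i) ++ U))) as (f0 & Hf0 & Nf0).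
    { apply NNPP. intros N0. apply Hnans. eapply nder_mono; [|reflexivity|exact DF].
      intros f Hf. apply NNPP. intros Nf. apply N0. exists f. auto. }
    destruct (PF f0 Hf0) as (If0 & Near & _). rewrite map_app, in_app_iff in If0, Nf0.
    destruct If0 as [If0|If0]; [|tauto]. rewrite restrict_natoms in Nf0. unfold near in Near.
    destruct (ntime f0) as [t0|]; [|tauto]. destruct Near as (t & [= <-] & Ht). fold D0 in Ht.
    apply in_nats. assert (~ (itmem i < t0)%Z) by tauto. lia. }
  (* Only the update facts used by the derivation are kept; dropping the others cannot create a
     derivation from the restricted data. *)
  destruct (classic_filter (fun f => In f (map fact_natom U)) F) as (FU & LFU & HFU).
  assert (PFU : forall f, In f FU -> exists p xs t, f = (p, xs, Some t) /\ pedb p = true /\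
    sorted_as p (length xs) true /\ (itin i < t)%Z /\ In (t - itmem i)%Z (nats (2 * D0)) /\ In p (body_preds rs)).
  { intros f Hf. apply HFU in Hf as [Hf HfU]. destruct (PF f Hf) as (_ & Near & Hp).
    assert (HfU' := HfU). apply in_map_iff in HfU' as (a & Ea & Ha).
    destruct HU as [HUd HUt]. destruct (Forall_in HUt a Ha) as (_ & t & Et & Ht).
    destruct f as [[p xs] t1]. unfold fact_natom in Ea. injection Ea as E1 E2 E3. rewrite Et in E3. subst t1.
    apply fact_natom_in in HfU as (He & Hs & _); [|assumption].
    exists p, xs, t. unfold near, ntime in Near. cbn [snd g] in Near. destruct Near as (t' & [= <-] & Hn).
    fold D0 in Hn. apply in_nats in Hj. rewrite in_nats. repeat split; auto; try lia.
    (* An update fact is EDB and the query predicate is not, so the fact is not the goal itself and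
       matches a body atom. *)
    destruct Hp as [Hp|Hp]; [|exact Hp]. exfalso. unfold npred in Hp. cbn in Hp. subst p.
    destruct Q_wf as (_ & Hq & _). congruence. }
  set (O := os ++ flat_map nobjs FU).
  assert (LO : length O <= W).
  { unfold O, W. rewrite length_app, Hlen. apply Nat.add_le_mono_l.
    etransitivity; [apply (flat_map_length_le nobjs FU A)|apply Nat.mul_le_mono_r; unfold M; lia].
    intros f Hf. destruct (PFU f Hf) as (p & xs & t & -> & _ & Hs & _ & _ & Hp).
    unfold nobjs; cbn [fst snd]. etransitivity; [|apply in_list_max, (in_map (fun p => length (psorts p))), Hp].
    rewrite Hs, length_app, repeat_length. lia. }
  (* These objects keep their names; the numbers below [c] include all constants of the rules. *)
  set (known := fun o => In o (dobjs (idata i)) \/ o < c).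
  destruct (classic_filter (fun o => ~ known o) O) as (E0 & _ & HE0).
  set (E := nodup Nat.eq_dec E0).
  assert (HE : forall o, In o E <-> In o O /\ ~ known o) by (intros o; unfold E; rewrite nodup_In; apply HE0).
  assert (LE : length E <= length O).
  { apply NoDup_incl_length; [apply NoDup_nodup|]. intros o Ho. now apply HE in Ho. }
  (* The unknown objects of [U] are renamed to fresh symbolic objects by [f], with left inverse [f']. *)
  set (f := fun o => if idx o E <? length E then symval c i (c + idx o E) else o).
  set (fresh := map (fun k => symval c i (c + k)) (seq 0 (length E))).
  set (f' := fun o => if idx o fresh <? length E then nth (idx o fresh) E 0 else o).
  assert (Lfresh : length fresh = length E) by (unfold fresh; now rewrite length_map, length_seq).
  assert (Ffresh : forall o, In o fresh <-> exists k, k < length E /\ o = symval c i (c + k)).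
  { intros o. unfold fresh. rewrite in_map_iff. split.
    - intros (k & <- & Hk). apply in_seq in Hk. exists k. split; [lia|reflexivity].
    - intros (k & Hk & ->). exists k. rewrite in_seq. split; [reflexivity|lia]. }
  assert (fk : forall o, known o -> f o = o).
  { intros o Ho. unfold f. destruct (Nat.ltb_spec (idx o E) (length E)) as [H|H]; [|reflexivity].
    apply idx_lt, HE in H. tauto. }
  assert (f'k : forall o, known o -> f' o = o).
  { intros o Ho. unfold f'. destruct (Nat.ltb_spec (idx o fresh) (length E)) as [H|H]; [|reflexivity].
    exfalso. rewrite <- Lfresh in H. apply idx_lt, Ffresh in H as (k & _ & ->).
    destruct Ho as [Ho|Ho]; [exact (symval_fresh c i (c + k) (Nat.le_add_r _ _) Ho)|].
    unfold symval in Ho. destruct (Nat.ltb_spec (c + k) c); lia. }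
  assert (f'f : forall o, In o O -> f' (f o) = o).
  { intros o Ho. destruct (classic (known o)) as [Hk|Hk]; [rewrite fk, f'k by assumption; reflexivity|].
    assert (HoE : In o E) by (apply HE; auto). assert (Hlt := proj2 (idx_lt o E) HoE).
    unfold f. rewrite (proj2 (Nat.ltb_lt _ _) Hlt).
    assert (HF' : In (symval c i (c + idx o E)) fresh) by (apply Ffresh; eauto).
    pose proof (proj2 (idx_lt _ _) HF') as H. rewrite Lfresh in H. unfold f'.
    rewrite (proj2 (Nat.ltb_lt _ _) H). pose proof (nth_idx _ _ HF') as H2. unfold fresh in H2 at 2.
    rewrite nth_indep with (d' := symval c i (c + 0)) in H2 by (fold fresh; lia).
    rewrite (map_nth (fun k => symval c i (c + k))), seq_nth in H2 by assumption.
    apply symval_inj in H2. replace (idx (symval c i (c + idx o E)) fresh) with (idx o E) by lia.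
    now apply nth_idx. }
  assert (fdom : forall o, In o O -> idom c nsym i (f o)).
  { intros o Ho. destruct (classic (known o)) as [Hk|Hk].
    - rewrite fk by assumption. destruct Hk as [Hk|Hk]; [now left|now apply const_in_dom].
    - assert (HoE : In o E) by (apply HE; auto). assert (Hlt := proj2 (idx_lt o E) HoE).
      unfold f. rewrite (proj2 (Nat.ltb_lt _ _) Hlt). right. exists (c + idx o E).
      split; [unfold nsym; lia|reflexivity]. }
  (* The renamed objects, padded to the fixed length [W]; below, [ix] translates objects into
     positions in this list. *)
  set (e := map f O ++ repeat (symval c i 0) (W - length O)).
  assert (He : length e = W) by (unfold e; rewrite length_app, length_map, repeat_length; lia).
  assert (Fe : Forall (idom c nsym i) e).
  { unfold e. apply Forall_app. split; apply Forall_forall; intros o Ho.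
    - apply in_map_iff in Ho as (o' & <- & Ho). now apply fdom.
    - apply repeat_spec in Ho as ->. right. exists 0. split; [unfold nsym; lia|reflexivity]. }
  assert (Hnth : forall o, In o O -> nth (idx o O) e 0 = f o).
  { intros o Ho. pose proof (proj2 (idx_lt o O) Ho) as H. unfold e.
    rewrite app_nth1 by (now rewrite length_map).
    rewrite nth_indep with (d' := f 0) by (now rewrite length_map). rewrite map_nth. now rewrite nth_idx. }
  set (ix := map (fun o => idx o O)).
  assert (Hix : forall xs, incl xs O -> map (fun x => nth x e 0) (ix xs) = map f xs).
  { intros xs Hxs. unfold ix. rewrite map_map. apply map_ext_in. intros o Ho. auto. }
  assert (Pix : forall xs, incl xs O -> In (ix xs) (power (seq 0 W) (length xs))).
  { intros xs Hxs. apply in_power. unfold ix. rewrite length_map. split; [reflexivity|].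
    intros k Hk. apply in_map_iff in Hk as (o & <- & Ho). apply Hxs, idx_lt in Ho. apply in_seq. lia. }
  set (us := map (fun h : natom => (npred h, ix (nobjs h),
    match ntime h with Some t => (t - itmem i)%Z | None => 0%Z end)) FU).
  assert (HObj : forall h, In h FU -> incl (nobjs h) O).
  { intros h Hh o Ho. apply in_or_app. right. apply in_flat_map. eauto. }
  assert (Eus : map (ufact_natom i e) us = map (nmap f) FU).
  { unfold us. rewrite map_map. apply map_ext_in. intros h Hh. pose proof (HObj h Hh) as Ho.
    destruct (PFU h Hh) as (p & xs & t & -> & _). cbn in *. rewrite Hix by assumption. do 2 f_equal. lia. }
  assert (Hus : In us updates).
  { apply in_flat_map. exists (length FU). split; [apply in_seq; unfold M; lia|]. apply in_power.
    split; [unfold us; apply length_map|]. intros u Hu. apply in_map_iff in Hu as (h & <- & Hh).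
    pose proof (HObj h Hh) as Ho. destruct (PFU h Hh) as (p & xs & t & -> & _ & Hs & _ & Ht & Hp).
    unfold ufacts, npred, nobjs, ntime in *. cbn [fst snd] in *.
    apply in_flat_map. exists p. split; [assumption|]. apply in_flat_map. exists (ix xs). split.
    - replace (length (psorts p) - 1) with (length xs); [now apply Pix|].
      rewrite Hs, length_app, repeat_length. cbn. lia.
    - now apply (in_map (fun j => (p, ix xs, j))). }
  assert (HosO : incl os O) by (intros o Ho; apply in_or_app; now left).
  assert (Eg : goal i e (ix os) (tau - itmem i) = nmap f g).
  { unfold goal, g. cbn. rewrite map_map. cbn. rewrite Hix by assumption. do 2 f_equal. lia. }
  assert (Hb : Forall (ufact_below (length e)) us) by (rewrite He; now apply ufacts_below).
  assert (Hgdom : forall o, In o (nobjs (nmap f g)) -> idom c nsym i o).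
  { intros o Ho. cbn in Ho. apply in_map_iff in Ho as (o' & <- & Ho). auto. }
  exists (tau - itmem i)%Z. split; [assumption|]. exists (ix os). split; [rewrite <- Hlen; now apply Pix|].
  exists us. split; [assumption|]. exists e. split; [assumption|]. split; [assumption|].
  split; [split|split].
  - lia.
  - intros u Hu. apply in_map_iff in Hu as (h & <- & Hh).
    destruct (PFU h Hh) as (p & xs & t & -> & He1 & Hs & Ht & _). unfold ufact_ok, npred, nobjs, ntime, ix.
    cbn [fst snd]. rewrite length_map. repeat split; auto. lia.
  (* Renaming by [f] carries the derivation from the full data over to the coded update. *)
  - rewrite Eg. apply der_on_nder; auto. eapply nder_map; [|intros h Hh|exact DF].
    + apply fixes_consts. intros k Hk. apply fk. now right.
    + destruct (PF h Hh) as (Ih & _). rewrite map_app, in_app_iff in Ih. destruct Ih as [Ih|Ih].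
      * left. rewrite nmap_id; [assumption|]. intros o Ho. apply fk. left. eapply fact_objs_in_dom; eauto.
      * right. rewrite Eus. apply in_map, HFU. auto.
  (* A derivation from the restricted data and the coded update would be carried back by [f'] to one
     from the restricted data and [U]. *)
  - rewrite Eg. intros H. apply der_on_nder in H; auto. apply Hnans.
    rewrite <- (nmap_id (fun o => f' (f o)) g) by (intros o Ho; apply f'f, HosO, Ho).
    rewrite <- nmap_nmap. eapply nder_map; [|intros h Hh|exact H].
    + apply fixes_consts. intros k Hk. apply f'k. now right.
    + rewrite map_app, in_app_iff. destruct Hh as [Hh|Hh].
      * left. rewrite nmap_id; [assumption|]. intros o Ho. apply f'k. left.
        apply restrict_natoms in Hh as [Hh _]. eapply fact_objs_in_dom; eauto.
      * right. rewrite Eus in Hh. apply in_map_iff in Hh as (h0 & <- & Hh0). rewrite nmap_nmap, nmap_id.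
        -- now apply HFU in Hh0.
        -- intros o Ho. apply f'f. eapply HObj; eauto.
Qed.

Lemma forget_ptime : ptime_decidable valid_instance enc (Forget Q).
Proof.
  (* [counterexample] has no free objects, so the program starts with the empty list of kinds and no
     input pointers. *)
  destruct (odef_not c 0 _ odef_counterexample [] eq_refl) as [prog Hprog].
  apply (cmd_ptime valid_instance enc (Forget Q) prog enc_instance_sym enc_instance_nil).
  intros i Hi. destruct (Hprog i (fun _ => 0) Hi) as (b & s' & E & _ & Hb); [intros p; lia|].
  exists b, s'. split; [assumption|]. rewrite Hb. split.
  - intros (_ & _ & H). apply NNPP. intros N0. now apply H, counterexample_complete.
  - intros H. exists []. split; [split; [reflexivity|cbn; lia]|]. intros H'. now apply counterexample_sound in H'.
Qed.

End Criterion.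

Theorem theorem9 :
  forall Q : query,
    query_wf Q -> temporal_query Q -> nonrecursive Q -> connected Q -> no_time_points Q ->
    ptime_decidable valid_instance enc_instance (Forget Q).
Proof. intros Q H1 _ H2 H3 H4. exact (forget_ptime Q H1 H2 H3 H4). Qed.
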